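(* Suppose $P(V_1>x)\sim L(x)x^{-\alpha}$ as $x\to\infty$, where $\alpha>2$ and $L$ is slowly varying, and let $\mu=E[X_1]=E[V_1^2]/(2E[V_1])$ and $\gamma(x,\rho)=1-\rho^{x/\mu}-\rho^{x/\mu}(1-\rho)x/\mu$. Then $$\sup_{0<\rho<1}\left|\frac{P(W_\infty(\rho)>x)}{\frac{\rho}{1-\rho}\,\gamma(x,\rho)\,P(X_1>x)+\rho^{x/\mu}}-1\right|\to 0\quad\text{as } x\to\infty.$$ Alternatively (that is, also), $$\sup_{x\ge 0}\left|\frac{P(W_\infty(\rho)>x)}{\frac{\rho}{1-\rho}\,\gamma(x,\rho)\,P(X_1>x)+\rho^{x/\mu}}-1\right|\to 0\quad\text{as } \rho\nearrow 1.$$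
   Context: Setting: for $\rho\in(0,1)$, $W_\infty(\rho)$ is the steady-state waiting time (exclusive of service) in the M/G/1 first-in first-out queue with i.i.d. nonnegative processing times $V_n$ (whose distribution does not depend on $\rho$) and an independent Poisson arrival process of rate $\lambda=\rho/E[V_1]$. Let $X_1,X_2,\dots$ be i.i.d. with density $g(t)=P(V_1>t)/E[V_1]$ on $(0,\infty)$, and $S_0=0$, $S_n=X_1+\cdots+X_n$. The distribution of $W_\infty(\rho)$ is given by the Pollaczek--Khintchine formula $$P(W_\infty(\rho)>x)=\sum_{n=0}^\infty(1-\rho)\rho^n P(S_n>x),\qquad x\ge 0.$$ Here $f(x)\sim h(x)$ means $f(x)/h(x)\to1$. *)

(* Defs.v *)
From HB Require Import structures.
From mathcomp Require Import all_boot all_order all_algebra.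
From mathcomp Require Import all_classical all_reals all_analysis.

Set Implicit Arguments.
Unset Strict Implicit.
Unset Printing Implicit Defensive.

Import Order.TTheory GRing.Theory Num.Theory.
Import numFieldNormedType.Exports.

Local Open Scope classical_set_scope.
Local Open Scope ring_scope.

Section random_variables.
Context d (T : measurableType d) (R : realType) (P : probability T R).

Definition mutually_independent (I : eqType) (X : I -> {RV P >-> R}) : Prop :=
  forall (s : seq I) (B : I -> set R), uniq s ->
    (forall i, measurable (B i)) ->
    P (\bigcap_(i in [set` s]) (X i @^-1` B i)) =
    (\prod_(i <- s) P (X i @^-1` B i))%E.

Definition identically_distributed (X : nat -> {RV P >-> R}) : Prop :=
  forall n (B : set R), measurable B ->
    distribution P (X n) B = distribution P (X 0%N) B.

Definition iid (X : nat -> {RV P >-> R}) : Prop :=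
  mutually_independent X /\ identically_distributed X.

Definition has_density (X : {RV P >-> R}) (g : R -> R) : Prop :=
  forall B : set R, measurable B ->
    distribution P X B = (\int[lebesgue_measure]_(t in B) (g t)%:E)%E.

Definition tail (X : {RV P >-> R}) (x : R) : R := fine (@ccdf _ T R P X x).

Definition mean (X : {RV P >-> R}) : R := fine 'E_P[X].

Definition equilibrium_density (V : {RV P >-> R}) : R -> R :=
  (fun t => tail V t / mean V) \_ `]0, +oo[.

(* Lindley's recursion: [V n] is the processing time of customer [n] and
   [A n] is the time between the arrivals of customers [n] and [n.+1]. *)
Fixpoint waiting_time (W0 : T -> R) (V A : nat -> T -> R) (n : nat) : T -> R :=
  if n is m.+1 then
    fun w => Num.max (waiting_time W0 V A m w + V m w - A m w) 0
  else W0.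

Definition queue_inputs (W0 : {RV P >-> R}) (V A : nat -> {RV P >-> R})
    (i : option (nat + nat)) : {RV P >-> R} :=
  match i with
  | None => W0
  | Some (inl n) => V n
  | Some (inr n) => A n
  end.

(* [W] has the stationary law of the waiting times (exclusive of service) in
   the first-in first-out single-server queue with processing times [V] and
   Poisson arrivals of rate [lambda], the Poisson process being given by its
   i.i.d. exponential interarrival times [A]: if customer 0 waits [W],
   independently of [V] and [A], then all customers wait a time distributed
   as [W]. *)
Definition MG1_steady_state_waiting_time (lambda : R)
    (V A : nat -> {RV P >-> R}) (W : {RV P >-> R}) : Prop :=
  [/\ iid V,
      (forall n (B : set R), measurable B ->
         distribution P (A n) B = exponential_prob lambda B),
      mutually_independent (queue_inputs W V A) &
      forall n (B : set R), measurable B ->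
        P (waiting_time W V A n @^-1` B) = distribution P W B].

End random_variables.

Section approximation.
Context (R : realType).

Definition slowly_varying (L : R -> R) : Prop :=
  [/\ measurable_fun (`]0, +oo[ : set R) L,
      (\forall x \near +oo, 0 < L x) &
      forall t, 0 < t -> L (t * x) / L x @[x --> +oo] --> (1 : R)].

Definition asymp_equal (f h : R -> R) : Prop :=
  f x / h x @[x --> +oo] --> (1 : R).

Definition gamma (mu x rho : R) : R :=
  1 - rho `^ (x / mu) - rho `^ (x / mu) * ((1 - rho) * x / mu).

Definition waiting_tail_approx (FX : R -> R) (mu x rho : R) : R :=
  rho / (1 - rho) * gamma mu x rho * FX x + rho `^ (x / mu).

End approximation.

(* Main.v *)
Require Import Defs.
From HB Require Import structures.
From mathcomp Require Import all_boot all_order all_algebra.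
From mathcomp Require Import all_classical all_reals all_analysis.
From mathcomp Require Import measurable_realfun.
From mathcomp Require Import ring lra.

Set Implicit Arguments.
Unset Strict Implicit.
Unset Printing Implicit Defensive.

Import Order.TTheory GRing.Theory Num.Theory.
Import numFieldNormedType.Exports.

Local Open Scope classical_set_scope.
Local Open Scope ring_scope.

(** Write F for the tail of X_1, G_n for that of S_n and H for that of the
    stationary waiting time W.  Under Lindley's recursion the level v is crossed
    downwards at rate lambda P(W + V - A <= v < W + V), because the exponential
    density is lambda times its tail; stationarity equates this with the rate
    of upward crossings lambda P(W <= v < W + V) ([level_crossing],
    [crossing_stationary]).  Integrated over v this is the renewal equation
    H(x) = rho E H(x - X_1) for x >= 0, with H = 1 on the negative half-line
    ([renewal_equation]).  Iterating it gives, for every N, the two-sided bound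
      sum_(n < N) (1 - rho) rho^n G_n(x) + rho^N G_N(x) <= H(x)
        <= sum_(n < N) (1 - rho) rho^n G_n(x) + rho^N
    ([renewal_lower], [renewal_upper]), a truncated form of the
    Pollaczek--Khintchine series whose truncation N is free to depend on x.

    The tail F is proportional to the integral of the tail of V, hence regularly
    varying of index k = alpha - 1 > 1 ([equilibrium_regularly_varying]), and
    X_1 has a moment of some order p with 1 < p <= 2 and p < k.  Inductions on n
    bound G_n by truncated exponential moments ([jump_tail_truncated],
    [jump_tail_one_big_jump], [jump_tail_laplace]), and with 1/p < r < 1 they
    yield, uniformly in n as x tends to infinity:
    - G_n(x) = (1 + o(1)) n F(x) for n <= eps x, the sum being large because a
      single summand is ([one_big_jump_bound], [lower_bound_small]);
    - G_n(x) <= C n F(x) while n mu stays below a fraction of x, and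
      G_n(x) <= x^(- tau) while n mu <= x - x^r ([moderate_bound],
      [near_mean_bound]);
    - G_n(x) = 1 - o(1) for x + x^r <= n mu <= 2 x ([lower_tail_bound]).

    So H(x) consists of the sum of (1 - rho) rho^n n F(x) over small n, at most
    rho / (1 - rho) F(x), and of the geometric mass beyond x / mu, which is
    rho^(x / mu).  Let theta = - ln rho.  If theta x is large against ln x, then
    rho^(eps x) is negligible against F(x) and the first contribution is alone.
    If theta x is large but O(ln x), both may count; the geometric mean is then
    attained by small n, gamma is close to 1, and the window of width x^r around
    x / mu has no influence because theta x^r tends to 0.  If theta x is bounded,
    then rho^(x / mu) is bounded below while gamma keeps the other term of order
    x F(x), which tends to 0.  The bounds agree in the three regimes
    ([uniform_bounds]), whence the first supremum.

    For the second one, these bounds serve for x >= x0, and on [0, x0] both the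
    tail of W and its approximation tend to 1 as rho tends to 1
    ([bounded_range_bounds]). *)

(** * Independence and integrated tails *)

Section joint.
Context d (T : measurableType d) (R : realType) (P : probability T R).

Definition rv_of d' (T' : measurableType d') (f : T -> T')
  (mf : measurable_fun setT f) : {RV P >-> T'} := mfun_Sub (mem_set mf).

(** The product rule on rectangles determines the joint law, as rectangles are
    stable under intersection and generate the product. *)
Lemma distribution_pair d1 d2 (T1 : measurableType d1) (T2 : measurableType d2)
    (X : {RV P >-> T1}) (Y : {RV P >-> T2}) :
  (forall B C, measurable B -> measurable C ->
     P (X @^-1` B `&` Y @^-1` C) = (P (X @^-1` B) * P (Y @^-1` C))%E) ->
  forall C, measurable C -> P ((fun w => (X w, Y w)) @^-1` C) =
    (distribution P X \x distribution P Y)%E C.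
Proof.
move=> h C mC.
have mXY : measurable_fun setT (fun w => (X w, Y w)).
  exact: measurable_fun_pair.
apply/esym; rewrite (@product_measure_unique _ _ _ _ _ (distribution P X)
  (distribution P Y) (distribution P (rv_of mXY)))//.
Qed.

(** For a fixed D both sides are finite measures in C that agree on rectangles.
    This makes W + V independent of A. *)
Lemma indep_pair d1 d2 d3 (T1 : measurableType d1) (T2 : measurableType d2)
    (T3 : measurableType d3)
    (X : {RV P >-> T1}) (Y : {RV P >-> T2}) (Z : {RV P >-> T3}) :
  (forall B C D, measurable B -> measurable C -> measurable D ->
     P (X @^-1` B `&` Y @^-1` C `&` Z @^-1` D) =
     (P (X @^-1` B) * P (Y @^-1` C) * P (Z @^-1` D))%E) ->
  forall C D, measurable C -> measurable D ->
   P ((fun w => (X w, Y w)) @^-1` C `&` Z @^-1` D) =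
   (P ((fun w => (X w, Y w)) @^-1` C) * P (Z @^-1` D))%E.
Proof.
move=> h C D mC mD.
have mZD : measurable (Z @^-1` D) by exact: measurable_funPTI.
have c0 : (0 <= fine (P (Z @^-1` D)))%R by exact: fine_ge0.
have cE : (fine (P (Z @^-1` D)))%:E = P (Z @^-1` D).
  by rewrite fineK// fin_num_measure.
have mXY : measurable_fun setT (fun w => (X w, Y w)).
  exact: measurable_fun_pair.
pose m2 := mscale (NngNum c0) (distribution P X).
rewrite distribution_pair//; last first.
  move=> B E mB mE; have := h B E setT mB mE measurableT.
  by rewrite preimage_setT setIT probability_setT mule1.
transitivity ((m2 \x distribution P Y)%E C).
  apply/esym; rewrite (@product_measure_unique _ _ _ _ _ m2 (distribution P Y)
    (pushforward (mrestr P mZD) (fun w => (X w, Y w))))// => B E mB mE.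
  change (P (X @^-1` B `&` Y @^-1` E `&` Z @^-1` D) =
    ((fine (P (Z @^-1` D)))%:E * P (X @^-1` B) * P (Y @^-1` E))%E).
  by rewrite cE -muleA muleC -h.
rewrite (@product_measure_unique _ _ _ _ _ m2 (distribution P Y)
  (mscale (NngNum c0) (distribution P X \x distribution P Y)%E))//.
  change ((fine (P (Z @^-1` D)))%:E * (distribution P X \x distribution P Y)%E C =
    (distribution P X \x distribution P Y)%E C * P (Z @^-1` D))%E.
  by rewrite cE muleC.
move=> B E mB mE.
change ((fine (P (Z @^-1` D)))%:E * (distribution P X \x distribution P Y)%E (B `*` E) =
    ((fine (P (Z @^-1` D)))%:E * P (X @^-1` B) * P (Y @^-1` E)))%E.
by rewrite product_measure1E// muleA.
Qed.
End joint.

Section measurable_comparisons.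
Context d (T : measurableType d) (R : realType).
Implicit Types f g : T -> R.

Lemma measurable_set_lt f g : measurable_fun setT f -> measurable_fun setT g ->
  measurable [set x | f x < g x].
Proof.
move=> mf mg; have := measurable_fun_ltr mf mg.
by move=> /(_ measurableT [set true]); rewrite setTI; exact.
Qed.

Lemma measurable_set_le f g : measurable_fun setT f -> measurable_fun setT g ->
  measurable [set x | f x <= g x].
Proof.
move=> mf mg; have := measurable_fun_ler mf mg.
by move=> /(_ measurableT [set true]); rewrite setTI; exact.
Qed.

End measurable_comparisons.

Section layer_cake.
Context d (T : measurableType d) (R : realType) (P : probability T R).
Local Notation leb := (@lebesgue_measure R).

Lemma measurable_below_graph (Y : {RV P >-> R}) (D : set R) : measurable D ->
  measurable [set p : T * R | D p.2 /\ p.2 < Y p.1].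
Proof.
move=> mD; apply: measurableI.
  have : measurable_fun setT (@snd T R) by exact: measurable_snd.
  by move=> /(_ measurableT D mD); rewrite setTI.
by apply: measurable_set_lt => //; exact: measurableT_comp.
Qed.

(** Both sides are the mass, under the product of P and Lebesgue measure, of
    the points of D lying below Y (Tonelli). *)
Lemma integral_ccdf (Y : {RV P >-> R}) (D : set R) : measurable D ->
  (\int[leb]_(v in D) ccdf Y v = \int[P]_w leb (D `&` `]-oo, Y w[))%E.
Proof.
move=> mD.
pose C := [set p : T * R | D p.2 /\ p.2 < Y p.1].
have mC : measurable C by exact: measurable_below_graph.
have mf : measurable_fun setT (fun p => (\1_C p)%:E : \bar R).
  by apply/measurable_EFinP; exact: measurable_indic.
rewrite integral_mkcond.
have := @fubini_tonelli _ _ _ _ R P leb _ mf.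
move=> /(_ _)/esym h.
transitivity (\int[leb]_y \int[P]_x (\1_C (x, y))%:E)%E.
  apply: eq_integral => v _; rewrite patchE.
  case: ifPn => vD.
    rewrite (eq_integral (fun w => (\1_(Y @^-1` `]v, +oo[) w)%:E)); last first.
      move=> w _; rewrite !indicE; congr ((nat_of_bool _)%:R)%:E.
      apply/idP/idP; rewrite !inE /C/= in_itv/= andbT; first by case.
      by move=> ?; split => //; rewrite inE in vD.
    by rewrite integral_indic ?setIT//; exact: measurable_funPTI.
  rewrite integral0_eq// => w _; rewrite indicE memNset// => -[/=].
  by move: vD; rewrite notin_setE.
rewrite h; last by move=> x; rewrite lee_fin.
apply: eq_integral => w _.
transitivity (\int[leb]_y (\1_(D `&` `]-oo, Y w[) y)%:E)%E.
  by apply: eq_integral => y _; rewrite !indicE; congr ((nat_of_bool _)%:R)%:E.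
by rewrite integral_indic ?setIT//; exact: measurableI.
Qed.
End layer_cake.

Section calculus.
Context (R : realType).
Local Notation leb := (@lebesgue_measure R).

Lemma integral_primitive (f F : R -> R) (a b : R) : a <= b ->
  continuous f -> (forall x : R, is_derive x 1 F (f x)) ->
  (\int[leb]_(x in `[a, b]) (f x)%:E = (F b - F a)%:E)%E.
Proof.
rewrite le_eqVlt => /predU1P[<-|ab] cf dF.
  by rewrite set_itv1 integral_set1 subrr.
have cF : continuous F.
  move=> x; apply: differentiable_continuous; apply/derivable1_diffP.
  exact: (@ex_derive _ _ _ _ _ _ _ (dF x)).
rewrite EFinB; apply: continuous_FTC2 => //.
- exact: continuous_subspaceT.
- split; first by move=> x _; exact: (@ex_derive _ _ _ _ _ _ _ (dF x)).
    exact: cvg_at_right_filter (cF a).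
  exact: cvg_at_left_filter (cF b).
- by move=> x _; rewrite derive1E; exact: (@derive_val _ _ _ _ _ _ _ (dF x)).
Qed.

Lemma integral_exp_kernel (lam y a b : R) : a <= b ->
  (\int[leb]_(v in `[a, b]) (lam * expR (- lam * (y - v)))%:E =
    (expR (- lam * (y - b)) - expR (- lam * (y - a)))%:E)%E.
Proof.
move=> ab; apply: (integral_primitive (F := fun v : R => expR (- lam * (y - v)))) => //.
  have c : continuous (fun v : R => lam * expR (- lam * (y - v))).
    by move=> v; apply: differentiable_continuous; apply/derivable1_diffP.
  exact: c.
move=> v; apply: is_derive_eq.
rewrite /GRing.scale/=; lra.
Qed.
End calculus.

Section lebesgue_sandwich.
Context (R : realType).

Lemma lebesgue_measure_sandwich (p q : R) (S : set R) : p <= q ->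
  measurable S -> `]p, q[ `<=` S -> S `<=` `[p, q] ->
  lebesgue_measure S = (q - p)%:E.
Proof.
move=> pq mS pS Sq; apply/eqP; rewrite eq_le; apply/andP; split.
  have : (lebesgue_measure S <= lebesgue_measure (`[p, q]%classic : set R))%E.
    by apply: le_measure; rewrite ?inE.
  move/le_trans; apply; rewrite lebesgue_measure_itv/= lte_fin.
  by case: ifPn => //; rewrite lee_fin subr_ge0.
have : (lebesgue_measure (`]p, q[%classic : set R) <= lebesgue_measure S)%E.
  by apply: le_measure; rewrite ?inE.
apply: le_trans; rewrite lebesgue_measure_itv/= lte_fin.
by case: ifPn => //; rewrite -leNgt lee_fin subr_le0.
Qed.

End lebesgue_sandwich.

(** * The exponential law *)

Section exponential_law.
Context d (T : measurableType d) (R : realType) (P : probability T R).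
Local Notation leb := (@lebesgue_measure R).
Variables (lam : R) (A : {RV P >-> R}).
Hypothesis A_exp : forall B, measurable B ->
  distribution P A B = exponential_prob lam B.

Lemma exponential_lt0 : P (A @^-1` `]-oo, 0[) = 0%E.
Proof.
rewrite -[LHS]/(distribution P A _) A_exp// /exponential_prob.
rewrite integral0_eq// => x /=; rewrite in_itv/= => x0.
by rewrite lt0_exponential_pdf.
Qed.

Lemma exponential_pt u : P (A @^-1` [set u]) = 0%E.
Proof.
by rewrite -[LHS]/(distribution P A _) A_exp// /exponential_prob integral_set1.
Qed.

Lemma exponential_ge (u : R) : P (A @^-1` `[u, +oo[) =
  (expR (- lam * Num.max u 0))%:E.
Proof.
rewrite -[LHS]/(distribution P A _) -setCitvl.
rewrite probability_setC//.
have [u0|u0] := leP u 0.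
  rewrite mulr0 expR0 [X in (1 - X)%E](_ : _ = 0%E) ?sube0//.
  apply/eqP; rewrite eq_le measure_ge0 andbT -exponential_lt0.
  by apply: le_measure; rewrite ?inE//; [exact: measurable_funPTI..|]; move=> w /=; rewrite !in_itv/= => /lt_le_trans; exact.
have E1 : distribution P A `]-oo, u] = distribution P A `]-oo, u[.
  rewrite -(@setUitv1 _ _ _ _ true)// measureU//=; last first.
    by rewrite -subset0 => z []/=; rewrite in_itv/= => /[swap] ->; rewrite ltxx.
  by rewrite [X in (_ + X)%E = _]exponential_pt adde0.
have E2 : distribution P A `]-oo, u] = distribution P A `[0, u].
  rewrite (_ : `]-oo, u] = `]-oo, 0[ `|` `[0, u])%classic; last first.
    by rewrite -itv_bndbnd_setU//= bnd_simp ltW.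
  rewrite measureU//=; last first.
    by rewrite -subset0 => z []/=; rewrite !in_itv/= => z0 /andP[]; rewrite leNgt z0.
  by rewrite [X in (X + _)%E = _]exponential_lt0 add0e.
transitivity (1 - distribution P A `]-oo, u[)%E; first by [].
rewrite -E1 E2 A_exp// exponential_prob_itv0c//.
by rewrite -[1%E]/(1%:E) -!EFinB; congr _%:E; lra.
Qed.

(** The density of y - A at v is lam P(A >= y - v): writing it so brings out
    the probability of jumping below v in [level_crossing]. *)
Lemma exponential_window (x y : R) : 0 <= x ->
  P (A @^-1` `[y - x, y[) =
  (\int[leb]_(v in `]0%R, x])
    ((lam * expR (- lam * Num.max (y - v) 0) * (v < y)%R%:R)%:E))%E.
Proof.
move=> x0.
have -> : P (A @^-1` `[(y - x)%R, y[) =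
    (P (A @^-1` `[(y - x)%R, +oo[) - P (A @^-1` `[y, +oo[))%E.
  rewrite (_ : A @^-1` `[(y - x)%R, +oo[ = A @^-1` `[(y - x)%R, y[ `|` A @^-1` `[y, +oo[)%classic; last first.
    by rewrite -preimage_setU -itv_bndbnd_setU//= bnd_simp; lra.
  rewrite measureU ?addeK ?fin_num_measure//; try exact: measurable_funPTI.
  by rewrite -preimage_setI -subset0 => z []/=; rewrite !in_itv/= => /andP[_]; rewrite andbT ltNge => /negP.
rewrite !exponential_ge -EFinB.
have [y0|y0] := leP y 0.
  rewrite integral0_eq; last first.
    by move=> v /=; rewrite in_itv/= => /andP[v0 _]; rewrite ltNge (le_trans y0 (ltW v0)) mulr0.
  by rewrite max_r ?subrr//; lra.
pose c := Num.min x y.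
have c0 : 0 <= c by rewrite le_min x0 ltW.
have -> : Num.max (y - x) 0 = y - c.
  by rewrite /c; have [xy|yx] := leP x y; [rewrite max_l//; lra|rewrite subrr max_r//; lra].
transitivity (\int[leb]_(v in `]0%R, c]) (lam * expR (- lam * (y - v)))%:E)%E.
  rewrite integral_itv_obnd_cbnd; last first.
    apply: measurable_funTS; apply/measurable_EFinP; apply: continuous_measurable_fun.
    by move=> v; apply: differentiable_continuous; apply/derivable1_diffP.
  by rewrite integral_exp_kernel// subr0.
rewrite /c; have [xy|yx] := ltP x y.
  apply: eq_integral => v; rewrite inE/= in_itv/= => /andP[v0 vx].
  by rewrite max_l ?(le_lt_trans vx xy) ?mulr1// subr_ge0 (le_trans vx (ltW xy)).
rewrite -integral_itv_bndo_bndc; last first.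
  apply: measurable_funTS; apply/measurable_EFinP; apply: continuous_measurable_fun.
  by move=> v; apply: differentiable_continuous; apply/derivable1_diffP.
rewrite integral_mkcond [RHS]integral_mkcond; apply: eq_integral => v _.
rewrite !patchE; case: ifPn; case: ifPn => //; rewrite ?inE ?notin_setE/= !in_itv/=.
- by move=> _ /andP[v0 vy]; rewrite max_l ?vy ?mulr1// subr_ge0 ltW.
- by move=> + /andP[v0 vy]; rewrite v0 (le_trans (ltW vy) yx).
- by move=> /andP[-> vx] /= /negP; rewrite -leNgt => yv; rewrite ltNge yv mulr0.
Qed.
End exponential_law.

(** * The renewal equation of the stationary waiting time *)

Section renewal.
Context d (T : measurableType d) (R : realType) (P : probability T R).
Local Notation leb := (@lebesgue_measure R).
Variables (lam m : R) (W V A X : {RV P >-> R}).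
Hypothesis lam_gt0 : 0 < lam.
Hypothesis m_gt0 : 0 < m.
Hypothesis A_exp : forall B, measurable B ->
  distribution P A B = exponential_prob lam B.
Hypothesis V_ge0 : forall w, 0 <= V w.
Hypothesis X_ge0 : forall w, 0 <= X w.
Hypothesis WVA_indep : forall B C D, measurable B -> measurable C -> measurable D ->
  P (W @^-1` B `&` V @^-1` C `&` A @^-1` D) =
  (P (W @^-1` B) * P (V @^-1` C) * P (A @^-1` D))%E.
Hypothesis W_stationary : forall B, measurable B ->
  P ((fun w => Num.max (W w + V w - A w) 0) @^-1` B) = P (W @^-1` B).
Hypothesis X_equilibrium : forall u : R, 0 <= u ->
  (m%:E * P (X @^-1` `]-oo, u]) = \int[leb]_(v in `]0%R, u]) ccdf V v)%E.

Let Y : {RV P >-> R} := (W + V)%R.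

Lemma stationary_lt0 : P (W @^-1` `]-oo, 0[) = 0%E.
Proof.
rewrite -W_stationary// [X in P X](_ : _ = set0) ?measure0//.
rewrite -subset0 => w /=; rewrite in_itv/=.
by rewrite gt_max ltxx andbF.
Qed.

Lemma WV_indep B C : measurable B -> measurable C ->
  P (W @^-1` B `&` V @^-1` C) = (P (W @^-1` B) * P (V @^-1` C))%E.
Proof.
move=> mB mC; have := WVA_indep mB mC measurableT.
by rewrite preimage_setT setIT probability_setT mule1.
Qed.

Lemma YA_law C : measurable C -> P ((fun w => (Y w, A w)) @^-1` C) =
  (distribution P Y \x distribution P A)%E C.
Proof.
move=> mC; apply: distribution_pair => // B D mB mD.
have mS : measurable ((fun p : R * R => p.1 + p.2) @^-1` B).
  rewrite -[X in measurable X]setTI; apply: measurable_funD mB => //.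
exact: (indep_pair WVA_indep mS mD).
Qed.

Let k (p : R * R) : R :=
  lam * expR (- lam * Num.max (p.1 - p.2) 0) * (p.2 < p.1)%R%:R.

Let k_ge0 p : 0 <= k p.
Proof. by rewrite /k !mulr_ge0 ?expR_ge0// ltW. Qed.

Let measurable_k : measurable_fun setT k.
Proof.
have mS : measurable [set p : R * R | p.2 < p.1] by exact: measurable_set_lt.
apply: measurable_funM.
  apply: measurable_funM => //; apply: measurableT_comp => //.
  apply: measurable_funM => //; apply: measurable_maxr => //.
  exact: measurable_funB.
rewrite (_ : (fun _ => _) = \1_[set p : R * R | p.2 < p.1]).
  exact: measurable_indic.
apply/funext => p; rewrite indicE; congr ((nat_of_bool _)%:R).
by apply/idP/idP; rewrite inE.
Qed.

Lemma stationary_le v : 0 <= v ->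
  P [set w | Y w - A w <= v] = P (W @^-1` `]-oo, v]).
Proof.
move=> v0; rewrite -W_stationary//; congr (P _); apply/seteqP.
by split => w /=; rewrite in_itv/= ge_max v0 andbT.
Qed.

(** The kernel k (y, v) is lam times the probability that y - A <= v, when v
    lies below y. *)
Lemma crossing (v : R) :
  (\int[distribution P Y]_y (k (y, v))%:E =
   lam%:E * P [set w | (Y w - A w <= v < Y w)%R])%E.
Proof.
pose C := [set p : R * R | p.1 - p.2 <= v < p.1].
have mC : measurable C.
  have -> : C = [set p : R * R | p.1 - p.2 <= v] `&` [set p | v < p.1].
    by apply/seteqP; split => p /=; [move=> /andP|move=> [? ?]; apply/andP].
  apply: measurableI; last exact: measurable_set_lt.
  by apply: measurable_set_le => //; exact: measurable_funB.
rewrite -[X in P X]/((fun w => (Y w, A w)) @^-1` C) YA_law//.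
rewrite /product_measure1/= -ge0_integralZl_EFin//; last 2 first.
- exact: measurable_fun_xsection.
- exact: ltW.
apply: eq_integral => y _; rewrite /k/=; have [vy|yv] := ltP v y.
  rewrite (_ : xsection C y = `[y - v, +oo[%classic); last first.
    by apply/seteqP; split => a; rewrite /xsection/= inE /C/= in_itv/= vy !andbT => ?; lra.
  by rewrite mulr1 EFinM -(exponential_ge A_exp).
rewrite (_ : xsection C y = set0) ?measure0 ?mule0 ?mulr0//.
by rewrite -subset0 => a; rewrite /xsection/= inE /C/= [v < _]ltNge yv andbF.
Qed.

(** Since the exponential density is lam times its tail, W + V - A has on the
    positive half-line the density lam P(W + V - A <= v < W + V). *)
Lemma level_crossing (x : R) : 0 <= x ->
  (P (W @^-1` `]0%R, x]) =
   \int[leb]_(v in `]0%R, x]) (lam%:E * P [set w | (Y w - A w <= v < Y w)%R]))%E.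
Proof.
move=> x0.
pose C := [set p : R * R | 0 < p.1 - p.2 <= x].
have mC : measurable C.
  have -> : C = [set p : R * R | 0 < p.1 - p.2] `&` [set p | p.1 - p.2 <= x].
    by apply/seteqP; split => p /=; [move=> /andP|move=> [? ?]; apply/andP].
  apply: measurableI.
    by apply: measurable_set_lt => //; exact: measurable_funB.
  by apply: measurable_set_le => //; exact: measurable_funB.
rewrite -W_stationary// [X in P X](_ : _ = (fun w => (Y w, A w)) @^-1` C); last first.
  apply/seteqP; split => w /=; rewrite in_itv/= /C/= lt_max ltxx orbF ge_max x0 andbT//.
rewrite YA_law// /product_measure1/=.
pose D : set R := `]0%R, x]%classic.
have mD : measurable D by exact: measurable_itv.
transitivity (\int[distribution P Y]_y \int[leb]_v (k (y, v) * \1_D v)%:E)%E.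
  apply: eq_integral => y _.
  rewrite (_ : xsection C y = `[y - x, y[%classic); last first.
    by apply/seteqP; split => a; rewrite /xsection/= inE /C/= in_itv/= => ?; lra.
  rewrite -[LHS]/(P (A @^-1` _)) (exponential_window A_exp)//.
  rewrite integral_mkcond; apply: eq_integral => v _.
  by rewrite patchE indicE -/D; case: (v \in D); rewrite ?mulr1 ?mulr0.
transitivity (\int[leb]_v \int[distribution P Y]_y (k (y, v) * \1_D v)%:E)%E.
  apply: (@fubini_tonelli _ _ _ _ R (distribution P Y) leb
      (fun p => (k p * \1_D p.2)%:E)).
    apply/measurable_EFinP; apply: measurable_funM => //.
    by apply: measurableT_comp => //; exact: measurable_indic.
  by move=> p; rewrite lee_fin mulr_ge0.
rewrite [RHS]integral_mkcond; apply: eq_integral => v _.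
rewrite patchE indicE -/D; case: (v \in D).
  by rewrite -crossing; apply: eq_integral => y _; rewrite mulr1.
by rewrite integral0_eq// => y _; rewrite mulr0.
Qed.

(** Conservation of crossings: for v >= 0 stationarity gives W + V - A <= v and
    W <= v the same probability, and up to a null event both contain the event
    W + V <= v, which is removed from each. *)
Lemma crossing_stationary (v : R) : 0 <= v ->
  P [set w | (Y w - A w <= v < Y w)%R] = P [set w | (W w <= v < Y w)%R].
Proof.
move=> v0.
pose YA := [set w | Y w - A w <= v].
pose Wv := [set w | W w <= v].
pose Yv := [set w | v < Y w].
have mYA : measurable YA.
  by apply: measurable_set_le => //; exact: measurable_funB.
have mW : measurable Wv by exact: measurable_set_le.
have mY : measurable Yv by exact: measurable_set_lt.
have E : (P (YA `&` Yv) + P (YA `\` Yv) = P (Wv `&` Yv) + P (Wv `\` Yv))%E.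
  rewrite [LHS]addeC [RHS]addeC -!measureDI//.
  by rewrite [LHS](stationary_le v0).
have F : P (YA `\` Yv) = P (Wv `\` Yv).
  have -> : Wv `\` Yv = ~` Yv.
    apply/seteqP; split => w /=; first by case.
    move=> nY; split => //; move/negP: nY; rewrite -leNgt/= /Wv/=.
    by apply: le_trans; rewrite lerDl.
  apply/eqP; rewrite eq_le; apply/andP; split.
    by apply: le_measure; rewrite ?inE;
      [exact: measurableD|exact: measurableC|move=> w []].
  have -> : P (YA `\` Yv) = (P (YA `\` Yv) + P (A @^-1` `]-oo, 0%R[))%E.
    by rewrite (exponential_lt0 A_exp) adde0.
  apply: le_trans (measureU2 _ _ _).
  - apply: le_measure; rewrite ?inE; first exact: measurableC.
      apply: measurableU; first exact: measurableD.
      exact: measurable_funPTI.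
    move=> w /=; rewrite in_itv/= => nY; have [A0|A0] := ltP (A w) 0; first by right.
    left; split => //; move/negP: nY; rewrite -leNgt /YA/=; lra.
  - exact: measurableD.
  - exact: measurable_funPTI.
have h : P (YA `&` Yv) = P (Wv `&` Yv).
  have fin : P (Wv `\` Yv) \is a fin_num.
    by apply: fin_num_measure; exact: measurableD.
  by rewrite -(addeK (P (YA `&` Yv)) fin) -{1}F E addeK.
have -> : [set w | Y w - A w <= v < Y w] = YA `&` Yv.
  by apply/seteqP; split => w /=; [move=> /andP|move=> [? ?]; apply/andP].
by rewrite h; congr (P _); apply/seteqP; split => w /=; [move=> [? ?]; apply/andP|move=> /andP].
Qed.

Lemma overshoot_law (v : R) : P [set w | (W w <= v < Y w)%R] =
  (\int[distribution P W]_u ((u <= v)%R%:R%:E * ccdf V (v - u)))%E.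
Proof.
pose C := [set p : R * R | p.1 <= v < p.1 + p.2].
have mC : measurable C.
  have -> : C = [set p : R * R | p.1 <= v] `&` [set p | v < p.1 + p.2].
    by apply/seteqP; split => p /=; [move=> /andP|move=> [? ?]; apply/andP].
  apply: measurableI; first exact: measurable_set_le.
  by apply: measurable_set_lt => //; exact: measurable_funD.
rewrite -[X in P X]/((fun w => (W w, V w)) @^-1` C).
rewrite (distribution_pair WV_indep)// /product_measure1/=.
apply: eq_integral => u _; have [uv|vu] := leP u v.
  rewrite (_ : xsection C u = `]v - u, +oo[%classic); last first.
    by apply/seteqP; split => a; rewrite /xsection/= inE /C/= in_itv/= uv !andbT => ?; lra.
  by rewrite mul1e.
rewrite (_ : xsection C u = set0) ?measure0 ?mul0e//.
by rewrite -subset0 => a; rewrite /xsection/= inE /C/= [u <= _]leNgt vu.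
Qed.

(** Given W = u, the overshoots above the levels in (0, x] integrate the tail
    of V over (0, x - u], which is the equilibrium distribution up to its
    normalization m. *)
Lemma integrated_overshoot (u x : R) : 0 <= u -> 0 <= x ->
  (\int[leb]_(v in `]0%R, x]) ((u <= v)%R%:R%:E * ccdf V (v - u)) =
   m%:E * P (X @^-1` `]-oo, (x - u)%R]))%E.
Proof.
move=> u0 x0.
transitivity (\int[leb]_(v in `]0%R, x] `&` `[u, +oo[) ccdf (V + cst u : {RV P >-> R})%R v)%E.
  rewrite integral_mkcond [RHS]integral_mkcond; apply: eq_integral => v _.
  rewrite !patchE in_setI; case: (v \in `]0%R, x]%classic) => //=.
  rewrite mem_setE in_itv/= andbT; have [uv|vu] := leP u v; last by rewrite mul0e.
  rewrite mul1e /ccdf /distribution /pushforward; congr (P _).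
  apply/seteqP; split => w /=; rewrite !in_itv/= !andbT.
    by rewrite ltrBlDr.
  by rewrite ltrBlDr.
rewrite integral_ccdf; last exact: measurableI.
have [xu|ux] := ltP (x - u) 0.
  rewrite (_ : X @^-1` _ = set0); last first.
    rewrite -subset0 => w /=; rewrite in_itv/= leNgt.
    by move=> /negP; apply; rewrite (lt_le_trans xu).
  rewrite measure0 mule0 integral0_eq// => w _.
  rewrite (_ : _ `&` _ = set0) ?measure0// -subset0 => v [[]]/=.
  by rewrite !in_itv/= => /andP[? ?]; rewrite andbT => ? ?; lra.
rewrite (X_equilibrium ux) integral_ccdf; last exact: measurable_itv.
apply: eq_integral => w _.
pose c := Num.min (V w) (x - u).
have c0 : 0 <= c by rewrite le_min V_ge0.
rewrite [X in leb (_ `&` X)](_ : _ = `]-oo, (V w + u)%R[%classic)//.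
rewrite (@lebesgue_measure_sandwich _ u (u + c)); last 4 first.
- by rewrite lerDl.
- by apply: measurableI => //; exact: measurableI.
- move=> v /=; rewrite !in_itv/= andbT -ltrBlDl lt_min => /andP[uv /andP[vV vx]].
  by split; [split|]; lra.
- move=> v [[]]/=; rewrite !in_itv/= andbT -lerBlDl le_min; lra.
rewrite (@lebesgue_measure_sandwich _ 0 c)//; last 3 first.
- exact: measurableI.
- move=> v /=; rewrite !in_itv/= lt_min => /andP[v0 /andP[vV vx]]; split; lra.
- move=> v []/=; rewrite !in_itv/= le_min; lra.
by congr _%:E; lra.
Qed.

Let rho := lam * m.

Lemma ladder_equation (x : R) : 0 <= x ->
  (P (W @^-1` `]0%R, x]) =
   rho%:E * \int[distribution P W]_u P (X @^-1` `]-oo, (x - u)%R]))%E.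
Proof.
move=> x0.
have mV : measurable_fun setT (fun p : R * R => ccdf V (p.2 - p.1)).
  apply: measurableT_comp; first exact: ccdf_measurable.
  exact: measurable_funB.
have mS : measurable_fun setT (fun p : R * R => (p.1 <= p.2)%R%:R : R).
  rewrite (_ : (fun _ => _) = \1_[set p : R * R | p.1 <= p.2]).
    exact/measurable_indic/measurable_set_le.
  apply/funext => p; rewrite indicE; congr ((nat_of_bool _)%:R).
  by apply/idP/idP; rewrite inE.
pose D : set R := `]0%R, x]%classic.
have mD : measurable D by exact: measurable_itv.
pose f (p : R * R) := ((p.1 <= p.2)%R%:R%:E * ccdf V (p.2 - p.1) * (\1_D p.2)%:E)%E.
have mf : measurable_fun setT f.
  apply: emeasurable_funM; last first.
    by apply/measurable_EFinP; apply: measurableT_comp.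
  by apply: emeasurable_funM => //; exact/measurable_EFinP.
have f0 p : (0 <= f p)%E by rewrite /f !mule_ge0// lee_fin.
rewrite (level_crossing x0).
transitivity (lam%:E * \int[leb]_v \int[distribution P W]_u f (u, v))%E.
  rewrite -ge0_integralZl//; last 3 first.
  - exact: (measurable_fun_fubini_tonelli_G (m1 := distribution P W) f mf f0).
  - by move=> v _; exact: integral_ge0.
  - by rewrite lee_fin ltW.
  rewrite [LHS]integral_mkcond; apply: eq_integral => v _.
  rewrite patchE /f/= -/D indicE; case: (boolP (v \in D)) => vD.
    have v0 : 0 <= v by move: vD; rewrite mem_setE in_itv/= => /andP[/ltW].
    rewrite crossing_stationary// overshoot_law; congr (_ * _)%E.
    by apply: eq_integral => u _; rewrite mule1.
  by rewrite integral0_eq ?mule0// => u _; rewrite mule0.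
rewrite /rho EFinM -muleA; congr (_ * _)%E.
transitivity (\int[distribution P W]_u \int[leb]_v f (u, v))%E.
  by apply/esym; exact: (@fubini_tonelli _ _ _ _ R (distribution P W) leb f mf f0).
have mX : measurable_fun setT (fun u : R => P (X @^-1` `]-oo, (x - u)%R])).
  rewrite (_ : (fun _ => _) = (fun u : R => cdf X (x - u))); last by [].
  apply: measurableT_comp; first exact: cdf_measurable.
  exact: measurable_funB.
rewrite -ge0_integralZl//; last by rewrite lee_fin ltW.
apply: ge0_ae_eq_integral => //.
- exact: (measurable_fun_fubini_tonelli_F (m2 := leb) f mf f0).
- exact: measurable_funeM.
- by move=> u _; exact: integral_ge0.
- by move=> u _; rewrite mule_ge0// lee_fin ltW.
(* The two integrands agree except where W < 0, which is a null event. *)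
exists `]-oo, 0%R[%classic; split => //.
  exact: stationary_lt0.
move=> u /= /not_implyP[_ h]; rewrite in_itv/= ltNge; apply/negP => u0.
apply: h; rewrite -(integrated_overshoot u0 x0) [RHS]integral_mkcond.
apply: eq_integral => v _; rewrite patchE /f/= indicE -/D.
by case: (v \in D); rewrite ?mule1 ?mule0.
Qed.

(** The integral in [ladder_equation] is the distribution function of the sum
    of independent copies of W and X, so that equation determines the tail of W
    up to the constant P(W > 0), which is found to be lam * m as x tends to
    infinity. *)
Lemma renewal_equation (x : R) : 0 <= x ->
  (ccdf W x = rho%:E * \int[P]_w ccdf W (x - X w))%E.
Proof.
move=> x0.
(* Z is the sum of independent copies of W and X on the product space. *)
pose PP := (distribution P W \x distribution P X)%E.
have mZ : measurable_fun setT (fun p : R * R => p.1 + p.2).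
  exact: measurable_funD.
pose Z : {RV PP >-> R} := rv_of PP mZ.
have mlaw (B : set R) : measurable B -> measurable (Z @^-1` B).
  by move=> mB; exact: measurable_funPTI.
have cdfZ t : cdf Z t = (\int[distribution P W]_u P (X @^-1` `]-oo, (t - u)%R]))%E.
  rewrite /cdf /distribution {1}/pushforward /PP /product_measure1/=.
  apply: eq_integral => u _; congr (P (X @^-1` _)).
  apply/seteqP; split => a; rewrite /xsection/= inE/= !in_itv/=.
    by rewrite lerBrDl.
  by rewrite lerBrDl.
have ladder t : 0 <= t -> (cdf W t - cdf W 0%R = rho%:E * cdf Z t)%E.
  move=> t0; rewrite cdfZ -ladder_equation//.
  have -> : cdf W t = (cdf W 0%R + P (W @^-1` `]0%R, t]))%E.
    rewrite /cdf -measureU//=.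
    - by rewrite -itv_bndbnd_setU// bnd_simp.
    - by rewrite -subset0 => z []/=; rewrite !in_itv/= => z0 /andP[]; rewrite ltNge z0.
  by rewrite addeAC subee ?add0e// fin_num_measure.
(* Let t tend to infinity in [ladder]. *)
have W0 : (1 - cdf W 0%R = rho%:E)%E.
  have L1 : (cdf W t - cdf W 0%R)%E @[t --> +oo%R] --> (1 - cdf W 0%R)%E.
    apply: cvgeB; [by rewrite fin_num_adde_defl// fin_numN fin_num_measure| |exact: cvg_cst].
    exact: cvg_cdfy1.
  have L2 : (rho%:E * cdf Z t)%E @[t --> +oo%R] --> (rho%:E * 1)%E.
    by apply: cvgeZl => //; exact: cvg_cdfy1.
  rewrite mule1 in L2.
  have L3 : (cdf W t - cdf W 0%R)%E @[t --> +oo%R] --> rho%:E.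
    apply: cvg_trans L2; apply: near_eq_cvg; near=> t.
    by rewrite ladder.
  exact: (cvg_unique _ L1 L3).
have -> : ccdf W x = (rho%:E * ccdf Z x)%E.
  rewrite !ccdf_1_cdf muleBr ?fin_num_adde_defl ?fin_numN ?fin_num_measure//.
  rewrite mule1 -ladder// -W0 fin_num_oppeB ?fin_num_measure//.
  have /fineK <- : cdf W x \is a fin_num by exact: fin_num_measure.
  have /fineK <- : cdf W 0 \is a fin_num by exact: fin_num_measure.
  rewrite -[1%E]/(1%:E) -!EFinN -!EFinD; congr _%:E; ring.
congr (_ * _)%E.
pose C := [set p : R * R | x < p.1 + p.2].
have mC : measurable C by exact: measurable_set_lt.
have -> : ccdf Z x = (\int[PP]_p (\1_C p)%:E)%E.
  rewrite integral_indic// setIT /ccdf /distribution {1}/pushforward.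
  by congr (PP _); apply/seteqP; split => p /=; rewrite in_itv/= andbT.
have mCf : measurable_fun setT (fun p => (\1_C p)%:E : \bar R).
  by apply/measurable_EFinP; exact: measurable_indic.
have mWX : measurable_fun setT (fun y : R => ccdf W (x - y)).
  apply: measurableT_comp; first exact: ccdf_measurable.
  exact: measurable_funB.
rewrite -[RHS](ge0_integral_distribution X (f := fun y : R => ccdf W (x - y)))//.
rewrite /PP fubini_tonelli2//.
apply: eq_integral => y _; rewrite /fubini_G.
transitivity (\int[distribution P W]_u (\1_`]x - y, +oo[ u)%:E)%E.
  apply: eq_integral => u _; rewrite !indicE; congr ((nat_of_bool _)%:R)%:E.
  by apply/idP/idP; rewrite !inE /C/= in_itv/= andbT ltrBlDr.
by rewrite integral_indic// setIT.
Unshelve. all: by end_near. Qed.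

End renewal.

(** * Sums of nonnegative jumps *)

Section exponential_inequalities.
Context (R : realType).
Implicit Types u p : R.

Lemma expR_le_quadratic u : 0 <= u -> expR u <= 1 + u + u ^+ 2 * expR u.
Proof.
move=> u0; have e0 := expR_gt0 u; have e1 := expR_ge1Dx u.
have [u1|u1] := leP 1 u.
  have : expR u <= u ^+ 2 * expR u by rewrite ler_peMl ?expR_ge0// exprn_ege1.
  lra.
have : (1 - u) * expR u <= 1.
  by rewrite -ler_pdivlMr// div1r -expRN expR_ge1Dx.
nra.
Qed.

Lemma expRN_le_powR u p : 0 <= u -> 1 <= p <= 2 -> expR (- u) <= 1 - u + u `^ p.
Proof.
move=> u0 /andP[p1 p2]; have [u1|u1] := leP 1 u.
  apply: (@le_trans _ _ 1); first by rewrite -expR0 ler_expR oppr_le0.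
  have := le1r_powR u1 p1; lra.
move: u0; rewrite le_eqVlt => /predU1P[<-|u0].
  by rewrite oppr0 expR0 powR0 ?subr0 ?addr0// gt_eqF// (lt_le_trans ltr01).
have : u ^+ 2 <= u `^ p.
  by rewrite -(powR_mulrn _ (ltW u0)) ger_powR// u0 ltW.
have : expR (- u) <= 1 - u + u ^+ 2.
  rewrite expRN invf_ple ?posrE ?expR_gt0//; last nra.
  apply: le_trans (expR_ge1Dx u).
  rewrite -div1r ler_pdivrMr; nra.
lra.
Qed.

End exponential_inequalities.

Section random_walk.
Context d (T : measurableType d) (R : realType) (P : probability T R).
Variable X : {RV P >-> R}.
Hypothesis X_ge0 : forall w, 0 <= X w.

Lemma bounded_integrable (f : T -> R) (M : R) : measurable_fun setT f ->
  (forall w, `|f w| <= M) -> P.-integrable setT (EFin \o f).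
Proof.
move=> mf fM; apply: (@le_integrable _ _ _ P setT measurableT _ (EFin \o cst M)) => //.
- exact/measurable_EFinP.
- by move=> w _ /=; rewrite lee_fin (le_trans (fM w))// ler_norm.
- exact: finite_measure_integrable_cst.
Qed.

(** It carries the tail of a variable to that of its sum with an independent
    copy of X. *)
Definition step (h : R -> R) (x : R) : R := \int[P]_w h (x - X w).

Definition tail_function (h : R -> R) : Prop :=
  [/\ measurable_fun setT h, forall x, 0 <= h x <= 1 &
      forall x y, x <= y -> h y <= h x].

Lemma measurable_translate (h : R -> R) (x : R) : measurable_fun setT h ->
  measurable_fun setT (fun w => h (x - X w)).
Proof. by move=> mh; apply: measurableT_comp => //; exact: measurable_funB. Qed.

Lemma integrable_translate (h : R -> R) (x : R) : tail_function h ->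
  P.-integrable setT (EFin \o (fun w => h (x - X w))).
Proof.
case=> mh h01 _; apply: (@bounded_integrable _ 1); first exact: measurable_translate.
by move=> w; have /andP[? ?] := h01 (x - X w); rewrite ger0_norm.
Qed.

Lemma Rintegral_cst1 (a : R) : \int[P]_w a = a.
Proof.
by rewrite /Rintegral integral_cst// [X in (_ * X)%E]probability_setT mule1.
Qed.

Lemma step_tail_function h : tail_function h -> tail_function (step h).
Proof.
move=> hh; have [mh h01 hd] := hh; split.
- have mf : measurable_fun setT (fun p : R * T => (h (p.1 - X p.2))%:E).
    apply/measurable_EFinP; apply: measurableT_comp => //.
    by apply: measurable_funB => //; exact: measurableT_comp.
  have f0 p : (0 <= (h (p.1 - X p.2))%:E)%E.
    by rewrite lee_fin; have /andP[] := h01 (p.1 - X p.2).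
  have := measurable_fun_fubini_tonelli_F (m2 := P) _ mf f0.
  by move=> /(measurableT_comp (fine_measurable measurableT)).
- move=> x; apply/andP; split.
    by apply: Rintegral_ge0 => w _; have /andP[] := h01 (x - X w).
  rewrite -(Rintegral_cst1 1); apply: le_Rintegral => //.
  + exact: integrable_translate.
  + exact: finite_measure_integrable_cst.
  + by move=> w _; have /andP[] := h01 (x - X w).
- move=> x y xy; apply: le_Rintegral => //; try exact: integrable_translate.
  by move=> w _; apply: hd; rewrite lerB.
Qed.

(** P(S_n > x) for the sum S_n of n independent copies of X.  As iterates of
    [step], these tails come without a construction of the copies. *)
Definition jump_tail (n : nat) : R -> R := iter n step (fun x => (x < 0)%R%:R).

Arguments jump_tail : simpl never.

Lemma jump_tailS n x : jump_tail n.+1 x = step (jump_tail n) x.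
Proof. by []. Qed.

Lemma jump_tail0 x : jump_tail 0 x = (x < 0)%R%:R.
Proof. by []. Qed.

Lemma jump_tail_function n : tail_function (jump_tail n).
Proof.
elim: n => [|n IH]; last exact: step_tail_function.
split; rewrite /jump_tail/=.
- rewrite (_ : (fun _ => _) = \1_(`]-oo, 0[%classic : set R)).
    exact: measurable_indic.
  by apply/funext => x; rewrite indicE mem_setE in_itv.
- by move=> x; case: (_ < _); rewrite /= ?ler01 ?lexx.
- move=> x y xy; have [y0|y0] := ltP y 0; last by rewrite ler0n.
  by rewrite (le_lt_trans xy y0).
Qed.

Lemma jump_tail_ge0 n x : 0 <= jump_tail n x.
Proof. by have [_ /(_ x)/andP[]] := jump_tail_function n. Qed.

Lemma jump_tail_le1 n x : jump_tail n x <= 1.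
Proof. by have [_ /(_ x)/andP[]] := jump_tail_function n. Qed.

Let gt_indicE (z : R) :
  (fun w => (z < X w)%R%:R : R) = \1_(X @^-1` `]z, +oo[).
Proof.
apply/funext => w; rewrite indicE; congr ((nat_of_bool _)%:R).
by apply/idP/idP; rewrite inE /= in_itv/= andbT.
Qed.

Lemma integrable_gt_indic (z : R) :
  P.-integrable setT (EFin \o (fun w => (z < X w)%R%:R : R)).
Proof.
apply: (@bounded_integrable _ 1).
  by rewrite gt_indicE; apply: measurable_indic; exact: measurable_funPTI.
by move=> w; case: (_ < _); rewrite /= ?normr0 ?normr1 ?ler01.
Qed.

Lemma Rintegral_gt_indic (z : R) : \int[P]_w ((z < X w)%R%:R) = tail X z.
Proof.
transitivity (\int[P]_w \1_(X @^-1` `]z, +oo[) w); first by rewrite -gt_indicE.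
rewrite /Rintegral integral_indic ?setIT//.
exact: measurable_funPTI.
Qed.

Lemma tail_ge0 z : 0 <= tail X z.
Proof. by rewrite /tail fine_ge0. Qed.

Lemma tail_nonincreasing z z' : z <= z' -> tail X z' <= tail X z.
Proof.
move=> zz'; rewrite /tail fine_le ?fin_num_measure//.
exact: ccdf_nonincreasing.
Qed.

Lemma tail_le1 z : tail X z <= 1.
Proof. by rewrite /tail -lee_fin fineK ?fin_num_measure// probability_le1. Qed.

(** The inductive step of the upper bounds on [jump_tail]: z and b are
    truncation levels for the last jump, and g is an exponential weight on the
    jumps below b. *)
Lemma step_le (h g : R -> R) (x a c0 c1 c2 z b : R) :
  tail_function h ->
  P.-integrable setT (EFin \o (fun w => g (X w))) ->
  (forall w, h (x - X w) <= a + c0 * (z < X w)%R%:R + c1 * (b < X w)%R%:R +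
     c2 * g (X w)) ->
  step h x <= a + c0 * tail X z + c1 * tail X b + c2 * \int[P]_w g (X w).
Proof.
move=> hh ig hle.
have iz c (t : R) : P.-integrable setT (EFin \o (fun w => c * (t < X w)%R%:R : R)).
  have := integrableZl measurableT c (integrable_gt_indic t).
  by apply: eq_integrable.
have i1 : P.-integrable setT (EFin \o (fun w => a + c0 * (z < X w)%R%:R)).
  have := integrableD measurableT (finite_measure_integrable_cst P a measurableT) (iz c0 z).
  by apply: eq_integrable.
have i2 : P.-integrable setT (EFin \o (fun w => a + c0 * (z < X w)%R%:R + c1 * (b < X w)%R%:R)).
  by have := integrableD measurableT i1 (iz c1 b); exact: eq_integrable.
have i3 : P.-integrable setT (EFin \o (fun w => c2 * g (X w))).
  by have := integrableZl measurableT c2 ig; exact: eq_integrable.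
have i4 : P.-integrable setT (EFin \o (fun w => a + c0 * (z < X w)%R%:R +
    c1 * (b < X w)%R%:R + c2 * g (X w))).
  by have := integrableD measurableT i2 i3; exact: eq_integrable.
have <- : \int[P]_w (a + c0 * (z < X w)%R%:R + c1 * (b < X w)%R%:R + c2 * g (X w)) =
   a + c0 * tail X z + c1 * tail X b + c2 * \int[P]_w g (X w).
  rewrite RintegralD// RintegralD// RintegralD//.
    rewrite Rintegral_cst1 !RintegralZl// ?Rintegral_gt_indic//; exact: integrable_gt_indic.
  exact: finite_measure_integrable_cst.
apply: le_Rintegral => //; exact: integrable_translate.
Qed.

Lemma step_ge (h : R -> R) (x a c : R) : tail_function h ->
  (forall w, a + c * (x < X w)%R%:R <= h (x - X w)) ->
  a + c * tail X x <= step h x.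
Proof.
move=> hh hle.
have iz : P.-integrable setT (EFin \o (fun w => c * (x < X w)%R%:R : R)).
  have := integrableZl measurableT c (integrable_gt_indic x).
  by apply: eq_integrable.
have i1 : P.-integrable setT (EFin \o (fun w => a + c * (x < X w)%R%:R)).
  have := integrableD measurableT (finite_measure_integrable_cst P a measurableT) iz.
  by apply: eq_integrable.
have <- : \int[P]_w (a + c * (x < X w)%R%:R) = a + c * tail X x.
  rewrite RintegralD//; last exact: finite_measure_integrable_cst.
  rewrite Rintegral_cst1 RintegralZl// ?Rintegral_gt_indic//; exact: integrable_gt_indic.
apply: le_Rintegral => //; exact: integrable_translate.
Qed.

Lemma jump_tail_lt0 n x : x < 0 -> jump_tail n x = 1.
Proof.
elim: n x => [|n IH] x x0; first by rewrite jump_tail0 x0.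
rewrite jump_tailS /step -[RHS]Rintegral_cst1; apply: eq_Rintegral => w _.
by rewrite IH// subr_lt0 (lt_le_trans x0).
Qed.

(** A sum of n nonnegative jumps exceeds x as soon as one of them does. *)
Lemma jump_tail_lower n x : 1 - (1 - tail X x) ^+ n <= jump_tail n x.
Proof.
elim: n => [|n IH]; first by rewrite expr0 subrr jump_tail_ge0.
apply: (@le_trans _ _ (jump_tail n x + (1 - jump_tail n x) * tail X x)).
  rewrite exprS; have := tail_ge0 x; have := tail_le1 x; nra.
rewrite jump_tailS; apply: step_ge; first exact: jump_tail_function.
move=> w; have [xX|Xx] := ltP x (X w).
  by rewrite [leRHS]jump_tail_lt0 ?subr_lt0// mulr1 addrC subrK.
have [_ _ hd] := jump_tail_function n.
by rewrite mulr0 addr0; apply: hd; rewrite gerBl.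
Qed.

Definition truncated_mgf (b s : R) : R :=
  \int[P]_w (expR (s * X w) * (X w <= b)%R%:R).

Let integrable_truncated_exp (b s : R) : 0 <= s ->
  P.-integrable setT (EFin \o (fun w => expR (s * X w) * (X w <= b)%R%:R)).
Proof.
move=> s0; apply: (@bounded_integrable _ (expR (s * b))).
  apply: measurable_funM.
    by apply: measurableT_comp => //; exact: measurable_funM.
  rewrite (_ : (fun _ => _) = \1_(X @^-1` `]-oo, b])).
    by apply: measurable_indic; exact: measurable_funPTI.
  apply/funext => w; rewrite indicE; congr ((nat_of_bool _)%:R).
  by apply/idP/idP; rewrite inE /= in_itv/=.
move=> w; have [Xb|bX] := leP (X w) b; last by rewrite mulr0 normr0 expR_ge0.
by rewrite mulr1 ger0_norm ?expR_ge0// ler_expR ler_wpM2l.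
Qed.

(** Either some jump exceeds b, or all stay below b and Markov's inequality
    applies to the truncated exponential moment. *)
Lemma jump_tail_truncated n (x b s M : R) : 0 <= s -> 1 <= M ->
  truncated_mgf b s <= M ->
  jump_tail n x <= n%:R * tail X b + expR (- s * x) * M ^+ n.
Proof.
move=> s0 M1 HM; elim: n x => [|n IH] x.
  rewrite mul0r add0r expr0 mulr1 jump_tail0; case: ltP => [x0|_]; last exact: expR_ge0.
  by rewrite -expR0 ler_expR mulNr oppr_ge0 mulr_ge0_le0// ltW.
have T0 := tail_ge0 b.
rewrite jump_tailS.
apply: (@le_trans _ _ (n%:R * tail X b + 0 * tail X b + 1 * tail X b +
   (expR (- s * x) * M ^+ n) * truncated_mgf b s)); last first.
  rewrite -natr1 exprSr mulrA mulrDl mul1r mul0r addr0 lerD2l.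
  by rewrite ler_wpM2l// mulr_ge0 ?expR_ge0// exprn_ge0// (le_trans ler01).
apply: (step_le (g := fun t => expR (s * t) * (t <= b)%R%:R)).
- exact: jump_tail_function.
- exact: integrable_truncated_exp.
- move=> w; have [Xb|bX] := leP (X w) b.
    rewrite !mulr0 !mulr1 !addr0 mulrAC -expRD.
    by have := IH (x - X w); rewrite (_ : - s * (x - X w) = - s * x + s * X w)//; ring.
  rewrite !mulr0 !mulr1 !addr0 (le_trans (jump_tail_le1 _ _))//.
  by rewrite lerDr mulr_ge0.
Qed.

(** The four terms account for a jump above z, for two jumps above b, for one
    jump between b and z while the others gain at least x - z, and for no jump
    above b.  The bound for the third comes from [jump_tail_truncated]. *)
Lemma jump_tail_one_big_jump n (x z b s M : R) : 0 <= s -> 1 <= M ->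
  truncated_mgf b s <= M -> b <= z ->
  jump_tail n x <= n%:R * tail X z + (n%:R * tail X b) ^+ 2 +
    n%:R * tail X b * (expR (- s * (x - z)) * M ^+ n) + expR (- s * x) * M ^+ n.
Proof.
move=> s0 M1 HM bz.
have T0 := tail_ge0 b; have Z0 := tail_ge0 z.
have M0 : 0 <= M by rewrite (le_trans ler01).
elim: n x => [|n IH] x.
  rewrite !mul0r expr0n !add0r expr0 mulr1 jump_tail0; case: ltP => [x0|_]; last exact: expR_ge0.
  by rewrite -expR0 ler_expR mulNr oppr_ge0 mulr_ge0_le0// ltW.
rewrite jump_tailS.
set E := expR (- s * (x - z)) * M ^+ n; set F := expR (- s * x) * M ^+ n.
have E0 : 0 <= E by rewrite mulr_ge0 ?expR_ge0// exprn_ge0.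
have F0 : 0 <= F by rewrite mulr_ge0 ?expR_ge0// exprn_ge0.
pose a := n%:R * tail X z + (n%:R * tail X b) ^+ 2.
have a0 : 0 <= a by rewrite addr_ge0 ?mulr_ge0 ?sqr_ge0.
pose c2 := n%:R * tail X b * E + F.
have nT0 : 0 <= n%:R * tail X b by rewrite mulr_ge0.
have c20 : 0 <= c2 by exact: (addr_ge0 (mulr_ge0 nT0 E0) F0).
pose c1 := n%:R * tail X b + E.
have c10 : 0 <= c1 by exact: addr_ge0.
apply: (@le_trans _ _ (a + 1 * tail X z + c1 * tail X b + c2 * truncated_mgf b s)).
  apply: (step_le (g := fun t => expR (s * t) * (t <= b)%R%:R)).
  - exact: jump_tail_function.
  - exact: integrable_truncated_exp.
  - move=> w; have [Xb|bX] := leP (X w) b.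
      rewrite (ltNge z) (le_trans Xb bz) !mulr0 !mulr1 !addr0.
      have := IH (x - X w); rewrite -/a.
      have -> : expR (- s * (x - X w - z)) = expR (- s * (x - z)) * expR (s * X w).
        by rewrite -expRD; congr expR; ring.
      have -> : expR (- s * (x - X w)) = expR (- s * x) * expR (s * X w).
        by rewrite -expRD; congr expR; ring.
      by move/le_trans; apply; rewrite /a /c2 /E /F -addrA lerD2l le_eqVlt; apply/orP; left; apply/eqP; ring.
    rewrite !mulr0 !mulr1 addr0; have [zX|Xz] := ltP z (X w).
      by rewrite (le_trans (jump_tail_le1 _ _))// mulr1 addrAC lerDr addr_ge0.
    rewrite mulr0 addr0; apply: (@le_trans _ _ (jump_tail n (x - z))).
      by have [_ _] := jump_tail_function n; apply; rewrite lerB.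
    apply: (le_trans (jump_tail_truncated _ _ s0 M1 HM)); rewrite -/E -/c1.
    by rewrite lerDr.
apply: (@le_trans _ _ (a + 1 * tail X z + c1 * tail X b + c2 * M)).
  by rewrite lerD2l ler_wpM2l.
have -> : expR (- s * (x - z)) * M ^+ n.+1 = E * M by rewrite exprSr mulrA.
have -> : expR (- s * x) * M ^+ n.+1 = F * M by rewrite exprSr mulrA.
rewrite /a /c1 /c2 -natr1 mul1r.
clear c1 c10 c2 c20 a a0; clearbody E F.
have EM : E <= E * M by rewrite ler_peMr.
have : E * tail X b <= E * M * tail X b by rewrite ler_wpM2r.
have n0 : 0 <= n%:R :> R by [].
have : 0 <= n%:R * tail X b * tail X b by rewrite !mulr_ge0.
have : 0 <= tail X b * tail X b by rewrite mulr_ge0.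
have -> : (n%:R * tail X b * E + F) * M =
  n%:R * tail X b * (E * M) + F * M by ring.
rewrite !expr2 => ? ? ?; lra.
Qed.

Definition laplace (s : R) : R := \int[P]_w expR (- s * X w).

(** Markov's inequality for exp (- s S_n). *)
Lemma jump_tail_laplace n (x s : R) : 0 <= s ->
  1 - jump_tail n x <= expR (s * x) * laplace s ^+ n.
Proof.
move=> s0.
have il : P.-integrable setT (EFin \o (fun w => expR (- s * X w))).
  apply: (@bounded_integrable _ 1).
    by apply: measurableT_comp => //; exact: measurable_funM.
  move=> w; rewrite ger0_norm ?expR_ge0// -expR0 ler_expR mulNr.
  by rewrite oppr_le0 mulr_ge0.
have l0 : 0 <= laplace s by apply: Rintegral_ge0 => w _; exact: expR_ge0.
elim: n x => [|n IH] x.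
  rewrite expr0 mulr1 jump_tail0; case: ltP => [x0|x0]; first by rewrite subrr expR_ge0.
  by rewrite subr0 -expR0 ler_expR mulr_ge0.
rewrite jump_tailS.
pose c := expR (s * x) * laplace s ^+ n.
rewrite exprSr mulrA -/c lerBlDl -lerBlDr.
have ic : P.-integrable setT (EFin \o (fun w => c * expR (- s * X w))).
  by have := integrableZl measurableT c il; exact: eq_integrable.
have <- : \int[P]_w (1 - c * expR (- s * X w)) = 1 - c * laplace s.
  rewrite RintegralB//; last exact: finite_measure_integrable_cst.
  by rewrite Rintegral_cst1 RintegralZl.
apply: le_Rintegral => //.
- have := integrableB measurableT (finite_measure_integrable_cst P 1 measurableT) ic.
  by apply: eq_integrable.
- exact/integrable_translate/jump_tail_function.
move=> w _; rewrite lerBlDl -lerBlDr.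
apply: (le_trans (IH _)); rewrite /c mulrBr expRD -mulNr le_eqVlt; apply/orP; left; apply/eqP; ring.
Qed.

Section moments.
Variables p : R.
Hypothesis p12 : 1 <= p <= 2.
Hypothesis X_integrable : P.-integrable setT (EFin \o X).
Hypothesis Xp_integrable : P.-integrable setT (EFin \o (fun w => X w `^ p)).

Let mu := \int[P]_w X w.
Let mp := \int[P]_w (X w `^ p).

(** On X <= b the second-order term is controlled by X^2 <= b^(2 - p) X^p, so
    that the variance of X may be infinite. *)
Lemma truncated_mgf_le (b s : R) : 0 < b -> 0 <= s ->
  truncated_mgf b s <= expR (s * mu + s ^+ 2 * b `^ (2 - p) * expR (s * b) * mp).
Proof.
move=> b0 s0; set c := s ^+ 2 * b `^ (2 - p) * expR (s * b).
apply: le_trans (expR_ge1Dx _).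
have i1 : P.-integrable setT (EFin \o (fun w => s * X w)).
  by have := integrableZl measurableT s X_integrable; exact: eq_integrable.
have i2 : P.-integrable setT (EFin \o (fun w => 1 + s * X w)).
  have := integrableD measurableT (finite_measure_integrable_cst P 1 measurableT) i1.
  by apply: eq_integrable.
have i3 : P.-integrable setT (EFin \o (fun w => c * X w `^ p)).
  by have := integrableZl measurableT c Xp_integrable; exact: eq_integrable.
have <- : \int[P]_w (1 + s * X w + c * X w `^ p) = 1 + (s * mu + c * mp).
  rewrite RintegralD// RintegralD//; last exact: finite_measure_integrable_cst.
  by rewrite Rintegral_cst1 !RintegralZl// addrA.
apply: le_Rintegral => //; first exact: integrable_truncated_exp.
  by have := integrableD measurableT i2 i3; exact: eq_integrable.
move=> w _; have [Xb|bX] := leP (X w) b; last first.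
  rewrite mulr0 addr_ge0 ?addr_ge0 ?mulr_ge0 ?powR_ge0 ?expR_ge0//.
rewrite mulr1; apply: (le_trans (expR_le_quadratic _)); first exact: mulr_ge0.
have X2 : X w ^+ 2 <= b `^ (2 - p) * X w `^ p.
  have [->|X0] := eqVneq (X w) 0; first by rewrite expr0n mulr_ge0 ?powR_ge0.
  have {}X0 : 0 < X w by rewrite lt_neqAle eq_sym X0 X_ge0.
  have -> : X w ^+ 2 = X w `^ (2 - p) * X w `^ p.
    rewrite -powRD; last by rewrite (gt_eqF X0) implybT.
    by rewrite subrK (powR_mulrn _ (ltW X0)).
  rewrite ler_wpM2r ?powR_ge0// ge0_ler_powR ?nnegrE ?(ltW X0) ?(ltW b0)//.
  by rewrite subr_ge0; case/andP : p12.
have XE : expR (s * X w) <= expR (s * b) by rewrite ler_expR ler_wpM2l.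
rewrite lerD2l exprMn.
have -> : c * X w `^ p = s ^+ 2 * ((b `^ (2 - p) * X w `^ p) * expR (s * b)).
  by rewrite /c; ring.
rewrite -[leLHS]mulrA; apply: ler_wpM2l; first exact: sqr_ge0.
apply: ler_pM => //; exact: sqr_ge0.
Qed.

Lemma laplace_le (s : R) : 0 <= s ->
  laplace s <= expR (- s * mu + s `^ p * mp).
Proof.
move=> s0; apply: le_trans (expR_ge1Dx _).
have i1 : P.-integrable setT (EFin \o (fun w => - s * X w)).
  by have := integrableZl measurableT (- s) X_integrable; exact: eq_integrable.
have i2 : P.-integrable setT (EFin \o (fun w => 1 + - s * X w)).
  have := integrableD measurableT (finite_measure_integrable_cst P 1 measurableT) i1.
  by apply: eq_integrable.
have i3 : P.-integrable setT (EFin \o (fun w => s `^ p * X w `^ p)).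
  by have := integrableZl measurableT (s `^ p) Xp_integrable; exact: eq_integrable.
have <- : \int[P]_w (1 + - s * X w + s `^ p * X w `^ p) =
    1 + (- s * mu + s `^ p * mp).
  rewrite RintegralD// RintegralD//; last exact: finite_measure_integrable_cst.
  by rewrite Rintegral_cst1 !RintegralZl// addrA.
apply: le_Rintegral => //.
- apply: (@bounded_integrable _ 1).
    by apply: measurableT_comp => //; exact: measurable_funM.
  move=> w; rewrite ger0_norm ?expR_ge0// -expR0 ler_expR mulNr.
  by rewrite oppr_le0 mulr_ge0.
- by have := integrableD measurableT i2 i3; exact: eq_integrable.
move=> w _; rewrite mulNr -powRM//.
by apply: expRN_le_powR => //; exact: mulr_ge0.
Qed.

End moments.

(** * Solutions of the renewal equation *)

Section renewal_bracket.
Variables (rho : R) (H : R -> R).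
Hypothesis rho01 : 0 < rho < 1.
Hypothesis H_tail : tail_function H.
Hypothesis H_lt0 : forall x : R, x < 0 -> H x = 1.
Hypothesis H_renewal : forall x : R, 0 <= x -> H x = rho * step H x.

Lemma renewalE (x : R) : H x = (1 - rho) * (x < 0)%R%:R + rho * step H x.
Proof.
have [x0|x0] := ltP x 0; last by rewrite mulr0 add0r H_renewal.
rewrite H_lt0// mulr1 [step _ _](_ : _ = 1) ?mulr1 ?subrK//.
rewrite -[RHS]Rintegral_cst1; apply: eq_Rintegral => w _.
by rewrite H_lt0// subr_lt0 (lt_le_trans x0).
Qed.

Lemma step_mono (h1 h2 : R -> R) (x : R) :
  P.-integrable setT (EFin \o (fun w => h1 (x - X w))) ->
  P.-integrable setT (EFin \o (fun w => h2 (x - X w))) ->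
  (forall y, h1 y <= h2 y) -> step h1 x <= step h2 x.
Proof. by move=> i1 i2 h12; apply: le_Rintegral => // w _; exact: h12. Qed.

Let S N x := \sum_(n < N) (1 - rho) * rho ^+ n * jump_tail n x.

Lemma integrable_partial_sum N c (h : R -> R) (x : R) : tail_function h ->
  P.-integrable setT (EFin \o (fun w => S N (x - X w) + c * h (x - X w))).
Proof.
move=> hh; rewrite /S; elim: N => [|N IH].
  have := integrableZl measurableT c (integrable_translate x hh).
  by apply: eq_integrable => // w _ /=; rewrite big_ord0 add0r.
have := integrableD measurableT IH (integrableZl measurableT
  ((1 - rho) * rho ^+ N) (integrable_translate x (jump_tail_function N))).
by apply: eq_integrable => // w _ /=; rewrite big_ord_recr/= -EFinM -EFinD addrAC.
Qed.

(** One application of the renewal operator shifts the series by one term. *)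
Lemma step_partial_sum N c (h : R -> R) (x : R) : tail_function h ->
  (1 - rho) * (x < 0)%R%:R + rho * step (fun y => S N y + c * h y) x =
  S N.+1 x + rho * c * step h x.
Proof.
move=> hh; rewrite {2}/S big_ord_recl/= expr0 mulr1 -addrA jump_tail0; congr (_ + _).
have iS M : P.-integrable setT (EFin \o (fun w => S M (x - X w))).
  have := @integrable_partial_sum M 0 h x hh.
  by apply: eq_integrable => // w _ /=; rewrite mul0r addr0.
have ih : P.-integrable setT (EFin \o (fun w => c * h (x - X w))).
  by have := integrableZl measurableT c (integrable_translate x hh); exact: eq_integrable.
rewrite {1}/step RintegralD// mulrDr RintegralZl ?mulrA//; last exact: integrable_translate.
congr (_ + _).
elim: N => [|N IH].
  by rewrite big_ord0 /S; under eq_Rintegral do rewrite big_ord0; rewrite Rintegral_cst1 mulr0.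
rewrite big_ord_recr/= -IH /S; under eq_Rintegral do rewrite big_ord_recr/=.
rewrite RintegralD//; [|exact: iS|]; last first.
  have := integrableZl measurableT ((1 - rho) * rho ^+ N) (integrable_translate x (jump_tail_function N)).
  by apply: eq_integrable.
rewrite mulrDr; congr (_ + _).
rewrite RintegralZl//; last exact/integrable_translate/jump_tail_function.
by rewrite /bump/= add1n exprS jump_tailS /step; ring.
Qed.

Let rho0 : 0 <= rho. Proof. by case/andP : rho01 => /ltW. Qed.

(** After N iterations the remainder of the renewal equation is
    rho^N E H(x - S_N).  It is at most rho^N, and, as H = 1 on the negative
    half-line, at least rho^N P(S_N > x). *)
Lemma renewal_upper N (x : R) : H x <= S N x + rho ^+ N.
Proof.
elim: N x => [|N IH] x.
  by rewrite /S big_ord0 add0r expr0; have [_ /(_ x)/andP[]] := H_tail.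
have h1 : tail_function (fun=> 1).
  by split=> //; [move=> y; rewrite ler01 lexx].
have := @step_partial_sum N (rho ^+ N) (fun=> 1) x h1.
rewrite [step (fun=> 1) x]Rintegral_cst1 -exprS [rho ^+ N.+1 * 1]mulr1 => <-.
rewrite renewalE lerD2l ler_wpM2l//; apply: step_mono.
- exact: integrable_translate.
- exact: (@integrable_partial_sum N (rho ^+ N) _ x h1).
- by move=> y; rewrite mulr1.
Qed.

Lemma renewal_lower N (x : R) : S N x + rho ^+ N * jump_tail N x <= H x.
Proof.
elim: N x => [|N IH] x.
  rewrite /S big_ord0 add0r expr0 mul1r jump_tail0; case: ltP => [/H_lt0->//|_].
  by have [_ /(_ x)/andP[]] := H_tail.
have hN := jump_tail_function N.
have := @step_partial_sum N (rho ^+ N) _ x hN.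
rewrite -exprS -jump_tailS => <-.
rewrite renewalE lerD2l ler_wpM2l//; apply: step_mono => //.
- exact: (@integrable_partial_sum N (rho ^+ N) _ x hN).
- exact: integrable_translate.
Qed.

End renewal_bracket.

End random_walk.

(** * Regular variation *)

Section near_infinity.
Context (R : realType).

Lemma near_pinfty_ge (Q : R -> Prop) (A : R) : (\forall x \near +oo, Q x) ->
  exists2 M, A < M & forall x, M <= x -> Q x.
Proof.
move=> [M [_ HM]]; exists (Num.max A M + 1).
  by rewrite ltr_pwDr// le_max lexx.
move=> x Mx; apply: HM; apply: lt_le_trans Mx.
by rewrite ltr_pwDr// le_max lexx orbT.
Qed.

Lemma ge_near_pinfty (Q : R -> Prop) (M : R) : (forall x, M <= x -> Q x) ->
  \forall x \near +oo, Q x.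
Proof. by move=> HM; apply: filterS (nbhs_pinfty_ge (num_real M)).
Qed.

Lemma powR_base_le (x y q : R) : 0 <= q -> 0 <= x -> x <= y ->
  x `^ q <= y `^ q.
Proof.
by move=> q0 x0 xy; rewrite ge0_ler_powR// nnegrE// (le_trans x0).
Qed.

End near_infinity.

Section regular_variation.
Context (R : realType).
Implicit Types (f : R -> R) (k q x : R).

Definition regularly_varying f k : Prop :=
  forall t, 0 < t -> f (t * x) / f x @[x --> +oo] --> t `^ (- k).

(** It lets regular variation at the single ratio 2 give bounds on a whole
    half-line. *)
Lemma dyadic_induction (Q : R -> Prop) (x0 : R) : 0 < x0 ->
  (forall x, x0 <= x < 2 * x0 -> Q x) ->
  (forall x, x0 <= x -> Q x -> Q (2 * x)) ->
  forall x, x0 <= x -> Q x.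
Proof.
move=> x0_gt0 Q0 Q2 x x0x.
have [n] : exists n : nat, x < 2 ^+ n * x0.
  have /archi_boundP : 0 <= x / x0 by rewrite divr_ge0 ?(le_trans _ x0x)// ltW.
  set n := Num.bound _ => xn; exists n; rewrite -ltr_pdivrMr// (lt_le_trans xn)//.
  by rewrite -natrX ler_nat ltnW// ltn_expl.
elim: n x x0x => [|n IH] x x0x; first by rewrite expr0 mul1r ltNge x0x.
move=> xn; have [x2|x2] := ltP x (2 * x0); first by apply: Q0; rewrite x0x.
rewrite (_ : x = 2 * (x / 2)); last by field.
apply: Q2; first lra.
by apply: IH; [lra|move: xn; rewrite exprS; lra].
Qed.

Variables (f : R -> R) (k : R).
Hypothesis f_nonincreasing : forall x y, x <= y -> f y <= f x.
Hypothesis f_gt0 : \forall x \near +oo, 0 < f x.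
Hypothesis f_rv : regularly_varying f k.

(** A Potter bound: eventually doubling x divides f by at least 2^q, and
    monotonicity fills the gaps between dyadic points. *)
Lemma regularly_varying_upper (q : R) : 0 <= q < k ->
  exists2 C, 0 < C & \forall x \near +oo, f x <= C * x `^ (- q).
Proof.
move=> /andP[q0 qk].
have h : \forall x \near +oo, f (2 * x) <= 2 `^ (- q) * f x.
  have lt2 : 2 `^ (- k) < 2 `^ (- q) :> R.
    by rewrite /powR (gt_eqF (ltr0n _ 2)) ltr_expR ltr_pM2r ?ltrN2// ln_gt0// ltr1n.
  have := @cvgr_le _ _ _ _ _ _ (@f_rv 2 _) _ lt2.
  move=> /(_ _ _)h.
  near=> x; rewrite -ler_pdivrMr; first by near: x; exact: h.
  by near: x.
have [x0 x0_gt0 Hx0] := near_pinfty_ge 0 h.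
pose C := (`|f x0| + 1) * (2 * x0) `^ q.
have C_gt0 : 0 < C by rewrite mulr_gt0 ?powR_gt0 ?mulr_gt0// ltr_pwDr.
exists C => //; apply: (@ge_near_pinfty _ _ x0).
apply: dyadic_induction => // [x /andP[x0x xx0]|x x0x IH].
  apply: (le_trans (f_nonincreasing x0x)).
  apply: (@le_trans _ _ (`|f x0| + 1)); first by rewrite (le_trans (ler_norm _))// lerDl.
  rewrite /C -mulrA ler_peMr ?addr_ge0// powRN ler_pdivlMr ?mul1r.
    by apply: powR_base_le => //; lra.
  by rewrite powR_gt0// (lt_le_trans x0_gt0).
have xgt0 : 0 < x by rewrite (lt_le_trans x0_gt0).
apply: (le_trans (Hx0 _ x0x)).
by rewrite (powRM _ (ler0n _ 2) (ltW xgt0)) mulrCA ler_wpM2l ?powR_ge0.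
Unshelve. all: by end_near. Qed.

Lemma regularly_varying_lower (q : R) : 0 <= k < q ->
  exists2 c, 0 < c & \forall x \near +oo, c * x `^ (- q) <= f x.
Proof.
move=> /andP[k0 kq]; have q0 : 0 <= q by rewrite (le_trans k0)// ltW.
have h : \forall x \near +oo, 2 `^ (- q) * f x <= f (2 * x) /\ 0 < f x.
  have lt2 : 2 `^ (- q) < 2 `^ (- k) :> R.
    by rewrite /powR (gt_eqF (ltr0n _ 2)) ltr_expR ltr_pM2r ?ltrN2// ln_gt0// ltr1n.
  have := @cvgr_ge _ _ _ _ _ _ (@f_rv 2 _) _ lt2.
  move=> /(_ _ _)h.
  near=> x.
  have fx : 0 < f x by near: x.
  split=> //; rewrite -ler_pdivlMr//; near: x; exact: h.
have [x0 x0_gt0 Hx0] := near_pinfty_ge 0 h.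
pose c := f (2 * x0) * x0 `^ q.
have fx0 : 0 < f (2 * x0) by apply: (Hx0 _ _).2; lra.
exists c; first by rewrite mulr_gt0 ?powR_gt0.
apply: (@ge_near_pinfty _ _ x0).
apply: dyadic_induction => // [x /andP[x0x xx0]|x x0x IH].
  apply: le_trans (f_nonincreasing (ltW xx0)).
  have xgt0 : 0 < x by rewrite (lt_le_trans x0_gt0).
  rewrite /c -mulrA ler_piMr ?(ltW fx0)// powRN ler_pdivrMr ?powR_gt0// mul1r.
  by apply: powR_base_le => //; lra.
have xgt0 : 0 < x by rewrite (lt_le_trans x0_gt0).
apply: le_trans ((Hx0 _ x0x).1).
by rewrite (powRM _ (ler0n _ 2) (ltW xgt0)) mulrCA ler_wpM2l ?powR_ge0.
Unshelve. all: by end_near. Qed.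

Lemma regularly_varying_shift_le (c : R) : 0 < c ->
  exists2 C, 0 < C & \forall x \near +oo, f (c * x) <= C * f x.
Proof.
move=> c0; exists (c `^ (- k) + 1); first by rewrite ltr_pwDr// powR_ge0.
have lt2 : c `^ (- k) < c `^ (- k) + 1 by rewrite ltrDl.
have := @cvgr_le _ _ _ _ _ _ (@f_rv c c0) _ lt2.
move=> /(_ _)h.
near=> x; rewrite -ler_pdivrMr; first by near: x; exact: h.
by near: x.
Unshelve. all: by end_near. Qed.

(** The limiting ratio (1 - eta)^(- k) tends to 1 with eta. *)
Lemma regularly_varying_near1 (eps : R) : 0 < k -> 0 < eps ->
  exists2 eta, 0 < eta < 1 &
    \forall x \near +oo, f ((1 - eta) * x) <= (1 + eps) * f x.
Proof.
move=> k0 e0.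
pose a := (1 + eps / 2) `^ (- k^-1).
have a_gt0 : 0 < a by rewrite powR_gt0// addr_gt0// divr_gt0.
have a_lt1 : a < 1.
  rewrite /a /powR gt_eqF ?addr_gt0 ?divr_gt0// -[ltRHS]expR0 ltr_expR mulNr oppr_lt0.
  by rewrite mulr_gt0 ?invr_gt0// ln_gt0// ltrDl divr_gt0.
have aE : a `^ (- k) = 1 + eps / 2.
  by rewrite /a -powRrM mulrNN mulVf ?gt_eqF// powRr1// addr_ge0// divr_ge0// ltW.
exists (1 - a); first by rewrite subr_gt0 a_lt1 /= ltrBlDr ltrDl.
rewrite subKr.
have lt2 : a `^ (- k) < 1 + eps by rewrite aE; lra.
have := @cvgr_le _ _ _ _ _ _ (@f_rv a a_gt0) _ lt2.
move=> /(_ _)h.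
near=> x; rewrite -ler_pdivrMr; first by near: x; exact: h.
by near: x.
Unshelve. all: by end_near. Qed.

End regular_variation.

Section tail_asymptotics.
Context (R : realType).

Lemma asymp_regularly_varying (U L : R -> R) (alpha : R) : slowly_varying L ->
  asymp_equal U (fun x => L x * x `^ (- alpha)) ->
  (\forall x \near +oo, 0 < U x) /\ regularly_varying U alpha.
Proof.
move=> [_ L_gt0 Lsv] UL.
pose h x := L x * x `^ (- alpha).
have h_gt0 : \forall x \near +oo, 0 < h x.
  near=> x; rewrite mulr_gt0//; first by near: x.
  by rewrite powR_gt0.
have Uh_gt0 : \forall x \near +oo, 0 < U x / h x.
  exact: (@cvgr_gt _ _ _ _ _ _ UL 0 ltr01).
have U_gt0 : \forall x \near +oo, 0 < U x.
  near=> x; have hx : 0 < h x by near: x.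
  by rewrite -(pmulr_lgt0 _ (x := (h x)^-1)) ?invr_gt0//; near: x.
split=> // t t0.
have cvt : t * x @[x --> +oo] --> +oo by exact: gt0_cvgMry.
have H1 : U (t * x) / h (t * x) @[x --> +oo] --> (1 : R).
  exact: (cvg_comp _ _ cvt UL).
have H2 : (U x / h x)^-1 @[x --> +oo] --> (1 : R)^-1.
  by apply: cvgV => //; exact: oner_neq0.
have H3 : L (t * x) / L x * t `^ (- alpha) @[x --> +oo] --> 1 * t `^ (- alpha).
  by apply: cvgMl; exact: Lsv.
have H : (U (t * x) / h (t * x)) * (U x / h x)^-1 *
    (L (t * x) / L x * t `^ (- alpha)) @[x --> +oo] -->
    (1 * 1^-1 * (1 * t `^ (- alpha)) : R).
  by apply: cvgM H3; exact: cvgM.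
rewrite invr1 !mul1r in H.
apply: cvg_trans H; apply: near_eq_cvg; near=> x.
have x0 : 0 < x by [].
have hx : h x != 0 by rewrite gt_eqF//; near: x.
have Lx : L x != 0 by rewrite gt_eqF//; near: x.
have Ux : U x != 0 by rewrite gt_eqF//; near: x.
have htx : h (t * x) != 0.
  rewrite gt_eqF//; near: x; exact: (cvt _ h_gt0).
have hE : h (t * x) = L (t * x) * (t `^ (- alpha) * x `^ (- alpha)).
  by rewrite /h powRM// ltW.
have xa : x `^ (- alpha) != 0 by rewrite gt_eqF// powR_gt0.
have ta : t `^ (- alpha) != 0 by rewrite gt_eqF// powR_gt0.
move: htx; rewrite hE mulf_eq0 negb_or => /andP[Ltx _].
rewrite /h in hx *; field.
by rewrite ?Lx ?Ux ?xa ?ta ?Ltx.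
Unshelve. all: by end_near. Qed.

End tail_asymptotics.

(** * Moments of variables with power tails *)

Section power_tails.
Context (R : realType).
Local Notation leb := (@lebesgue_measure R).

Lemma cvg_powRN (b : R) : 0 < b -> x `^ (- b) @[x --> +oo] --> (0 : R).
Proof.
move=> b0; apply/cvgr0Pnorm_le => e e0.
apply: (@ge_near_pinfty _ _ (e `^ (- b^-1))) => x xe.
have e1 : 0 < e `^ (- b^-1) by rewrite powR_gt0.
rewrite ger0_norm ?powR_ge0// powRN invf_ple ?posrE ?powR_gt0//; last first.
  exact: lt_le_trans xe.
have -> : e^-1 = (e `^ (- b^-1)) `^ b.
  by rewrite -powRrM mulNr mulVf ?gt_eqF// powR_inv1// ltW.
by apply: powR_base_le => //; exact: ltW.
Qed.

Lemma integral_powRN_lty (a r0 : R) : 1 < a -> 0 < r0 ->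
  (\int[leb]_(r in `[r0, +oo[) (r `^ (- a))%:E < +oo)%E.
Proof.
move=> a1 r00; have a1' : 1 - a != 0 by rewrite lt_eqF// subr_lt0.
pose F (r : R) := (1 - a)^-1 * r `^ (1 - a).
have dF (x : R) : 0 < x -> is_derive x 1 F (x `^ (- a)).
  move=> x0; have h := is_derive1_powR (1 - a) x0.
  apply: is_derive_eq; rewrite /GRing.scale/= mulrA mulVf// mul1r.
  by congr powR; ring.
have cF (x : R) : 0 < x -> {for x, continuous F}.
  move=> x0; apply: differentiable_continuous; apply/derivable1_diffP.
  exact: (@ex_derive _ _ _ _ _ _ _ (dF x x0)).
rewrite (_ : (\int[leb]_(r in _) _)%E = 0%:E - (F r0)%:E)%E; first exact: ltry.
apply: ge0_continuous_FTC2y.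
- by move=> x _; exact: powR_ge0.
- apply: continuous_in_subspaceT => x; rewrite inE/= in_itv/= andbT => rx.
  have x0 := lt_le_trans r00 rx.
  apply: differentiable_continuous; apply/derivable1_diffP.
  exact: (@ex_derive _ _ _ _ _ _ _ (is_derive1_powR (- a) x0)).
- rewrite -[X in _ --> X](mulr0 (1 - a)^-1); apply: cvgMr.
  by rewrite -opprB; apply: cvg_powRN; rewrite subr_gt0.
- move=> x rx; exact: (@ex_derive _ _ _ _ _ _ _ (dF x (lt_trans r00 rx))).
- exact: cvg_at_right_filter (cF _ r00).
- move=> x; rewrite in_itv/= andbT => rx; rewrite derive1E.
  exact: (@derive_val _ _ _ _ _ _ _ (dF x (lt_trans r00 rx))).
Qed.

End power_tails.

Section moments_from_tails.
Context d (T : measurableType d) (R : realType) (P : probability T R).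
Local Notation leb := (@lebesgue_measure R).

(** P(Y^p > u) is the tail of Y at u^(1/p), of order u^(- q/p) with q/p > 1. *)
Lemma integrable_powR_of_tail (Y : {RV P >-> R}) (p q : R) :
  (forall w, 0 <= Y w) -> 0 < p < q ->
  (exists2 C, 0 < C & \forall x \near +oo, tail Y x <= C * x `^ (- q)) ->
  P.-integrable setT (EFin \o (fun w => Y w `^ p)).
Proof.
move=> Y0 /andP[p0 pq] [C C0 hC].
have mYp : measurable_fun setT (fun w => Y w `^ p).
  by apply: (measurableT_comp (f := @powR R ^~ p)) => //; exact: measurable_powR.
pose Z : {RV P >-> R} := mfun_Sub (mem_set mYp).
apply/integrableP; split; first exact/measurable_EFinP.
rewrite (_ : (\int[P]_x _)%E = 'E_P[Z]%E); last first.
  rewrite expectation_def; apply: eq_integral => w _ /=.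
  by rewrite ger0_norm// powR_ge0.
rewrite ge0_expectation_ccdf; last by move=> w; exact: powR_ge0.
have [x0 x0_gt0 Hx0] := near_pinfty_ge 0 hC.
pose r0 := x0 `^ p.
have r0_gt0 : 0 < r0 by rewrite powR_gt0.
have q0 : 0 < q := lt_trans p0 pq.
rewrite (_ : `[0, +oo[%classic = `[0, r0[%classic `|` `[r0, +oo[%classic); last first.
  by rewrite -itv_bndbnd_setU// bnd_simp ltW.
rewrite ge0_integral_setU//=; last 2 first.
- exact: measurable_funTS (ccdf_measurable Z).
- by apply/disj_setPS => z []/=; rewrite !in_itv/= andbT => /andP[_]; rewrite ltNge => /negP.
apply: lte_add_pinfty.
  apply: (@le_lt_trans _ _ (\int[leb]_(x in `[0%R, r0[) 1)%E).
    apply: ge0_le_integral => //.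
      exact: measurable_funTS (ccdf_measurable Z).
    by move=> x _; exact: probability_le1.
  rewrite integral_cst; last exact: measurable_itv.
  by rewrite mul1e [X in (X < _)%E](lebesgue_measure_itv `[0%R, r0[)/= lte_fin r0_gt0 ltry.
apply: (@le_lt_trans _ _ (\int[leb]_(x in `[r0, +oo[) (C%:E * (x `^ (- (q / p)))%:E))%E).
  apply: ge0_le_integral => //.
  - exact: measurable_funTS (ccdf_measurable Z).
  - apply/measurable_EFinP; apply: measurable_funM => //.
    exact: measurable_funTS (measurable_powR _).
  - move=> r /=; rewrite in_itv/= andbT => r0r.
    have r_gt0 := lt_le_trans r0_gt0 r0r.
    have -> : ccdf Z r = (tail Y (r `^ p^-1))%:E.
      rewrite /tail fineK ?fin_num_measure// /ccdf /distribution /pushforward.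
      congr (P _); apply/seteqP; split => w /=; rewrite !in_itv/= !andbT => h.
        rewrite ltNge; apply/negP => h1.
        have := powR_base_le (ltW p0) (Y0 w) h1.
        by rewrite -powRrM mulVf ?gt_eqF// powRr1 ?(ltW r_gt0)// leNgt h.
      rewrite ltNge; apply/negP => h1.
      have pV : 0 <= p^-1 by rewrite invr_ge0 ltW.
      have := powR_base_le pV (powR_ge0 _ _) h1.
      by rewrite -powRrM mulfV ?gt_eqF// powRr1// leNgt h.
    rewrite lee_fin (le_trans (Hx0 _ _))//.
      have pV : 0 <= p^-1 by rewrite invr_ge0 ltW.
      have := powR_base_le pV (ltW r0_gt0) r0r.
      by rewrite /r0 -powRrM mulfV ?gt_eqF// powRr1 ?(ltW x0_gt0).
    by rewrite -powRrM ler_pM2l// (_ : p^-1 * - q = - (q / p))//; ring.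
rewrite ge0_integralZl//; last 3 first.
- by apply/measurable_EFinP; exact: measurable_funTS (measurable_powR _).
- by move=> r _; rewrite lee_fin powR_ge0.
- by rewrite lee_fin ltW.
by rewrite lte_mul_pinfty ?lee_fin ?(ltW C0)// integral_powRN_lty// ltr_pdivlMr// mul1r.
Qed.

End moments_from_tails.

(** * The equilibrium law of the processing times *)

Section equilibrium.
Context d (T : measurableType d) (R : realType) (P : probability T R).
Local Notation leb := (@lebesgue_measure R).
Variables V X : {RV P >-> R}.
Hypothesis V_ge0 : forall w, 0 <= V w.
Hypothesis V_integrable : P.-integrable setT (EFin \o V).
Hypothesis m_gt0 : 0 < mean V.
Hypothesis X_density : has_density X (equilibrium_density V).

Let m := mean V.

Lemma integrated_tail (Z : {RV P >-> R}) (x : R) :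
  (\int[leb]_(v in `]x, +oo[) ccdf Z v = \int[P]_w (Num.max (Z w - x) 0)%:E)%E.
Proof.
rewrite integral_ccdf//; apply: eq_integral => w _.
rewrite (@lebesgue_measure_sandwich _ x (x + Num.max (Z w - x) 0)).
- by congr _%:E; ring.
- by rewrite lerDl le_max lexx orbT.
- exact: measurableI.
- move=> v /=; rewrite !in_itv/= andbT => /andP[xv].
  by rewrite -ltrBlDl lt_max => /orP[|] ?; split => //; lra.
- move=> v []/=; rewrite !in_itv/= andbT => xv vV.
  by rewrite ltW//= -lerBlDl le_max; apply/orP; left; lra.
Qed.

Lemma equilibrium_measure (B : set R) : measurable B -> B `<=` `]0, +oo[ ->
  (m%:E * P (X @^-1` B) = \int[leb]_(t in B) ccdf V t)%E.
Proof.
move=> mB B0.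
rewrite -[P _]/(distribution P X B) X_density//.
have -> : (\int[leb]_(t in B) (equilibrium_density V t)%:E =
    \int[leb]_(t in B) ((m^-1)%:E * ccdf V t))%E.
  apply: eq_integral => t tB; rewrite /equilibrium_density patchE ifT; last first.
    by rewrite inE; apply: B0; rewrite inE in tB.
  by rewrite mulrC EFinM /tail fineK// fin_num_measure.
rewrite ge0_integralZl//; last 2 first.
- exact: measurable_funTS (ccdf_measurable V).
- by rewrite lee_fin invr_ge0 ltW.
by rewrite muleA -EFinM divff ?gt_eqF// mul1e.
Qed.

Lemma equilibrium_le0 : P (X @^-1` `]-oo, 0]) = 0%E.
Proof.
rewrite -[LHS]/(distribution P X _) X_density// integral0_eq// => t /=.
rewrite in_itv/= => t0; rewrite /equilibrium_density patchE ifF//.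
by apply/negP; rewrite inE/= in_itv/= andbT ltNge t0.
Qed.

Let mXp : measurable_fun setT (fun w => Num.max (X w) 0).
Proof. exact: measurable_maxr. Qed.

(** When X has a density carried by the positive half-line, this is a version
    of X that is nonnegative everywhere. *)
Definition positive_part : {RV P >-> R} := mfun_Sub (mem_set mXp).

Local Notation Y := positive_part.

Lemma positive_part_ge0 w : 0 <= Y w.
Proof. by rewrite /= le_max lexx orbT. Qed.

Lemma tail_positive_part x : 0 <= x -> tail Y x = tail X x.
Proof.
move=> x0; rewrite /tail /ccdf /distribution /pushforward; congr (fine (P _)).
apply/seteqP; split => w /=; rewrite !in_itv/= !andbT lt_max.
  by move=> /orP[//|]; rewrite ltNge x0.
by move=> ->.
Qed.

Lemma positive_part_equilibrium (u : R) : 0 <= u ->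
  (m%:E * P (Y @^-1` `]-oo, u]) = \int[leb]_(v in `]0%R, u]) ccdf V v)%E.
Proof.
move=> u0; rewrite -equilibrium_measure//; last first.
  by move=> t /=; rewrite !in_itv/= => /andP[->].
congr (_ * _)%E.
have -> : Y @^-1` `]-oo, u] = X @^-1` `]-oo, 0] `|` X @^-1` `]0, u].
  rewrite -preimage_setU -itv_bndbnd_setU// ?bnd_simp//.
  by apply/seteqP; split => w /=; rewrite !in_itv/= ge_max u0 andbT.
rewrite measureU//; last 3 first.
- exact: measurable_funPTI.
- exact: measurable_funPTI.
- by rewrite -subset0 => w []/=; rewrite !in_itv/= => /le_lt_trans h /andP[/h]; rewrite ltxx.
by rewrite [X in (X + _)%E]equilibrium_le0 add0e.
Qed.

Lemma expectation_positive_part : 'E_P[X]%E = 'E_P[Y]%E.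
Proof.
rewrite !expectation_def; apply: ae_eq_integral => //.
- exact/measurable_EFinP.
- exact/measurable_EFinP.
exists (X @^-1` `]-oo, 0]); split; first exact: measurable_funPTI.
  exact: equilibrium_le0.
move=> w /= /not_implyP[_ h]; rewrite in_itv/= leNgt; apply/negP => Xw.
by apply: h; rewrite max_l// ltW.
Qed.

Lemma equilibrium_tail (x : R) : 0 <= x ->
  m * tail X x = \int[P]_w Num.max (V w - x) 0.
Proof.
move=> x0; rewrite /Rintegral -integrated_tail -equilibrium_measure//.
  by rewrite fineM// fin_num_measure//; exact: measurable_funPTI.
by move=> t /=; rewrite !in_itv/= !andbT; exact: le_lt_trans.
Qed.

Lemma integrable_excess (x : R) : 0 <= x ->
  P.-integrable setT (EFin \o (fun w => Num.max (V w - x) 0)).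
Proof.
move=> x0; apply: le_integrable V_integrable => //.
  by apply/measurable_EFinP; apply: measurable_maxr => //; exact: measurable_funB.
move=> w _ /=; have h := V_ge0 w.
by rewrite lee_fin !ger0_norm// ?le_max ?lexx ?orbT// ge_max h andbT gerBl.
Qed.

(** After division by t, both sides are integrals of the tail of V / t, which
    is E (V / t - x)^+. *)
Lemma equilibrium_tail_scaled (t x : R) : 0 <= x -> 0 < t ->
  (\int[leb]_(v in `]x, +oo[) (tail V (t * v))%:E = (m / t * tail X (t * x))%:E)%E.
Proof.
move=> x0 t0.
have mVt : measurable_fun setT (fun w => V w / t) by exact: measurable_funM.
pose Vt : {RV P >-> R} := mfun_Sub (mem_set mVt).
transitivity (\int[leb]_(v in `]x, +oo[) ccdf Vt v)%E.
  apply: eq_integral => v _; rewrite /tail fineK ?fin_num_measure//.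
  rewrite /ccdf /distribution /pushforward; congr (P _).
  by apply/seteqP; split => w /=; rewrite !in_itv/= !andbT ltr_pdivlMr// mulrC.
rewrite integrated_tail.
have -> : m / t * tail X (t * x) = t^-1 * \int[P]_w Num.max (V w - t * x) 0.
  by rewrite -equilibrium_tail ?mulr_ge0 ?(ltW t0)// mulrCA mulrA mulrC.
have i1 := integrable_excess (mulr_ge0 (ltW t0) x0).
rewrite -RintegralZl//.
rewrite /Rintegral fineK; last first.
  apply: integrable_fin_num => //.
  by have := integrableZl measurableT t^-1 i1; exact: eq_integrable.
apply: eq_integral => w _; congr _%:E.
rewrite maxr_pMr ?invr_ge0 ?(ltW t0)// mulr0; congr Num.max.
by rewrite -[Vt w]/(V w / t); field; rewrite gt_eqF.
Qed.

Lemma equilibrium_tailE (x : R) : 0 <= x ->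
  (\int[leb]_(v in `]x, +oo[) (tail V v)%:E = (m * tail X x)%:E)%E.
Proof.
move=> x0; have := equilibrium_tail_scaled x0 ltr01.
by rewrite divr1 mul1r; under eq_integral do rewrite mul1r.
Qed.

Hypothesis V_gt0 : \forall x \near +oo, 0 < tail V x.

Lemma equilibrium_tail_gt0 (x : R) : 0 <= x -> 0 < tail X x.
Proof.
move=> x0.
have [M xM HM] := near_pinfty_ge x V_gt0.
rewrite -(pmulr_rgt0 _ m_gt0) equilibrium_tail//.
apply: (@lt_le_trans _ _ ((M - x) * tail V M)).
  by rewrite mulr_gt0 ?subr_gt0// HM.
rewrite -Rintegral_gt_indic -RintegralZl//; last exact: integrable_gt_indic.
apply: le_Rintegral => //.
- have := integrableZl measurableT (M - x) (integrable_gt_indic V M).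
  by apply: eq_integrable.
- exact: integrable_excess.
move=> w _; have [MV|VM] := ltP M (V w); last by rewrite mulr0 le_max lexx orbT.
by rewrite mulr1 le_max lerD2r ltW.
Qed.

Let measurable_tail (D : set R) : measurable D ->
  measurable_fun D (fun v => (tail V v)%:E).
Proof.
move=> mD; apply/measurable_EFinP/measurable_funTS.
apply: (measurableT_comp (fine_measurable measurableT)).
exact: ccdf_measurable.
Qed.

Let measurable_tail_scaled (t : R) (D : set R) : measurable D ->
  measurable_fun D (fun v => (tail V (t * v))%:E).
Proof.
move=> mD; apply: measurable_funTS.
apply: (measurableT_comp (measurable_tail measurableT)).
exact: measurable_funM.
Qed.

Lemma equilibrium_tail_scaled_le (c t x : R) : 0 <= c -> 0 <= x -> 0 < t ->
  (forall v, x < v -> tail V (t * v) <= c * tail V v) ->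
  t^-1 * tail X (t * x) <= c * tail X x.
Proof.
move=> c0 x0 t0 h.
rewrite -(ler_pM2l m_gt0) mulrA -/m [leRHS]mulrCA -lee_fin EFinM -EFinM.
rewrite -equilibrium_tail_scaled// EFinM -equilibrium_tailE//.
rewrite -ge0_integralZl//; last 2 first.
- exact: measurable_tail.
- by move=> v _; rewrite lee_fin tail_ge0.
apply: ge0_le_integral => //.
- by move=> v _; rewrite lee_fin tail_ge0.
- exact: measurable_tail_scaled.
- by apply: measurable_funeM; exact: measurable_tail.
- by move=> v /=; rewrite in_itv/= andbT => /h; rewrite -EFinM lee_fin.
Qed.

Lemma equilibrium_tail_scaled_ge (c t x : R) : 0 <= c -> 0 <= x -> 0 < t ->
  (forall v, x < v -> c * tail V v <= tail V (t * v)) ->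
  c * tail X x <= t^-1 * tail X (t * x).
Proof.
move=> c0 x0 t0 h.
rewrite -(ler_pM2l m_gt0) [leRHS]mulrA -/m [leLHS]mulrCA -lee_fin EFinM.
rewrite -equilibrium_tailE// -[X in (_ <= X)%E]equilibrium_tail_scaled//.
rewrite -ge0_integralZl//; last 2 first.
- exact: measurable_tail.
- by move=> v _; rewrite lee_fin tail_ge0.
apply: ge0_le_integral => //.
- by move=> v _; rewrite -EFinM lee_fin mulr_ge0 ?tail_ge0.
- by apply: measurable_funeM; exact: measurable_tail.
- exact: measurable_tail_scaled.
- by move=> v /=; rewrite in_itv/= andbT => /h; rewrite -EFinM lee_fin.
Qed.

(** m P(X > x) integrates the tail of V over (x, +oo), so a comparison of
    tail V (t v) with t^(- alpha) tail V v that is uniform in v > x passes to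
    the tail of X, where the change of variable supplies the factor t. *)
Lemma equilibrium_regularly_varying (alpha : R) :
  regularly_varying (tail V) alpha -> regularly_varying (tail X) (alpha - 1).
Proof.
move=> rv t t0; apply/cvgrPdist_le => e e0.
have e1 : 0 < e / t by rewrite divr_gt0.
have /cvgrPdist_le/(_ _ e1) h := rv _ t0.
have h2 : \forall x \near +oo, 0 < tail V x /\
    `|t `^ (- alpha) - tail V (t * x) / tail V x| <= e / t.
  by near=> x; split; near: x.
have [x0 x0_gt0 Hx0] := near_pinfty_ge 0 h2.
apply: (@ge_near_pinfty _ _ x0) => x x0x.
have x_ge0 : 0 <= x by rewrite (le_trans (ltW x0_gt0)).
have X0 := equilibrium_tail_gt0 x_ge0.
have tE : t `^ (- (alpha - 1)) = t * t `^ (- alpha).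
  by rewrite opprB addrC powRD ?powRr1 ?(ltW t0) 1?mulrC// (gt_eqF t0) implybT.
have up : tail X (t * x) / tail X x <= t `^ (- (alpha - 1)) + e.
  rewrite tE ler_pdivrMr//.
  have := @equilibrium_tail_scaled_le (t `^ (- alpha) + e / t) t x.
  rewrite addr_ge0 ?powR_ge0 ?(ltW e1)// x_ge0 t0 => /(_ isT isT isT) up.
  have {}up : t^-1 * tail X (t * x) <= (t `^ (- alpha) + e / t) * tail X x.
    apply: up => v xv; have [V0] := Hx0 v (le_trans x0x (ltW xv)).
    by rewrite ler_norml -(ler_pdivrMr _ _ V0) => /andP[]; lra.
  rewrite mulrC ler_pdivrMr// in up; apply: le_trans up _.
  by rewrite le_eqVlt; apply/orP; left; apply/eqP; field; rewrite gt_eqF.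
have down : t `^ (- (alpha - 1)) - e <= tail X (t * x) / tail X x.
  rewrite tE ler_pdivlMr//.
  have [c0|c0] := leP 0 (t `^ (- alpha) - e / t); last first.
    have : t * t `^ (- alpha) - e <= 0.
      by move: c0; rewrite subr_lt0 ltr_pdivlMr// mulrC subr_le0 => /ltW.
    by move=> /mulr_le0_ge0 h0; apply: le_trans (tail_ge0 _ _); apply: h0; exact: ltW.
  have := @equilibrium_tail_scaled_ge (t `^ (- alpha) - e / t) t x.
  rewrite c0 x_ge0 t0 => /(_ isT isT isT) down.
  have {}down : (t `^ (- alpha) - e / t) * tail X x <= t^-1 * tail X (t * x).
    apply: down => v xv; have [V0] := Hx0 v (le_trans x0x (ltW xv)).
    by rewrite ler_norml -(ler_pdivlMr _ _ V0) => /andP[]; lra.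
  rewrite [leRHS]mulrC ler_pdivlMr// in down; apply: le_trans down.
  by rewrite le_eqVlt; apply/orP; left; apply/eqP; field; rewrite gt_eqF.
by rewrite distrC ler_norml; lra.
Unshelve. all: by end_near. Qed.

Let integral_triangle (v : R) : 0 <= v ->
  (\int[leb]_(r in `[0%R, +oo[) (Num.max (v - r) 0)%:E = (v ^+ 2 / 2)%:E)%E.
Proof.
move=> v0; transitivity (\int[leb]_(r in `[0%R, v]) (v - r)%:E)%E.
  rewrite integral_mkcond [RHS]integral_mkcond; apply: eq_integral => r _.
  rewrite !patchE !mem_setE !in_itv/= andbT; have [r0|//] := leP 0 r.
  rewrite andTb; have [rv|vr] := leP r v; first by rewrite max_l// subr_ge0.
  by rewrite max_r// subr_le0 ltW.
pose F (r : R) := v * r - r ^+ 2 / 2.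
have -> : v ^+ 2 / 2 = F v - F 0 by rewrite /F; field.
apply: integral_primitive => //.
- have c : continuous (fun r : R => v - r).
    by move=> r; apply: differentiable_continuous; apply/derivable1_diffP.
  exact: c.
- by move=> r; apply: is_derive_eq; rewrite /GRing.scale/=; field.
Qed.

(** E X integrates P(X > r) = E (V - r)^+ / m over r >= 0, and (v - r)^+
    integrates to v^2 / 2. *)
Lemma equilibrium_mean : P.-integrable setT (EFin \o (fun w => V w ^+ 2)) ->
  ('E_P[X] = (fine 'E_P[fun w => (V w ^+ 2)%R] / (2 * m))%:E)%E.
Proof.
move=> iV2.
have h : (m%:E * 'E_P[X] = (fine 'E_P[fun w => (V w ^+ 2)%R] / 2)%:E)%E.
  rewrite expectation_positive_part ge0_expectation_ccdf; last exact: positive_part_ge0.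
  rewrite -ge0_integralZl//; last 2 first.
  - exact: measurable_funTS (ccdf_measurable _).
  - by rewrite lee_fin ltW.
  have mf : measurable_fun setT (fun p : R * T => (Num.max (V p.2 - p.1) 0 * \1_(`[0%R, +oo[%classic : set R) p.1)%:E).
    apply/measurable_EFinP; apply: measurable_funM.
      apply: measurable_maxr => //; apply: measurable_funB => //.
      exact: measurableT_comp.
    by apply: measurableT_comp => //; exact: measurable_indic.
  have f0 p : (0 <= (Num.max (V p.2 - p.1) 0 * \1_(`[0%R, +oo[%classic : set R) p.1)%:E)%E.
    by rewrite lee_fin mulr_ge0// le_max lexx orbT.
  transitivity (\int[leb]_r \int[P]_w (Num.max (V w - r) 0 * \1_(`[0%R, +oo[%classic : set R) r)%:E)%E.
    rewrite integral_mkcond; apply: eq_integral => r _.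
    rewrite patchE indicE; case: (boolP (r \in `[0%R, +oo[%classic)) => r0.
      under [RHS]eq_integral do rewrite mulr1.
      rewrite -integrated_tail -equilibrium_measure//; last first.
        move=> t /=; rewrite !in_itv/= !andbT.
        by move: r0; rewrite mem_setE in_itv/= andbT; exact: le_lt_trans.
      congr (_ * _)%E; rewrite -[LHS](@fineK) ?fin_num_measure// -[RHS](@fineK).
        congr _%:E; apply: tail_positive_part.
        by move: r0; rewrite mem_setE in_itv/= andbT.
      by apply: fin_num_measure; exact: measurable_funPTI.
    by rewrite integral0_eq// => w _; rewrite mulr0.
  transitivity (\int[P]_w \int[leb]_r (Num.max (V w - r) 0 * \1_(`[0%R, +oo[%classic : set R) r)%:E)%E.
    exact: (@fubini_tonelli _ _ _ _ R leb P _ mf f0).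
  transitivity (\int[P]_w ((2^-1)%:E * (V w ^+ 2)%:E))%E.
    apply: eq_integral => w _; rewrite -EFinM mulrC -integral_triangle//.
    rewrite [RHS]integral_mkcond; apply: eq_integral => r _.
    by rewrite patchE indicE; case: (r \in _); rewrite ?mulr1 ?mulr0.
  rewrite integralZl//; rewrite mulrC EFinM; congr (_ * _)%E.
  by rewrite unlock fineK//; exact: integrable_fin_num.
rewrite (_ : _ / (2 * m) = m^-1 * (fine 'E_P[fun w => (V w ^+ 2)%R] / 2)); last first.
  by field; rewrite gt_eqF.
by rewrite EFinM -h muleA -EFinM mulVf ?mul1e// gt_eqF.
Qed.

End equilibrium.

(** * Large deviations of sums of heavy-tailed jumps *)

Section growth_comparison.
Context (R : realType).
Implicit Types (a b c e x : R).

Lemma near_powRN_le (b e : R) : 0 < b -> 0 < e ->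
  \forall x \near +oo, x `^ (- b) <= e.
Proof.
move=> b0 e0; have /cvgr0Pnorm_le/(_ _ e0) := cvg_powRN b0.
by apply: filterS => x; rewrite ger0_norm// powR_ge0.
Qed.

Lemma ln_le_powR (a x : R) : 0 < a -> 0 < x -> ln x <= a^-1 * x `^ a.
Proof.
move=> a0 x0; have xa : 0 < x `^ a by rewrite powR_gt0.
have := ltW (ln_sublinear xa); rewrite ln_powR => h.
by rewrite mulrC ler_pdivlMr// mulrC.
Qed.

Lemma near_powR_ge (b c : R) : 0 < b -> \forall x \near +oo, c <= x `^ b.
Proof.
move=> b0.
have := @near_powRN_le b (`|c| + 1)^-1 b0.
rewrite invr_gt0 ltr_pwDr// => /(_ isT) h.
near=> x; have x0 : 0 < x by [].
have : x `^ (- b) <= (`|c| + 1)^-1 by near: x.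
rewrite powRN lef_pV2 ?posrE ?powR_gt0 ?ltr_pwDr// => /(le_trans _); apply.
by rewrite (le_trans (ler_norm c))// lerDl.
Unshelve. all: by end_near. Qed.

Lemma near_powR_ln_le (b c e : R) : 0 < b -> 0 < e ->
  \forall x \near +oo, c * (ln x * x `^ (- b)) <= e.
Proof.
move=> b0 e0; have b2 : 0 < b / 2 by rewrite divr_gt0.
have e1 : 0 < e / (`|c| + 1) * (b / 2).
  by rewrite mulr_gt0// divr_gt0// ltr_pwDr.
have h := near_powRN_le b2 e1.
near=> x; have x1 : 1 <= x by near: x; exact: nbhs_pinfty_ge.
have x0 : 0 < x by rewrite (lt_le_trans ltr01).
have lx : 0 <= ln x * x `^ (- b) by rewrite mulr_ge0 ?ln_ge0 ?powR_ge0.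
apply: (@le_trans _ _ ((`|c| + 1) * (ln x * x `^ (- b)))).
  by rewrite ler_wpM2r// (le_trans (ler_norm c))// lerDl.
rewrite mulrC -ler_pdivlMr ?ltr_pwDr//.
apply: (@le_trans _ _ ((b / 2)^-1 * x `^ (b / 2) * x `^ (- b))).
  by rewrite ler_wpM2r ?powR_ge0// ln_le_powR.
rewrite -mulrA -powRD; last by rewrite (gt_eqF x0) implybT.
rewrite (_ : b / 2 - b = - (b / 2)); last by field.
rewrite mulrC ler_pdivrMr//; near: x; exact: h.
Unshelve. all: by end_near. Qed.

Lemma near_powR_le_scaled (a b c : R) : a < b -> 0 < c ->
  \forall x \near +oo, x `^ a <= c * x `^ b.
Proof.
move=> ab c0; have ba : 0 < b - a by rewrite subr_gt0.
have h := near_powRN_le ba c0.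
near=> x; have x0 : 0 < x by [].
rewrite -ler_pdivrMr ?powR_gt0// -powRB; last by rewrite (gt_eqF x0) implybT.
by rewrite -opprB; near: x.
Unshelve. all: by end_near. Qed.

End growth_comparison.

Section large_deviations.
Context (R : realType).
Variables (Fb : R -> R) (G : nat -> R -> R) (k p mu mp : R).
Hypothesis Fb_nonincreasing : forall x y, x <= y -> Fb y <= Fb x.
Hypothesis Fb_ge0 : forall x, 0 <= Fb x.
Hypothesis Fb_le1 : forall x, Fb x <= 1.
Hypothesis Fb_gt0 : \forall x \near +oo, 0 < Fb x.
Hypothesis Fb_rv : regularly_varying Fb k.
Hypothesis p12 : 1 < p <= 2.
Hypothesis pk : p < k.
Hypothesis mu_gt0 : 0 < mu.
Hypothesis mp_ge0 : 0 <= mp.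

(** The exponent left over when n jumps truncated at b are weighted by
    exp (s X), beyond the contribution s n mu of their mean. *)
Definition remainder (n : nat) (b s : R) : R :=
  n%:R * (s ^+ 2 * b `^ (2 - p) * expR (s * b) * mp).

Hypothesis G0 : forall x, 0 <= x -> G 0 x = 0.
Hypothesis G_lower : forall n x, 1 - (1 - Fb x) ^+ n <= G n x.
Hypothesis G_truncated : forall n x b s, 0 < b -> 0 <= s ->
  G n x <= n%:R * Fb b + expR (- s * (x - n%:R * mu) + remainder n b s).
Hypothesis G_one_big_jump : forall n x z b s, 0 < b -> 0 <= s -> b <= z ->
  G n x <= n%:R * Fb z + (n%:R * Fb b) ^+ 2 +
    n%:R * Fb b * expR (- s * (x - z - n%:R * mu) + remainder n b s) +
    expR (- s * (x - n%:R * mu) + remainder n b s).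
Hypothesis G_laplace : forall n x s, 0 <= s ->
  1 - G n x <= expR (s * (x - n%:R * mu) + n%:R * (s `^ p * mp)).

(* Sums of n = O(x) jumps fluctuate by about x^(1/p), and 1/p < r < 1. *)
Let r : R := (1 + p^-1) / 2.
(* r p = 1 + 2 c leaves a factor x^(- c) in the remainder below. *)
Let c : R := (r * p - 1) / 2.

Let p_gt0 : 0 < p. Proof. by case/andP : p12 => /(lt_trans ltr01). Qed.
Let r_lt1 : r < 1.
Proof.
have : p^-1 < 1 by rewrite invf_lt1//; case/andP : p12.
rewrite /r; lra.
Qed.
Let r_gt0 : 0 < r.
Proof. by rewrite /r divr_gt0// addr_gt0// invr_gt0. Qed.
Let rpE : r * p = (p + 1) / 2.
Proof. by rewrite /r; field; rewrite gt_eqF. Qed.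
Let c_gt0 : 0 < c.
Proof. by rewrite /c rpE; case/andP : p12 => ? _; lra. Qed.

(* At this rate exp (s b) = x^c. *)
Let s_of (x b : R) := c * ln x / b.

(** With s b = c ln x and b of order at least x^r, the remainder is of order
    x (ln x)^2 x^(- r p) x^c = (ln x)^2 x^(- c). *)
Lemma remainder_le1 (kap K : R) : 0 < kap -> 0 < K ->
  \forall x \near +oo, forall n y, n%:R * mu <= x -> kap * x `^ r <= y ->
    remainder n (y / K) (s_of x (y / K)) <= 1.
Proof.
move=> kap0 K0.
pose A := mu^-1 * ((kap / K) `^ (- p) * (c ^+ 2 * mp)).
have A0 : 0 <= A.
  rewrite mulr_ge0 ?invr_ge0 ?(ltW mu_gt0)// mulr_ge0 ?powR_ge0//.
  by rewrite mulr_ge0// sqr_ge0.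
have c2 : 0 < c / 2 by rewrite divr_gt0.
have h := @near_powR_ln_le R (c / 2) 1 (A + 1)^-1 c2.
rewrite invr_gt0 ltr_wpDl// in h; move: (h isT) => {}h.
near=> x => n y nx xy.
have x1 : 1 <= x by near: x; exact: nbhs_pinfty_ge.
have x0 : 0 < x by rewrite (lt_le_trans ltr01).
have lx0 : 0 <= ln x by rewrite ln_ge0.
have xr0 : 0 < x `^ r by rewrite powR_gt0.
have y0 : 0 < y by rewrite (lt_le_trans _ xy)// mulr_gt0.
set b := y / K; have b0 : 0 < b by rewrite divr_gt0.
have sbE : s_of x b * b = c * ln x by rewrite /s_of divfK// gt_eqF.
have eE : expR (s_of x b * b) = x `^ c by rewrite sbE /powR gt_eqF.
have s2 : s_of x b ^+ 2 * b `^ (2 - p) = (c * ln x) ^+ 2 * b `^ (- p).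
  rewrite powRD ?(gt_eqF b0) ?implybT// (powR_mulrn _ (ltW b0)) mulrA -exprMn.
  by rewrite sbE.
rewrite /remainder eE s2.
have n_le : n%:R <= mu^-1 * x by rewrite mulrC ler_pdivlMr.
have b_le : b `^ (- p) <= (kap / K) `^ (- p) * x `^ (- (r * p)).
  have kx : (kap * x `^ r) / K <= b by rewrite /b ler_pM2r ?invr_gt0.
  have kx0 : 0 < (kap * x `^ r) / K by rewrite divr_gt0 ?mulr_gt0.
  rewrite -mulrN powRrM -powRM ?(ltW xr0) ?divr_ge0 ?(ltW kap0) ?(ltW K0)//.
  rewrite !powRN lef_pV2 ?posrE ?powR_gt0 ?mulr_gt0 ?invr_gt0//.
  apply: powR_base_le; rewrite ?(ltW p_gt0)//.
    by rewrite ltW// mulr_gt0// divr_gt0.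
  by rewrite mulrAC.
have -> : n%:R * ((c * ln x) ^+ 2 * b `^ (- p) * x `^ c * mp) =
   (n%:R * b `^ (- p)) * ((c * ln x) ^+ 2 * x `^ c * mp) by ring.
apply: (@le_trans _ _ ((mu^-1 * x * ((kap / K) `^ (- p) * x `^ (- (r * p)))) *
    ((c * ln x) ^+ 2 * x `^ c * mp))).
  apply: ler_wpM2r.
    by rewrite mulr_ge0// mulr_ge0 ?powR_ge0// sqr_ge0.
  by apply: ler_pM; rewrite ?powR_ge0.
have -> : (mu^-1 * x * ((kap / K) `^ (- p) * x `^ (- (r * p)))) *
    ((c * ln x) ^+ 2 * x `^ c * mp) =
   A * (ln x * x `^ (- (c / 2))) ^+ 2.
  have xE : x * x `^ (- (r * p)) * x `^ c = x `^ (- (c / 2)) ^+ 2.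
    rewrite -(powR_mulrn _ (powR_ge0 _ _)) -powRrM -{1}[x](powRr1 (ltW x0)).
    rewrite -!powRD ?(gt_eqF x0) ?implybT//; congr powR.
    by rewrite (_ : r * p = c * 2 + 1); [field|rewrite /c; field].
  rewrite [(ln x * _) ^+ 2]exprMn -xE /A; ring.
have hx : ln x * x `^ (- (c / 2)) <= (A + 1)^-1.
  by rewrite -[leLHS]mul1r; near: x.
have hx0 : 0 <= ln x * x `^ (- (c / 2)) by rewrite mulr_ge0 ?powR_ge0.
have A1 : (A + 1)^-1 <= 1 by rewrite invf_le1; lra.
have : (ln x * x `^ (- (c / 2))) ^+ 2 <= (A + 1)^-1.
  by rewrite expr2; apply: le_trans (ler_piMr hx0 (le_trans hx A1)) _.
move=> h2; apply: (le_trans (ler_wpM2l A0 h2)).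
by rewrite ler_pdivrMr; lra.
Unshelve. all: by end_near. Qed.

(** If the mean of S_n falls short of x by y, then S_n > x requires a jump
    above y / K, up to a probability that is a power of x improving with K. *)
Lemma truncated_bound (kap K : R) : 0 < kap -> 0 < K ->
  \forall x \near +oo, forall n y, kap * x `^ r <= y -> y <= x - n%:R * mu ->
    G n x <= n%:R * Fb (y / K) + expR 1 * x `^ (- (c * K)).
Proof.
move=> kap0 K0; have hr := remainder_le1 kap0 K0.
near=> x => n y xy yx.
have x1 : 1 <= x by near: x; exact: nbhs_pinfty_ge.
have x0 : 0 < x by rewrite (lt_le_trans ltr01).
have lx0 : 0 <= ln x by rewrite ln_ge0.
have y0 : 0 < y by rewrite (lt_le_trans _ xy)// mulr_gt0// powR_gt0.
have b0 : 0 < y / K by rewrite divr_gt0.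
have s0 : 0 <= s_of x (y / K).
  by rewrite /s_of divr_ge0 ?(ltW b0)// mulr_ge0// ltW.
apply: (le_trans (G_truncated _ _ b0 s0)); rewrite lerD2l.
rewrite /powR (gt_eqF x0) -expRD ler_expR addrC lerD//.
  have H : forall n y, n%:R * mu <= x -> kap * x `^ r <= y ->
    remainder n (y / K) (s_of x (y / K)) <= 1 by near: x.
  by apply: H => //; lra.
rewrite !mulNr lerN2.
rewrite (_ : c * K * ln x = s_of x (y / K) * y).
  by rewrite ler_wpM2l.
by rewrite /s_of; field; rewrite !gt_eqF.
Unshelve. all: by end_near. Qed.

Let Fb_upper (q : R) : 0 <= q < k ->
  exists2 C, 0 < C & \forall x \near +oo, Fb x <= C * x `^ (- q).
Proof. exact: regularly_varying_upper. Qed.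

Let k_gt1 : 1 < k. Proof. by apply: lt_trans pk; case/andP : p12. Qed.

Lemma power_negligible (C e : R) : 0 < e ->
  \forall x \near +oo, C * x `^ (- (k + 1)) <= e * Fb x.
Proof.
move=> e0.
have [|c1 c10 h1] := @regularly_varying_lower _ _ _ Fb_nonincreasing Fb_gt0 Fb_rv (k + 2^-1).
  by have := k_gt1; lra.
have h2 := @near_powR_le_scaled R (- (k + 1)) (- (k + 2^-1)) (e * c1 / (`|C| + 1)).
have h3 : \forall x \near +oo,
   x `^ (- (k + 1)) <= (e * c1 / (`|C| + 1)) * x `^ (- (k + 2^-1)).
  by apply: h2; [lra|rewrite divr_gt0 ?mulr_gt0// ltr_pwDr].
near=> x.
apply: (@le_trans _ _ ((`|C| + 1) * x `^ (- (k + 1)))).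
  by rewrite ler_wpM2r ?powR_ge0// (le_trans (ler_norm C))// lerDl.
have h : x `^ (- (k + 1)) <= (e * c1 / (`|C| + 1)) * x `^ (- (k + 2^-1)) by near: x.
have hx : c1 * x `^ (- (k + 2^-1)) <= Fb x by near: x.
have C1 : 0 < `|C| + 1 by rewrite ltr_pwDr.
apply: (le_trans (ler_wpM2l (ltW C1) h)).
rewrite mulrA [(_ + 1) * _]mulrC divfK ?gt_eqF// -mulrA.
by rewrite ler_wpM2l// ltW.
Unshelve. all: by end_near. Qed.

Lemma linear_tail_negligible (a e : R) : 0 < a -> 0 < e ->
  \forall x \near +oo, x * Fb (a * x) <= e.
Proof.
move=> a0 e0.
have [|C C0 h1] := Fb_upper (q := p); first by rewrite (ltW p_gt0) pk.
have p1 : 0 < p - 1 by rewrite subr_gt0; case/andP : p12.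
have Ca : 0 < C * a `^ (- p) by rewrite mulr_gt0// powR_gt0.
have h2 := near_powRN_le p1 (divr_gt0 e0 Ca).
have h3 : \forall x \near +oo, Fb (a * x) <= C * (a * x) `^ (- p).
  have [M M0 HM] := near_pinfty_ge 0 h1.
  apply: (@ge_near_pinfty _ _ (M / a)) => x.
  by rewrite ler_pdivrMr// mulrC => /HM.
near=> x; have x0 : 0 < x by [].
apply: (@le_trans _ _ (x * (C * (a * x) `^ (- p)))).
  by rewrite ler_pM2l//; near: x.
rewrite powRM ?(ltW a0) ?(ltW x0)//.
have -> : x * (C * (a `^ (- p) * x `^ (- p))) = C * a `^ (- p) * x `^ (- (p - 1)).
  rewrite opprB addrC powRD ?(gt_eqF x0) ?implybT// (powRr1 (ltW x0)); ring.
by rewrite mulrC -ler_pdivlMr//; near: x.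
Unshelve. all: by end_near. Qed.

(** K is such that the exponential term is of order x^(- k - 1), which is
    negligible against F(x). *)
Lemma moderate_bound (e : R) : 0 < e ->
  exists2 C, 0 < C & \forall x \near +oo, forall n, (0 < n)%N ->
    n%:R * mu <= (1 - e) * x -> G n x <= C * (n%:R * Fb x).
Proof.
move=> e0; pose K := (k + 1) / c.
have K0 : 0 < K by rewrite divr_gt0// addr_gt0// (lt_trans ltr01).
have cK : c * K = k + 1 by rewrite /K; field; rewrite gt_eqF.
have [C C0 hC] := regularly_varying_shift_le Fb_gt0 Fb_rv (divr_gt0 e0 K0).
exists (C + 1); first by rewrite addr_gt0.
have h1 := truncated_bound e0 K0.
have h2 := power_negligible (expR 1) ltr01.
near=> x => n n0 nx.
have x1 : 1 <= x by near: x; exact: nbhs_pinfty_ge.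
have H1 : forall n y, e * x `^ r <= y -> y <= x - n%:R * mu ->
    G n x <= n%:R * Fb (y / K) + expR 1 * x `^ (- (c * K)) by near: x.
apply: (le_trans (H1 n (e * x) _ _)).
- by rewrite ler_pM2l// ler1_powR// ltW.
- lra.
rewrite cK mulrDl mul1r lerD//.
  rewrite mulrCA ler_wpM2l// mulrAC; near: x; exact: hC.
apply: (@le_trans _ _ (1 * Fb x)); first by near: x.
by rewrite ler_wpM2r// ler1n.
Unshelve. all: by end_near. Qed.

(** At distance x^r the jump term is n F(x^r / 2) = O(x^(1 - r p)), because F
    decays faster than the power p. *)
Lemma near_mean_bound : exists2 tau, 0 < tau &
  \forall x \near +oo, forall n, n%:R * mu <= x - x `^ r -> G n x <= x `^ (- tau).
Proof.
exists c => //.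
have h1 := truncated_bound ltr01 (ltr0n R 2).
have [|C C0 hC] := Fb_upper (q := p); first by rewrite (ltW p_gt0) pk.
have hC2 : \forall x \near +oo, Fb (x `^ r / 2) <= C * (x `^ r / 2) `^ (- p).
  have [M M0 HM] := near_pinfty_ge 0 hC.
  have := near_powR_ge (M * 2) r_gt0; apply: filterS => x hx.
  by apply: HM; rewrite ler_pdivlMr.
pose A := mu^-1 * (C * 2^-1 `^ (- p)) + expR 1.
have A0 : 0 < A.
  by rewrite addr_gt0 ?expR_gt0// !mulr_gt0 ?invr_gt0 ?powR_gt0.
have h2 := @near_powR_le_scaled R (- (c * 2)) (- c) A^-1.
have h3 : \forall x \near +oo, x `^ (- (c * 2)) <= A^-1 * x `^ (- c).
  by apply: h2; [rewrite ltrN2 mulr_natr mulr2n ltrDl|rewrite invr_gt0].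
near=> x => n nx.
have x0 : 0 < x by [].
have xr0 : 0 < x `^ r by rewrite powR_gt0.
have H1 : forall n y, 1 * x `^ r <= y -> y <= x - n%:R * mu ->
    G n x <= n%:R * Fb (y / 2) + expR 1 * x `^ (- (c * 2)) by near: x.
apply: (le_trans (H1 n (x `^ r) _ _)); [by rewrite mul1r|lra|].
apply: (@le_trans _ _ (A * x `^ (- (c * 2)))); last first.
  by rewrite -ler_pdivlMl//; near: x.
rewrite /A mulrDl lerD2r.
have H2 : Fb (x `^ r / 2) <= C * (x `^ r / 2) `^ (- p) by near: x.
have n_le : n%:R <= mu^-1 * x by rewrite mulrC ler_pdivlMr//; lra.
apply: (@le_trans _ _ ((mu^-1 * x) * (C * (x `^ r / 2) `^ (- p)))).
  by apply: ler_pM.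
rewrite powRM ?(ltW xr0)// -powRrM.
rewrite le_eqVlt; apply/orP; left; apply/eqP.
have -> : x `^ (- (c * 2)) = x * x `^ (r * - p).
  rewrite -{2}[x](powRr1 (ltW x0)) -powRD ?(gt_eqF x0) ?implybT//.
  by congr powR; rewrite /c; field.
ring.
Unshelve. all: by end_near. Qed.

(** For n <= eps x the mean of S_n is a small part of x, so a single jump must
    come close to x: regular variation compares F((1 - eta) x) with F(x).  Two
    jumps above b contribute (n F(b))^2, which is small against n F(x) because
    x F(x) tends to 0. *)
Lemma one_big_jump_bound (del : R) : 0 < del ->
  exists2 eps, 0 < eps & \forall x \near +oo, forall n,
    n%:R <= eps * x -> G n x <= (1 + del) * (n%:R * Fb x).
Proof.
move=> del0.
have d4 : 0 < del / 4 by rewrite divr_gt0.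
have [eta' /andP[eta'0 eta'1] heta'] := regularly_varying_near1
  Fb_gt0 Fb_rv (lt_trans ltr01 k_gt1) d4.
pose eta := Num.min eta' 2^-1.
have eta0 : 0 < eta by rewrite lt_min eta'0 invr_gt0 ltr0n.
have eta2 : eta <= 2^-1 by rewrite ge_min lexx orbT.
have heta : \forall x \near +oo, Fb ((1 - eta) * x) <= (1 + del / 4) * Fb x.
  near=> x; have x0 : 0 < x by [].
  apply: (@le_trans _ _ (Fb ((1 - eta') * x))); last by near: x.
  by apply: Fb_nonincreasing; rewrite ler_pM2r// lerD2l lerN2 ge_min lexx.
pose eps := eta / 2 / mu.
have eps0 : 0 < eps by rewrite !divr_gt0.
exists eps => //.
pose K := (k + 1) / c + 1.
have kc0 : 0 < (k + 1) / c by rewrite divr_gt0// addr_gt0// (lt_trans ltr01).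
have K0 : 0 < K by rewrite addr_gt0.
have K1 : 1 <= K by rewrite lerDr ltW.
have cK : c * K = k + 1 + c by rewrite /K; field; rewrite gt_eqF.
pose a := eta / 2 / K.
have a0 : 0 < a by rewrite !divr_gt0.
have [C C0 hC] := regularly_varying_shift_le Fb_gt0 Fb_rv a0.
have e20 : 0 < eta / 2 by rewrite divr_gt0.
have hr := remainder_le1 e20 K0.
have hpow := power_negligible (2 * expR 1) d4.
have Ce : 0 < del / 4 / (eps * C) by rewrite !divr_gt0// mulr_gt0.
have hlin := linear_tail_negligible a0 Ce.
near=> x => n nx.
have x1 : 1 <= x by near: x; exact: nbhs_pinfty_ge.
have x0 : 0 < x by rewrite (lt_le_trans ltr01).
case: n nx => [|n'] nx.
  by rewrite G0 ?mul0r ?mulr0// ltW.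
set n := n'.+1 in nx *.
have n1 : 1 <= n%:R :> R by rewrite ler1n.
have nmu : n%:R * mu <= eta / 2 * x.
  by move: nx; rewrite /eps [eta / 2 / mu * x]mulrAC ler_pdivlMr.
pose y := eta / 2 * x.
pose b := y / K.
have y0 : 0 < y by rewrite mulr_gt0.
have b0 : 0 < b by rewrite divr_gt0.
have bE : b = a * x by rewrite /b /y /a mulrAC.
have lx0 : 0 <= ln x by rewrite ln_ge0.
have s0 : 0 <= s_of x b by rewrite /s_of divr_ge0 ?(ltW b0)// mulr_ge0// ltW.
have by_ : b <= y by rewrite /b ler_pdivrMr// ler_peMr// ltW.
pose z := (1 - eta) * x.
have yz : y <= z by rewrite /y /z ler_pM2r//; lra.
have bz : b <= z := le_trans by_ yz.
have FbaC : Fb b <= C * Fb x by rewrite bE; near: x; exact: hC.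
have rem : remainder n b (s_of x b) <= 1.
  have H : forall n y, n%:R * mu <= x -> eta / 2 * x `^ r <= y ->
    remainder n (y / K) (s_of x (y / K)) <= 1 by near: x.
  apply: H; first by apply: (le_trans nmu); rewrite ler_piMl ?ltW//; lra.
  by rewrite ler_pM2l// ler1_powR// ltW.
have expo (u : R) : y <= u - n%:R * mu ->
    expR (- s_of x b * (u - n%:R * mu) + remainder n b (s_of x b)) <=
    expR 1 * x `^ (- (c * K)).
  move=> yu; rewrite /powR (gt_eqF x0) -expRD ler_expR addrC lerD//.
  rewrite !mulNr lerN2 (_ : c * K * ln x = s_of x b * y) ?ler_wpM2l//.
  by rewrite /s_of /b; field; rewrite !gt_eqF.
have cKk : expR 1 * x `^ (- (c * K)) <= expR 1 * x `^ (- (k + 1)).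
  by rewrite ler_pM2l ?expR_gt0// ler_powR// lerN2 cK lerDl ltW.
have hp : 2 * expR 1 * x `^ (- (k + 1)) <= del / 4 * Fb x by near: x.
have E1 : expR (- s_of x b * (x - z - n%:R * mu) + remainder n b (s_of x b)) <=
    del / 8 * Fb x.
  apply: (le_trans (expo _ _)); first by rewrite /y /z; lra.
  by apply: (le_trans cKk); lra.
have E2 : expR (- s_of x b * (x - n%:R * mu) + remainder n b (s_of x b)) <=
    del / 8 * Fb x.
  apply: (le_trans (expo _ _)); last by apply: (le_trans cKk); lra.
  rewrite /y; have : eta * x <= 2^-1 * x by rewrite ler_pM2r.
  by move: nmu; rewrite /y; lra.
have hz : Fb z <= (1 + del / 4) * Fb x by rewrite /z; near: x.
have hl : x * Fb (a * x) <= del / 4 / (eps * C) by near: x.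
have nFb : n%:R * Fb b <= del / 4 / C.
  apply: (@le_trans _ _ (eps * (x * Fb (a * x)))).
    by rewrite bE mulrA ler_wpM2r.
  rewrite (_ : del / 4 / C = eps * (del / 4 / (eps * C))); last first.
    by field; rewrite !gt_eqF.
  by rewrite ler_pM2l.
apply: (le_trans (G_one_big_jump _ _ b0 s0 bz)).
have Fx0 : 0 <= Fb x by [].
have n0 : 0 <= n%:R :> R by [].
have T1 : n%:R * Fb z <= n%:R * ((1 + del / 4) * Fb x) by rewrite ler_wpM2l.
have T2 : (n%:R * Fb b) ^+ 2 <= n%:R * (del / 4 * Fb x).
  rewrite expr2 -mulrA [Fb b * _]mulrC; apply: ler_wpM2l => //.
  apply: (@le_trans _ _ (del / 4 / C * (C * Fb x))).
    by apply: ler_pM => //; exact: mulr_ge0.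
  by rewrite mulrA divfK// gt_eqF.
have T3 : n%:R * Fb b * expR (- s_of x b * (x - z - n%:R * mu) + remainder n b (s_of x b))
    <= n%:R * (del / 8 * Fb x).
  rewrite -mulrA; apply: ler_wpM2l => //.
  apply: (@le_trans _ _ (1 * (del / 8 * Fb x))); last by rewrite mul1r.
  by apply: ler_pM => //; exact: expR_ge0.
have T4 : expR (- s_of x b * (x - n%:R * mu) + remainder n b (s_of x b))
    <= n%:R * (del / 8 * Fb x).
  apply: (le_trans E2); rewrite ler_peMl//.
  by rewrite mulr_ge0// divr_ge0// ltW.
have -> : (1 + del) * (n%:R * Fb x) = n%:R * ((1 + del / 4) * Fb x) +
   n%:R * (del / 4 * Fb x) + n%:R * (del / 8 * Fb x) + n%:R * (del / 8 * Fb x)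
   + n%:R * (del / 4 * Fb x) by field.
have T5 : 0 <= n%:R * (del / 4 * Fb x) by rewrite !mulr_ge0// ltW.
lra.
Unshelve. all: by end_near. Qed.

(** Inclusion-exclusion: 1 - (1 - F(x))^n is n F(x) up to (n F(x))^2, and
    n F(x) tends to 0 for n = O(x). *)
Lemma lower_bound_small (del eps : R) : 0 < del -> 0 < eps ->
  \forall x \near +oo, forall n, n%:R <= eps * x ->
    (1 - del) * (n%:R * Fb x) <= G n x.
Proof.
move=> d0 e0.
have de : 0 < del / eps by rewrite divr_gt0.
have h := linear_tail_negligible ltr01 de.
near=> x => n nx.
have x0 : 0 < x by [].
have hx : x * Fb x <= del / eps by rewrite -{2}[x]mul1r; near: x.
have nF : n%:R * Fb x <= del.
  apply: (@le_trans _ _ (eps * (x * Fb x))); first by rewrite mulrA ler_wpM2r.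
  by rewrite mulrC -ler_pdivlMr.
apply: le_trans (G_lower n x).
have u0 := Fb_ge0 x; have u1 := Fb_le1 x; move: nF; set u := Fb x in u0 u1 *.
(* A Bonferroni inequality, by induction. *)
have bern (N : nat) : (1 - u) ^+ N <= 1 - N%:R * u + (N%:R * u) ^+ 2.
  elim: N => [|N IH]; first by rewrite expr0 mul0r subr0 expr0n addr0.
  rewrite exprS -natr1.
  apply: (@le_trans _ _ ((1 - u) * (1 - N%:R * u + (N%:R * u) ^+ 2))).
    by rewrite ler_wpM2l// subr_ge0.
  have N0 : 0 <= N%:R * u by rewrite mulr_ge0.
  have : 0 <= (N%:R * u) * u by rewrite mulr_ge0.
  have : 0 <= u * (N%:R * u) ^+ 2 by rewrite mulr_ge0// sqr_ge0.
  have : 0 <= u * u by rewrite mulr_ge0.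
  rewrite mulrDl mul1r !expr2; lra.
move=> nF; have := bern n; rewrite expr2.
have N0 : 0 <= n%:R * u by rewrite mulr_ge0.
have : n%:R * u * (n%:R * u) <= del * (n%:R * u) by rewrite ler_wpM2r.
lra.
Unshelve. all: by end_near. Qed.

(** Chernoff's bound with s = x^(- r') and 1/p < r' < r, for which s x^r tends
    to infinity while n s^p tends to 0. *)
Lemma lower_tail_bound (del : R) : 0 < del ->
  \forall x \near +oo, forall n, x + x `^ r <= n%:R * mu <= 2 * x ->
    1 - del <= G n x.
Proof.
move=> d0; pose r' := (r + p^-1) / 2.
have pV1 : p^-1 < 1 by rewrite invf_lt1//; case/andP : p12.
have pr : p^-1 < r by rewrite /r; lra.
have r'r : 0 < r - r' by rewrite /r'; lra.
have r'p : 0 < r' * p - 1.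
  by rewrite subr_gt0 -ltr_pdivrMr// div1r /r'; lra.
have h1 := near_powR_ge (1 - ln del) r'r.
pose A := 2 * mp / mu + 1.
have A0 : 0 < A by rewrite ltr_wpDl// divr_ge0 ?mulr_ge0// ltW.
have h2 := near_powRN_le r'p (divr_gt0 ltr01 A0).
near=> x => n /andP[nlo nhi].
have x0 : 0 < x by [].
pose s := x `^ (- r').
have s0 : 0 <= s by rewrite powR_ge0.
rewrite lerBlDr -lerBlDl; apply: (le_trans (G_laplace _ _ s0)).
rewrite -[leRHS]lnK ?posrE// ler_expR.
have e1 : s * (x - n%:R * mu) <= - (1 - ln del).
  apply: (@le_trans _ _ (s * - (x `^ r))); first by rewrite ler_wpM2l//; lra.
  rewrite mulrN lerN2 mulrC /s powRN -powRB; last by rewrite (gt_eqF x0) implybT.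
  by near: x.
have e2 : n%:R * (s `^ p * mp) <= 1.
  have n_le : n%:R <= 2 * x / mu by rewrite ler_pdivlMr.
  apply: (@le_trans _ _ (2 * x / mu * (s `^ p * mp))).
    by rewrite ler_wpM2r// mulr_ge0// powR_ge0.
  have -> : 2 * x / mu * (s `^ p * mp) = (2 * mp / mu) * x `^ (- (r' * p - 1)).
    rewrite opprB addrC powRD ?(gt_eqF x0) ?implybT// (powRr1 (ltW x0)).
    by rewrite /s -powRrM mulNr; ring.
  have hx : x `^ (- (r' * p - 1)) <= 1 / A by near: x.
  apply: (@le_trans _ _ (A * x `^ (- (r' * p - 1)))).
    by rewrite ler_wpM2r ?powR_ge0// lerDl.
  by rewrite mulrC -ler_pdivlMr.
lra.
Unshelve. all: by end_near. Qed.

End large_deviations.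

(** * Geometric weights and gamma *)

Section geometric_weights.
Context (R : realType).
Variable rho : R.
Hypothesis rho01 : 0 < rho < 1.

Let theta := - ln rho.

Let rho_gt0 : 0 < rho. Proof. by case/andP : rho01. Qed.
Let rho_lt1 : rho < 1. Proof. by case/andP : rho01. Qed.
Let rho1_gt0 : 0 < 1 - rho. Proof. by rewrite subr_gt0. Qed.

Lemma neg_ln_gt0 : 0 < theta.
Proof. by rewrite oppr_gt0 ln_lt0. Qed.

Lemma one_minus_le_neg_ln : 1 - rho <= theta.
Proof.
have := @le_ln1Dx R (rho - 1); rewrite ltrBrDr addNr rho_gt0 => /(_ isT).
by rewrite addrCA subrr addr0 /theta; lra.
Qed.

Lemma neg_ln_le : rho * theta <= 1 - rho.
Proof.
have rV : 0 < rho^-1 by rewrite invr_gt0.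
have := @le_ln1Dx R (rho^-1 - 1); rewrite ltrBrDr addNr rV => /(_ isT).
rewrite addrCA subrr addr0 lnV ?posrE// -/theta => h.
by rewrite (le_trans (ler_wpM2l (ltW rho_gt0) h))// mulrBr mulr1 mulfV// gt_eqF.
Qed.

Lemma powR_expR (t : R) : rho `^ t = expR (- (theta * t)).
Proof. by rewrite /powR gt_eqF// /theta mulNr opprK mulrC. Qed.

Lemma expr_powR n : rho ^+ n = rho `^ n%:R.
Proof. by rewrite powR_mulrn// ltW. Qed.

Lemma powR_decreasing (s t : R) : s <= t -> rho `^ t <= rho `^ s.
Proof. by move=> st; rewrite ger_powR// rho_gt0 ltW. Qed.

Lemma exp_decay (u : R) : 1 <= u -> expR (- u) * (1 + u) <= 4 / u.
Proof.
move=> u1; have u0 : 0 < u by rewrite (lt_le_trans ltr01).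
rewrite expRN mulrC ler_pdivrMr ?expR_gt0//.
have h := @expR_ge1Dxn R u 1 (ltW u0).
rewrite mulrAC ler_pdivlMr//.
move: h; rewrite (_ : (2`!)%:R = 2 :> R)// => h.
nra.
Qed.

(** The part of the mean of a geometric variable that comes from its values
    below N. *)
Definition geometric_mean (N : nat) : R :=
  \sum_(0 <= n < N) (1 - rho) * rho ^+ n * n%:R.

Lemma geometric_sum (a b : nat) : (a <= b)%N ->
  \sum_(a <= n < b) (1 - rho) * rho ^+ n = rho ^+ a - rho ^+ b.
Proof.
move=> ab; rewrite -(opprB (rho ^+ b)) -(telescope_sumr (fun n => rho ^+ n) ab) -sumrN.
by apply: eq_bigr => n _; rewrite exprS; ring.
Qed.

Lemma geometric_meanE N : geometric_mean N.+1 =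
  rho / (1 - rho) * (1 - rho ^+ N * (1 + N%:R * (1 - rho))).
Proof.
have h : 1 - rho != 0 by rewrite gt_eqF.
elim: N => [|N IH].
  by rewrite /geometric_mean big_nat1 expr0 mulr0 mul0r addr0 mulr1 subrr mulr0.
rewrite /geometric_mean big_nat_recr//= -/(geometric_mean N.+1) IH -natr1 exprS.
by field.
Qed.

Lemma geometric_mean_ge0 N : 0 <= geometric_mean N.
Proof.
apply: sumr_ge0 => n _; rewrite mulr_ge0// mulr_ge0 ?(ltW rho1_gt0)//.
by rewrite exprn_ge0// ltW.
Qed.

Lemma geometric_mean_le N : geometric_mean N <= rho / (1 - rho).
Proof.
case: N => [|N]; first by rewrite /geometric_mean big_nil divr_ge0// ltW.
rewrite geometric_meanE ler_piMr//; first by rewrite divr_ge0// ltW.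
rewrite gerBl mulr_ge0 ?exprn_ge0 ?(ltW rho_gt0)// addr_ge0// mulr_ge0//.
exact: ltW.
Qed.

Lemma geometric_mean_le_nat N : geometric_mean N <= N%:R.
Proof.
apply: (@le_trans _ _ (\sum_(0 <= n < N) (1 - rho) * rho ^+ n * N%:R)).
  rewrite /geometric_mean !big_nat; apply: ler_sum => n /andP[_ nN].
  apply: ler_wpM2l; last by rewrite ler_nat ltnW.
  by rewrite mulr_ge0 ?exprn_ge0 ?(ltW rho1_gt0) ?(ltW rho_gt0).
rewrite -mulr_suml geometric_sum// expr0 ler_piMl//.
by rewrite gerBl exprn_ge0// ltW.
Qed.

(** Already values of order 1 / theta make up the mean rho / (1 - rho). *)
Lemma geometric_mean_ge (J : nat) : 1 <= theta * J%:R ->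
  (1 - 4 / (theta * J%:R)) * (rho / (1 - rho)) <= geometric_mean J.+1.
Proof.
move=> u1; rewrite geometric_meanE mulrC ler_wpM2l//.
  by rewrite divr_ge0// ltW.
rewrite lerD2l lerN2; apply: le_trans (exp_decay u1).
rewrite expr_powR powR_expR ler_wpM2l ?expR_ge0// lerD2l mulrC ler_wpM2r//.
exact: one_minus_le_neg_ln.
Qed.

Section gamma_bounds.
Variables mu x : R.
Hypothesis mu_gt0 : 0 < mu.
Hypothesis x_ge0 : 0 <= x.

Let m := x / mu.
Let m_ge0 : 0 <= m. Proof. by rewrite divr_ge0// ltW. Qed.

Let gammaE : gamma mu x rho = 1 - rho `^ m * (1 + (1 - rho) * m).
Proof. by rewrite /gamma -/m -[(1 - rho) * x / mu]mulrA -/m; ring. Qed.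

(** With u = - m ln rho one has rho^m (1 + (1 - rho) m) <= exp (- u) (1 + u);
    this comparison also gives [gamma_ge]. *)
Lemma gamma_ge0 : 0 <= gamma mu x rho.
Proof.
rewrite gammaE subr_ge0 powR_expR expRN mulrC ler_pdivrMr ?expR_gt0// mul1r.
apply: le_trans (expR_ge1Dx _); rewrite lerD2l ler_wpM2r//.
exact: one_minus_le_neg_ln.
Qed.

Lemma gamma_le1 : gamma mu x rho <= 1.
Proof.
by rewrite gammaE gerBl mulr_ge0 ?powR_ge0// addr_ge0// mulr_ge0// ltW.
Qed.

Lemma gamma_ge : 1 <= theta * m -> 1 - 4 / (theta * m) <= gamma mu x rho.
Proof.
move=> u1; rewrite gammaE lerD2l lerN2; apply: le_trans (exp_decay u1).
rewrite powR_expR ler_wpM2l ?expR_ge0// lerD2l ler_wpM2r//.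
exact: one_minus_le_neg_ln.
Qed.

(** It makes the first term of the approximation of order x F(x), whatever
    rho. *)
Lemma gamma_le_linear : rho / (1 - rho) * gamma mu x rho <= m.
Proof.
have g_le : gamma mu x rho <= theta * m.
  rewrite gammaE; apply: (@le_trans _ _ (1 - rho `^ m)).
    rewrite lerD2l lerN2 mulrDr mulr1 lerDl mulr_ge0 ?powR_ge0// mulr_ge0//.
    exact: ltW.
  by rewrite powR_expR; have := expR_ge1Dx (- (theta * m)); lra.
apply: (@le_trans _ _ (rho / (1 - rho) * (theta * m))).
  by rewrite ler_wpM2l// divr_ge0// ltW.
rewrite mulrA ler_piMl// mulrAC ler_pdivrMr// mul1r.
exact: neg_ln_le.
Qed.

End gamma_bounds.

End geometric_weights.

(** * The uniform approximation *)

Section relative_errors.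
Context (R : realType).
Variables (del g Q T h : R).
Hypothesis del01 : 0 <= del <= 2^-1.
Hypothesis Q_ge0 : 0 <= Q.
Hypothesis T_ge0 : 0 <= T.

Let close := (1 - 8 * del) * (g * Q + T) <= h /\ h <= (1 + 8 * del) * (g * Q + T).

(** Here and below, Q stands for rho / (1 - rho) P(X_1 > x), g for gamma, T for
    rho^(x / mu), h for the exact tail and F for the contribution of few jumps.
    This is the case where theta x is large against ln x. *)
Lemma relative_error_heavy (F e : R) :
  1 - del <= g <= 1 -> T <= del * Q -> (1 - del) * Q <= F <= Q -> e <= del * Q ->
  (1 - del) * F <= h <= (1 + del) * F + e -> close.
Proof.
case/andP : del01 => d0 d1 /andP[g0 g1] TQ /andP[F0 F1] eQ /andP[h0 h1].
have gQ0 : (1 - del) * Q <= g * Q by rewrite ler_wpM2r.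
have gQ1 : g * Q <= Q by rewrite ler_piMl.
have dQ : 0 <= del * Q by rewrite mulr_ge0.
have ddQ : del * (del * Q) <= 2^-1 * (del * Q) by rewrite ler_wpM2r.
have ddQ0 : 0 <= del * (del * Q) by rewrite mulr_ge0.
split.
  apply: le_trans h0; apply: (@le_trans _ _ ((1 - del) * ((1 - del) * Q))); last first.
    by rewrite ler_wpM2l//; lra.
  have [?|?] := leP 0 (1 - 8 * del).
    apply: (@le_trans _ _ ((1 - 8 * del) * (Q + del * Q))); last lra.
    by rewrite ler_wpM2l// lerD.
  apply: (@le_trans _ _ 0); last by rewrite !mulr_ge0//; lra.
  rewrite mulr_le0_ge0 ?addr_ge0//; first exact: ltW.
  by apply: le_trans gQ0; rewrite mulr_ge0//; lra.
apply: (le_trans h1); apply: (@le_trans _ _ ((1 + 8 * del) * ((1 - del) * Q))).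
  apply: (@le_trans _ _ ((1 + del) * Q + del * Q)); last lra.
  by rewrite lerD// ler_wpM2l//; lra.
by rewrite ler_wpM2l ?ler_wpDr//; lra.
Qed.

(** The case of large theta x with theta x = O(ln x); m bounds the contribution
    of a moderate number of jumps. *)
Lemma relative_error_mixed (F m : R) :
  1 - del <= g <= 1 -> (1 - del) * Q <= F <= Q -> m <= del * Q ->
  (1 - del) * F + (1 - del) ^+ 2 * T <= h <=
    (1 + del) * F + m + (1 + 2 * del) * T -> close.
Proof.
case/andP : del01 => d0 d1 /andP[g0 g1] /andP[F0 F1] mQ /andP[h0 h1].
have gQ0 : (1 - del) * Q <= g * Q by rewrite ler_wpM2r.
have gQ1 : g * Q <= Q by rewrite ler_piMl.
have dS : 0 <= del * (Q + T) by rewrite mulr_ge0 ?addr_ge0.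
have ddS : del * (del * (Q + T)) <= 2^-1 * (del * (Q + T)) by rewrite ler_wpM2r.
have ddS0 : 0 <= del * (del * (Q + T)) by rewrite mulr_ge0.
have dT : 0 <= del * T by rewrite mulr_ge0.
split.
  apply: le_trans h0; apply: (@le_trans _ _ ((1 - del) ^+ 2 * (Q + T))); last first.
    rewrite mulrDr lerD2r expr2 -mulrA ler_wpM2l//; lra.
  have [?|?] := leP 0 (1 - 8 * del).
    apply: (@le_trans _ _ ((1 - 8 * del) * (Q + T))); last by rewrite expr2; lra.
    by rewrite ler_wpM2l// lerD.
  apply: (@le_trans _ _ 0); last by rewrite mulr_ge0 ?sqr_ge0 ?addr_ge0.
  rewrite mulr_le0_ge0 ?addr_ge0//; first exact: ltW.
  by apply: le_trans gQ0; rewrite mulr_ge0//; lra.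
apply: (le_trans h1); apply: (@le_trans _ _ ((1 + 8 * del) * ((1 - del) * (Q + T)))).
  apply: (@le_trans _ _ ((1 + 2 * del) * (Q + T))); last lra.
  have : (1 + del) * F <= (1 + del) * Q by rewrite ler_wpM2l//; lra.
  lra.
by rewrite ler_wpM2l//; lra.
Qed.

(** The case of bounded theta x, in which only T matters. *)
Lemma relative_error_light (F m : R) : 0 <= g ->
  g * Q <= del * T -> 0 <= F -> (1 + del) * F + m <= del * T ->
  (1 - del) * F + (1 - del) ^+ 2 * T <= h <=
    (1 + del) * F + m + (1 + 2 * del) * T -> close.
Proof.
case/andP : del01 => d0 d1 g0 gQ F0 Fm /andP[h0 h1].
have gQ0 : 0 <= g * Q by rewrite mulr_ge0.
have dS : 0 <= del * T by rewrite mulr_ge0.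
have ddS : del * (del * T) <= 2^-1 * (del * T) by rewrite ler_wpM2r.
have ddS0 : 0 <= del * (del * T) by rewrite mulr_ge0.
have dF : 0 <= (1 - del) * F by rewrite mulr_ge0//; lra.
split.
  apply: le_trans h0; apply: (@le_trans _ _ ((1 - del) ^+ 2 * T)); last lra.
  have [?|?] := leP 0 (1 - 8 * del).
    apply: (@le_trans _ _ ((1 - 8 * del) * (del * T + T))); last by rewrite expr2; lra.
    by rewrite ler_wpM2l// lerD.
  apply: (@le_trans _ _ 0); last by rewrite mulr_ge0 ?sqr_ge0.
  by rewrite mulr_le0_ge0 ?addr_ge0//; exact: ltW.
apply: (le_trans h1); apply: (@le_trans _ _ ((1 + 8 * del) * T)); first lra.
by rewrite ler_wpM2l//; lra.
Qed.

End relative_errors.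

Section uniform_approximation.
Context (R : realType).
Variables (Fb : R -> R) (G : nat -> R -> R) (H : R -> R -> R) (k mu r : R).
Hypothesis Fb_ge0 : forall x, 0 <= Fb x.
Hypothesis G_ge0 : forall n x, 0 <= G n x.
Hypothesis mu_gt0 : 0 < mu.
Hypothesis r_ge0 : 0 <= r.
Hypothesis r_lt1 : r < 1.
Hypothesis k_gt0 : 0 < k.
Hypothesis power_negl : forall C e, 0 < e ->
  \forall x \near +oo, C * x `^ (- (k + 1)) <= e * Fb x.
Hypothesis linear_negl : forall e, 0 < e -> \forall x \near +oo, x * Fb x <= e.
Hypothesis moderate : forall e, 0 < e ->
  exists2 C, 0 < C & \forall x \near +oo, forall n, (0 < n)%N ->
    n%:R * mu <= (1 - e) * x -> G n x <= C * (n%:R * Fb x).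
Hypothesis near_mean : exists2 tau, 0 < tau &
  \forall x \near +oo, forall n, n%:R * mu <= x - x `^ r -> G n x <= x `^ (- tau).
Hypothesis small_upper : forall del, 0 < del ->
  exists2 eps, 0 < eps & \forall x \near +oo, forall n,
    n%:R <= eps * x -> G n x <= (1 + del) * (n%:R * Fb x).
Hypothesis small_lower : forall del eps, 0 < del -> 0 < eps ->
  \forall x \near +oo, forall n, n%:R <= eps * x ->
    (1 - del) * (n%:R * Fb x) <= G n x.
Hypothesis beyond_mean : forall del, 0 < del ->
  \forall x \near +oo, forall n, x + x `^ r <= n%:R * mu <= 2 * x ->
    1 - del <= G n x.
Hypothesis H_upper : forall rho N x, 0 < rho < 1 ->
  H rho x <= \sum_(n < N) (1 - rho) * rho ^+ n * G n x + rho ^+ N.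
Hypothesis H_lower : forall rho N x, 0 < rho < 1 ->
  \sum_(n < N) (1 - rho) * rho ^+ n * G n x + rho ^+ N * G N x <= H rho x.

Section weighted_sums.
Variables (rho x : R).
Hypothesis rho01 : 0 < rho < 1.

Let w (n : nat) := (1 - rho) * rho ^+ n.

Let w_ge0 n : 0 <= w n.
Proof.
by case/andP : rho01 => ? ?; rewrite /w mulr_ge0 ?subr_ge0 ?exprn_ge0// ltW.
Qed.

Let A := geometric_mean rho.

Lemma geometric_meanB (a b : nat) : (a <= b)%N ->
  \sum_(a <= n < b) w n * n%:R = A b - A a.
Proof.
by move=> ab; rewrite /A /geometric_mean (@big_cat_nat _ _ _ a 0 b)//= addrC addrK.
Qed.

Lemma weighted_le_linear (c : R) (a b : nat) : (a <= b)%N ->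
  (forall n, (a <= n < b)%N -> G n x <= c * n%:R) ->
  \sum_(a <= n < b) w n * G n x <= c * (A b - A a).
Proof.
move=> ab h; rewrite -geometric_meanB// mulr_sumr !big_nat.
apply: ler_sum => n nab; rewrite mulrCA; apply: ler_wpM2l; first exact: w_ge0.
exact: h.
Qed.

Lemma weighted_ge_linear (c : R) (b : nat) :
  (forall n, (n < b)%N -> c * n%:R <= G n x) ->
  c * A b <= \sum_(0 <= n < b) w n * G n x.
Proof.
move=> h; rewrite /A /geometric_mean mulr_sumr !big_nat.
apply: ler_sum => n nab; rewrite mulrCA; apply: ler_wpM2l; first exact: w_ge0.
exact: h.
Qed.

Lemma weighted_le_const (c : R) (a b : nat) : (a <= b)%N -> 0 <= c ->
  (forall n, (a <= n < b)%N -> G n x <= c) ->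
  \sum_(a <= n < b) w n * G n x <= c * rho ^+ a.
Proof.
move=> ab c0 h; apply: (@le_trans _ _ (c * (rho ^+ a - rho ^+ b))).
  rewrite -geometric_sum// mulr_sumr !big_nat; apply: ler_sum => n nab.
  by rewrite mulrC; apply: ler_wpM2r; [exact: w_ge0|exact: h].
rewrite ler_wpM2l// gerBl exprn_ge0// ltW//; by case/andP : rho01.
Qed.

End weighted_sums.

Lemma near_ln_ge (b : R) : \forall x \near +oo, b <= ln x.
Proof.
apply: (@ge_near_pinfty _ _ (expR b)) => x bx.
by rewrite -ler_expR lnK// posrE (lt_le_trans (expR_gt0 b)).
Qed.

Lemma half_le (y : R) : 2 <= y -> y / 2 <= y - 1.
Proof. lra. Qed.

Lemma half_complement_ge (y : R) : y <= 2^-1 -> 2^-1 <= 1 - y.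
Proof. lra. Qed.

Lemma expR_half_le (u y : R) : 0 <= y <= 1 -> u <= y / 2 -> expR u <= 1 + y.
Proof.
move=> /andP[y0 y1] uy; rewrite -[u]opprK expRN.
have h := expR_ge1Dx (- u).
have h0 : 0 < 1 - u by lra.
apply: (@le_trans _ _ (1 - u)^-1); first by rewrite lef_pV2// posrE ?expR_gt0.
rewrite -[leLHS]mul1r ler_pdivrMr//.
have : (1 + y) * u <= (1 + y) * (y / 2) by rewrite ler_wpM2l//; lra.
have : y * y <= y * 1 by rewrite ler_wpM2l.
lra.
Qed.

(** At a distance e x below the mean, the geometric weight exceeds
    rho^(x / mu) by the factor exp (theta e x / mu), a small power of x that
    x^(- tau) absorbs. *)
Lemma near_mean_exponent (theta x l B e tau N : R) : 0 < theta ->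
  B * e / mu <= tau / 2 -> theta * x <= B * l -> 0 <= l -> 0 <= e ->
  (1 - e) * x / mu <= N ->
  - tau * l + - (theta * N) <= - (tau / 2) * l + - (theta * (x / mu)).
Proof.
move=> t0 Be tx l0 e0 hN.
have h1 : theta * ((1 - e) * x / mu) <= theta * N by rewrite ler_pM2l.
have h2 : theta * x * (e / mu) <= B * l * (e / mu).
  by rewrite ler_wpM2r// divr_ge0// ltW.
have h3 : B * e / mu * l <= tau / 2 * l by rewrite ler_wpM2r.
have e1 : B * l * (e / mu) = B * e / mu * l by ring.
have e2 : theta * ((1 - e) * x / mu) = theta * (x / mu) - theta * x * (e / mu) by ring.
lra.
Qed.

(** The constants are chosen in this order: eps from the range of the one big
    jump; B so large that theta x > B ln x makes rho^(eps x) negligible against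
    F(x); e' so small that near-mean sums stay negligible when
    theta x <= B ln x; C from the moderate range; M so large that theta x >= M
    puts gamma and the geometric mean within d' of their limits, C d' being
    small. *)
Lemma uniform_bounds (del : R) : 0 < del <= 2^-1 ->
  \forall x \near +oo, forall rho, 0 < rho < 1 ->
    (1 - 8 * del) * waiting_tail_approx Fb mu x rho <= H rho x /\
    H rho x <= (1 + 8 * del) * waiting_tail_approx Fb mu x rho.
Proof.
move=> /andP[d0 d2].
have d1 : 0 <= 1 - del by lra.
have d01 : 0 <= del <= 1 by apply/andP; split; lra.
have [eps0 eps00 hsu] := small_upper d0.
have [tau tau0 hnm] := near_mean.
pose eps := Num.min eps0 (mu^-1 / 2).
have eps_gt0 : 0 < eps by rewrite lt_min eps00 divr_gt0// invr_gt0.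
have eps_le0 : eps <= eps0 by rewrite ge_min lexx.
have eps_mu : eps <= mu^-1 / 2 by rewrite ge_min lexx orbT.
pose B := 2 * (k + 1) / eps.
have B0 : 0 < B by rewrite divr_gt0// mulr_gt0// addr_gt0.
have BE : B * eps = 2 * (k + 1) by rewrite /B divfK// gt_eqF.
clearbody B eps.
pose e' := Num.min 2^-1 (tau * mu / (2 * B)).
have e'0 : 0 < e'.
  by rewrite lt_min invr_gt0 ltr0n /=; apply: divr_gt0; exact: mulr_gt0.
have e'2 : e' <= 2^-1 by rewrite ge_min lexx.
have e'B : B * e' / mu <= tau / 2.
  have : e' <= tau * mu / (2 * B) by rewrite ge_min lexx orbT.
  rewrite ler_pdivrMr// => h; apply: (le_trans (ler_wpM2l (ltW B0) h)).
  by rewrite le_eqVlt; apply/orP; left; apply/eqP; field; rewrite gt_eqF.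
clearbody e'.
have [C C0 hmod] := moderate e'0.
pose d' := Num.min del (del / C).
have d'0 : 0 < d' by rewrite lt_min d0 divr_gt0.
have d'd : d' <= del by rewrite ge_min lexx.
have d'C : C * d' <= del.
  by rewrite mulrC -ler_pdivlMr// ge_min lexx orbT.
pose U := 4 / d'.
have U1 : 1 <= U by rewrite /U ler_pdivlMr//; lra.
have U0 : 0 < U by rewrite (lt_le_trans ltr01).
have Ud : 4 / U <= d' by rewrite /U invfM invrK mulrA divff ?mul1r// gt_eqF.
clearbody U d'.
pose M := U * (2 / eps + mu).
have M0 : 0 < M by rewrite mulr_gt0// addr_gt0// divr_gt0.
have Meps : U <= M * (eps / 2).
  have -> : M * (eps / 2) = U + U * mu * eps / 2.
    by rewrite /M; field; rewrite gt_eqF.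
  by rewrite lerDl divr_ge0// mulr_ge0 ?(ltW eps_gt0)// mulr_ge0// ltW.
have Mmu : U <= M / mu.
  by rewrite ler_pdivlMr// /M ler_pM2l// lerDr divr_ge0// ltW.
clearbody M.
pose kap := (C + 2) * (mu^-1 + 1).
have kap0 : 0 < kap by rewrite mulr_gt0 ?addr_gt0// invr_gt0.
have kap_ge : mu^-1 <= kap.
  rewrite /kap mulrDr mulr1 mulrDl; have : 0 < mu^-1 by rewrite invr_gt0.
  by move=> h; rewrite -addrA addrCA mulr_natl mulr2n -!addrA lerDl !addr_ge0// ?mulr_ge0// ltW.
have hsl := small_lower d0 eps00.
have hbm := beyond_mean d0.
have hpow := power_negl 1 d0.
have tau2 : 0 < tau / 2 by rewrite divr_gt0.
have htau := near_powRN_le tau2 d0.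
have r1 : 0 < 1 - r by rewrite subr_gt0.
have del2 : 0 < del / 2 by rewrite divr_gt0.
have hln := @near_powR_ln_le R (1 - r) (B * (mu^-1 + 1)) (del / 2) r1 del2.
have hlnM := near_ln_ge (M / B).
have hlin0 : 0 < del * expR (- (M / mu)) / kap.
  by rewrite divr_gt0// mulr_gt0// expR_gt0.
have hlin := linear_negl hlin0.
have hxr := @near_powR_le_scaled R r 1 (Num.min 2^-1 e') r_lt1.
have hxr' : \forall x \near +oo, x `^ r <= Num.min 2^-1 e' * x `^ 1.
  by apply: hxr; rewrite lt_min e'0 invr_gt0 ltr0n.
near=> x => rho rho01.
have /andP[rho0 rho1] := rho01.
have x1 : 1 <= x by near: x; exact: nbhs_pinfty_ge.
have x0 : 0 < x by rewrite (lt_le_trans ltr01).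
have epsx : 2 <= eps * x.
  by rewrite -ler_pdivrMl//; near: x; exact: nbhs_pinfty_ge.
have mux : mu <= 2^-1 * x.
  by rewrite mulrC -ler_pdivrMr ?invr_gt0//; near: x; exact: nbhs_pinfty_ge.
have xr : x `^ r <= 2^-1 * x /\ x `^ r <= e' * x.
  have : x `^ r <= Num.min 2^-1 e' * x `^ 1 by near: x.
  rewrite (powRr1 (ltW x0)) => h; split; apply: (le_trans h).
    by rewrite ler_pM2r// ge_min lexx.
  by rewrite ler_pM2r// ge_min lexx orbT.
case: xr => xr2 xre.
have Hsu : forall n, n%:R <= eps0 * x -> G n x <= (1 + del) * (n%:R * Fb x) by near: x.
have Hsl : forall n, n%:R <= eps0 * x -> (1 - del) * (n%:R * Fb x) <= G n x by near: x.
have Hmod : forall n, (0 < n)%N -> n%:R * mu <= (1 - e') * x ->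
    G n x <= C * (n%:R * Fb x) by near: x.
have Hnm : forall n, n%:R * mu <= x - x `^ r -> G n x <= x `^ (- tau) by near: x.
have Hbm : forall n, x + x `^ r <= n%:R * mu <= 2 * x -> 1 - del <= G n x by near: x.
have Hpow : 1 * x `^ (- (k + 1)) <= del * Fb x by near: x.
have Htau : x `^ (- (tau / 2)) <= del by near: x.
have Hln : B * (mu^-1 + 1) * (ln x * x `^ (- (1 - r))) <= del / 2 by near: x.
have HlnM : M / B <= ln x by near: x.
have Hlin : x * Fb x <= del * expR (- (M / mu)) / kap by near: x.
pose theta := - ln rho.
have theta0 : 0 < theta := neg_ln_gt0 rho01.
pose Q := rho / (1 - rho) * Fb x.
pose g := gamma mu x rho.
pose T2 := rho `^ (x / mu).
have T2_0 : 0 < T2 by rewrite powR_gt0.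
have g0 : 0 <= g := gamma_ge0 rho01 mu_gt0 (ltW x0).
have g1 : g <= 1 := gamma_le1 rho01 mu_gt0 (ltW x0).
have q0 : 0 <= rho / (1 - rho) by rewrite divr_ge0 ?subr_ge0// ltW.
have Q0 : 0 <= Q by rewrite mulr_ge0.
have DE : waiting_tail_approx Fb mu x rho = g * Q + T2.
  by rewrite /waiting_tail_approx -/g -/T2 /Q; congr (_ + _); ring.
rewrite DE.
pose J := Num.truncn (eps * x).
have /andP[J_le J_lt] : J%:R <= eps * x < J.+1%:R.
  by apply: truncn_itv; rewrite mulr_ge0// ltW.
pose A := geometric_mean rho.
pose a1 := A J.+1.
have a1_0 : 0 <= a1 := geometric_mean_ge0 rho01 _.
have a1_le : a1 <= rho / (1 - rho) := geometric_mean_le rho01 _.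
have Sbig (N : nat) : \sum_(n < N) (1 - rho) * rho ^+ n * G n x =
   \sum_(0 <= n < N) (1 - rho) * rho ^+ n * G n x by rewrite big_mkord.
have small_n (n : nat) : (n < J.+1)%N -> n%:R <= eps0 * x.
  rewrite ltnS => nJ; apply: (@le_trans _ _ J%:R); first by rewrite ler_nat.
  by apply: (le_trans J_le); rewrite ler_pM2r.
have S1_le : \sum_(0 <= n < J.+1) (1 - rho) * rho ^+ n * G n x <= (1 + del) * Fb x * a1.
  have := @weighted_le_linear rho x rho01 ((1 + del) * Fb x) 0 J.+1 (leq0n _).
  rewrite {2}/geometric_mean big_nil subr0; apply => n /andP[_ /small_n/Hsu].
  by rewrite mulrCA mulrC.
have S1_ge : (1 - del) * Fb x * a1 <= \sum_(0 <= n < J.+1) (1 - rho) * rho ^+ n * G n x.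
  apply: (@weighted_ge_linear rho x rho01) => n /small_n/Hsl.
  by rewrite mulrCA mulrC.
have Fb0 := Fb_ge0 x.
have q_ge : rho <= rho / (1 - rho).
  by rewrite ler_pdivlMr ?subr_gt0// ler_piMr ?(ltW rho0)// gerBl ltW.
have J_ge : eps * x / 2 <= J%:R.
  move: J_lt; rewrite -natr1 -ltrBlDr => /ltW; apply: le_trans.
  exact: half_le.
have rhoE (n : nat) : rho ^+ n = expR (- (theta * n%:R)).
  by rewrite expr_powR// powR_expR.
have T2E : T2 = expR (- (theta * (x / mu))) by rewrite /T2 powR_expR.
have saturated : M <= theta * x -> (1 - d') * (rho / (1 - rho)) <= a1 /\ 1 - d' <= g.
  move=> Mx.
  have UJ : U <= theta * J%:R.
    apply: (le_trans Meps); apply: (le_trans (ler_wpM2r _ Mx)).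
      by rewrite divr_ge0// ltW.
    rewrite -mulrA; apply: ler_wpM2l; first exact: ltW.
    by rewrite mulrA (mulrC x).
  have Um : U <= theta * (x / mu).
    apply: (le_trans Mmu); rewrite mulrA; apply: ler_wpM2r => //.
    by rewrite invr_ge0 ltW.
  have frac (t : R) : U <= t -> 1 - d' <= 1 - 4 / t.
    move=> Ut; rewrite lerD2l lerN2; apply: le_trans Ud.
    by rewrite ler_pM2l// lef_pV2// posrE (lt_le_trans U0).
  split.
    apply: le_trans (geometric_mean_ge rho01 (le_trans U1 UJ)).
    by apply: ler_wpM2r => //; exact: frac.
  by apply: le_trans (gamma_ge rho01 _ _ (le_trans U1 Um)); [exact: frac| |]; rewrite ?ltW.
clearbody theta.
have H_ge (N : nat) : (J.+1 <= N)%N -> (1 - del) * Fb x * a1 + rho ^+ N * G N x <= H rho x.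
  move=> JN; apply: le_trans (H_lower N x rho01); rewrite lerD2r Sbig.
  rewrite (@big_cat_nat _ _ _ J.+1)//=; apply: (le_trans S1_ge); rewrite lerDl.
  apply: sumr_ge0 => n _; rewrite mulr_ge0// mulr_ge0 ?exprn_ge0 ?subr_ge0 ?(ltW rho1)//.
  exact: ltW.
have Fa1 : Fb x * a1 <= Q by rewrite /Q mulrC; apply: ler_wpM2r.
have Fa1_0 : 0 <= Fb x * a1 by rewrite mulr_ge0.
have [lnx|lnx] := ltP (B * ln x) (theta * x).
(* The geometric mass beyond eps x, and a fortiori rho^(x / mu), is
   negligible against rho F(x). *)
- have Mx : M <= theta * x.
    by apply: ltW; apply: le_lt_trans lnx; rewrite mulrC -ler_pdivrMr.
  have [a1_ge g_ge] := saturated Mx.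
  have rhoJ : rho ^+ J.+1 <= del * Q.
    have : rho ^+ J <= x `^ (- (k + 1)).
      rewrite rhoE /powR gt_eqF// ler_expR (mulNr (k + 1)) lerN2.
      apply: (@le_trans _ _ (theta * x * (eps / 2))); last first.
        rewrite -mulrA; apply: ler_wpM2l; first exact: ltW.
        by rewrite mulrA (mulrC x).
      apply: (@le_trans _ _ (B * ln x * (eps / 2))).
        rewrite le_eqVlt; apply/orP; left; apply/eqP.
        by transitivity (B * eps * ln x / 2); [rewrite BE; field|field].
      by apply: ler_wpM2r; [rewrite divr_ge0// ltW|exact: ltW].
    move: Hpow; rewrite mul1r => hp hJ.
    rewrite exprS /Q mulrCA; apply: ler_pM => //; first exact: ltW.
      by rewrite exprn_ge0// ltW.
    exact: le_trans hp.
  have T2Q : T2 <= del * Q.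
    apply: le_trans rhoJ; rewrite expr_powR//; apply: powR_decreasing => //.
    apply: (@le_trans _ _ (eps * x + eps * x)).
      by rewrite -natr1 lerD//; apply: le_trans epsx; rewrite ler1n.
    rewrite -mulr2n -mulrnAl mulrC; apply: ler_wpM2l; first exact: ltW.
    by rewrite -mulr_natr -ler_pdivlMr.
  have up := H_upper J.+1 x rho01.
  have lo : (1 - del) * (Fb x * a1) <= H rho x.
    rewrite mulrA; apply: le_trans (H_ge J.+1 (leqnn _)); rewrite lerDl.
    by apply: mulr_ge0 => //; rewrite exprn_ge0// ltW.
  move: up; rewrite Sbig => up.
  have Qa : (1 - del) * Q <= Fb x * a1.
    apply: (@le_trans _ _ ((1 - d') * Q)).
      by apply: ler_wpM2r => //; rewrite lerD2l lerN2.
    by rewrite /Q mulrA mulrC; apply: ler_wpM2l.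
  apply: (@relative_error_heavy _ _ _ _ _ _ _ _ _ (Fb x * a1) (rho ^+ J.+1)) => //.
  + by rewrite (ltW d0).
  + exact: ltW.
  + by rewrite g1 andbT; apply: le_trans g_ge; rewrite lerD2l lerN2.
  + by rewrite Qa Fa1.
  + rewrite lo /=; apply: (le_trans up); rewrite lerD2r mulrA; exact: S1_le.
(* The sum is cut at J, y1, y2 for the upper bound, and y3 is the first level
   at which S_n is beyond x with high probability. *)
- have mu0' : 0 < mu^-1 by rewrite invr_gt0.
  have xr1 : 1 <= x `^ r by rewrite -(powRr0 x) ler_powR.
  have xr0 : 0 <= x `^ r := powR_ge0 x r.
  have divmu (n : nat) y : n%:R <= y / mu -> n%:R * mu <= y by rewrite ler_pdivlMr.
  pose y1 := (1 - e') * x / mu.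
  pose y2 := (x - x `^ r) / mu.
  pose y3 := (x + x `^ r) / mu.
  have e'1 : 0 <= 1 - e' by rewrite subr_ge0 (le_trans e'2)// invf_le1// ler1n.
  have y1_0 : 0 <= y1 by rewrite /y1 !mulr_ge0// ltW.
  have y12 : y1 <= y2.
    by rewrite /y1 /y2 ler_pM2r// mulrBl mul1r lerD2l lerN2.
  have y23 : y2 <= y3.
    by rewrite /y2 /y3 ler_pM2r// lerD2l (le_trans _ xr0)// oppr_le0.
  have y2_0 := le_trans y1_0 y12.
  have y3_0 := le_trans y2_0 y23.
  have Jy1 : eps * x <= y1.
    apply: (@le_trans _ _ (mu^-1 / 2 * x)); first by rewrite ler_pM2r.
    have -> : mu^-1 / 2 * x = 2^-1 * x / mu by rewrite (mulrC mu^-1) mulrAC.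
    by rewrite /y1 !ler_pM2r//; exact: half_complement_ge.
  pose N1 := (Num.truncn y1).+1.
  pose N2 := (Num.truncn y2).+1.
  pose N3 := (Num.truncn y3).+1.
  have JN1 : (J.+1 <= N1)%N by rewrite ltnS; exact: le_truncn.
  have N12 : (N1 <= N2)%N by rewrite ltnS; exact: le_truncn.
  have N23 : (N2 <= N3)%N by rewrite ltnS; exact: le_truncn.
  have below (n : nat) (y : R) : 0 <= y -> (n < (Num.truncn y).+1)%N -> n%:R <= y.
    move=> yge; rewrite ltnS => nN; have /andP[h _] := truncn_itv yge.
    by apply: le_trans h; rewrite ler_nat.
  have above (y : R) : 0 <= y -> y <= (Num.truncn y).+1%:R <= y + 1.
    by move=> yge; have /andP[h /ltW ->] := truncn_itv yge; rewrite -natr1 lerD2r.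
  pose m := C * (Fb x * (A N1 - a1)).
  have S2_le : \sum_(J.+1 <= n < N1) (1 - rho) * rho ^+ n * G n x <= m.
    rewrite /m mulrA; apply: weighted_le_linear => // n /andP[Jn nN1].
    rewrite -mulrA (mulrC (Fb x)); apply: Hmod; first exact: leq_trans Jn.
    by apply: divmu; exact: below.
  have S3_le : \sum_(N1 <= n < N2) (1 - rho) * rho ^+ n * G n x <= del * T2.
    apply: (@le_trans _ _ (x `^ (- tau) * rho ^+ N1)).
      apply: weighted_le_const => //; first exact: powR_ge0.
      move=> n /andP[_ nN2]; apply: Hnm; apply: divmu; exact: below.
    apply: (@le_trans _ _ (x `^ (- (tau / 2)) * T2)); last first.
      by rewrite ler_wpM2r// ltW.
    rewrite rhoE T2E /powR gt_eqF// -!expRD ler_expR.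
    apply: (near_mean_exponent theta0 e'B lnx _ (ltW e'0)).
      by apply: le_trans HlnM; rewrite divr_ge0// ltW.
    by have /andP[] := above _ y1_0.
  (* Replacing x / mu by y2 or y3, and rounding to an integer, changes the
     geometric weight by a factor between exp (- u) and exp u. *)
  pose u := theta * (x `^ r / mu + 1).
  have u_le : u <= del / 2.
    apply: le_trans Hln; rewrite /u.
    apply: (@le_trans _ _ (theta * (x `^ r * (mu^-1 + 1)))).
      apply: ler_wpM2l; first exact: ltW.
      by rewrite mulrDr mulr1 lerD2l.
    have -> : x `^ r = x * x `^ (- (1 - r)).
      by rewrite opprB -[X in X * _](powRr1 (ltW x0)) -powRD ?(gt_eqF x0) ?implybT// addrCA subrr addr0.
    have -> : theta * (x * x `^ (- (1 - r)) * (mu^-1 + 1)) =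
        theta * x * (x `^ (- (1 - r)) * (mu^-1 + 1)) by ring.
    have -> : B * (mu^-1 + 1) * (ln x * x `^ (- (1 - r))) =
        B * ln x * (x `^ (- (1 - r)) * (mu^-1 + 1)) by ring.
    apply: ler_wpM2r => //; rewrite mulr_ge0 ?powR_ge0//.
    by rewrite addr_ge0// ltW.
  have S4_le : rho ^+ N2 <= (1 + del) * T2.
    apply: (@le_trans _ _ (expR u * T2)); last first.
      by apply: ler_wpM2r; [exact: ltW|exact: expR_half_le].
    have /andP[h _] := above _ y2_0.
    rewrite rhoE T2E -expRD ler_expR lerNl opprD opprK /u.
    apply: (@le_trans _ _ (theta * y2)); last by apply: ler_wpM2l => //; exact: ltW.
    have -> : - (theta * (x `^ r / mu + 1)) + theta * (x / mu) = theta * (y2 - 1).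
      by rewrite /y2; ring.
    by apply: ler_wpM2l; [exact: ltW|rewrite gerBl].
  have S5_ge : (1 - del) ^+ 2 * T2 <= rho ^+ N3 * G N3 x.
    rewrite expr2 -mulrA mulrC; apply: ler_pM => //.
    + by rewrite mulr_ge0// ltW.
    + apply: (@le_trans _ _ (expR (- u) * T2)).
        apply: ler_wpM2r; first exact: ltW.
        apply: (le_trans _ (expR_ge1Dx _)); rewrite lerD2l lerN2.
        by apply: (le_trans u_le); rewrite ler_piMr ?(ltW d0)// invf_le1// ler1n.
      have /andP[_ h] := above _ y3_0.
      rewrite rhoE T2E -expRD ler_expR -opprD lerN2 /u -mulrDr.
      apply: ler_wpM2l; first exact: ltW.
      by apply: (le_trans h); rewrite /y3 mulrDl -addrA addrC.
    + apply: Hbm; have /andP[h1 h2] := above _ y3_0.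
      rewrite -ler_pdivrMr// h1 /= -ler_pdivlMr//; apply: (le_trans h2).
      have -> : y3 + 1 = (x + x `^ r + mu) / mu.
        by rewrite [RHS]mulrDl divff// gt_eqF.
      rewrite ler_pM2r// mulr_natl mulr2n -addrA lerD2l.
      by rewrite [X in _ <= X](splitr x) ![x / 2]mulrC lerD.
  have up : H rho x <= (1 + del) * (Fb x * a1) + m + (1 + 2 * del) * T2.
    apply: (le_trans (H_upper N2 x rho01)); rewrite Sbig.
    rewrite (@big_cat_nat _ _ _ N1)//= (@big_cat_nat _ _ _ J.+1)//=.
    have -> : (1 + 2 * del) * T2 = del * T2 + (1 + del) * T2 by ring.
    by rewrite mulrA !addrA -!addrA; do ?apply: lerD.
  have lo : (1 - del) * (Fb x * a1) + (1 - del) ^+ 2 * T2 <= H rho x.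
    apply: le_trans (H_ge N3 (leq_trans JN1 (leq_trans N12 N23))).
    by rewrite mulrA lerD2l.
  have [Mx|Mx] := leP M (theta * x).
  + have [a1_ge g_ge] := saturated Mx.
    apply: (@relative_error_mixed _ _ _ _ _ _ _ _ _ (Fb x * a1) m) => //.
    * by rewrite (ltW d0).
    * exact: ltW.
    * by rewrite g1 andbT; apply: le_trans g_ge; rewrite lerD2l lerN2.
    * rewrite Fa1 andbT; apply: (@le_trans _ _ ((1 - d') * Q)).
        by apply: ler_wpM2r => //; rewrite lerD2l lerN2.
      by rewrite /Q mulrA mulrC; apply: ler_wpM2l.
    * apply: (@le_trans _ _ (C * (d' * Q))); last first.
        by rewrite mulrA; apply: ler_wpM2r.
      rewrite /m ler_pM2l// /Q mulrA (mulrC (Fb x)); apply: ler_wpM2r => //.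
      rewrite lerBlDr; apply: (le_trans (geometric_mean_le rho01 _)).
      by rewrite -[X in X <= _]mul1r -lerBlDl -mulrBl.
    * by rewrite lo up.
  (* All sums over fewer than y1 jumps are O(x F(x)), whereas rho^(x / mu)
     stays above exp (- M / mu). *)
  + have light : kap * (x * Fb x) <= del * T2.
      rewrite mulrC -ler_pdivlMr//; apply: (le_trans Hlin).
      rewrite ler_pM2r ?invr_gt0// ler_pM2l// T2E ler_expR lerN2 mulrA.
      by rewrite ler_pM2r// ltW.
    have AN1 : A N1 <= (mu^-1 + 1) * x.
      apply: (le_trans (geometric_mean_le_nat rho01 _)).
      have /andP[_ h] := above _ y1_0; apply: (le_trans h).
      rewrite mulrDl mul1r lerD// /y1 mulrC ler_pM2l//.
      by rewrite ler_piMl ?(ltW x0)// gerBl ltW.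
    have aA : a1 <= A N1.
      rewrite -subr_ge0 -geometric_meanB//; apply: sumr_ge0 => n _.
      by rewrite mulr_ge0// mulr_ge0 ?exprn_ge0 ?subr_ge0 ?(ltW rho1)// ltW.
    have light1 : (1 + del) * (Fb x * a1) + C * (Fb x * (A N1 - a1)) <= kap * (x * Fb x).
      have -> : kap * (x * Fb x) = (C + 2) * (Fb x * ((mu^-1 + 1) * x)).
        by rewrite /kap; ring.
      apply: (@le_trans _ _ ((C + 2) * (Fb x * A N1))); last first.
        by rewrite ler_pM2l ?addr_gt0//; apply: ler_wpM2l.
      rewrite [X in _ <= X]mulrDl [X in _ <= X]addrC lerD//.
        apply: ler_pM; rewrite ?addr_ge0 ?(ltW d0) ?lerD2l//.
          by apply: (le_trans d2); rewrite invf_le1// ler1n.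
        exact: ler_wpM2l.
      by rewrite ler_pM2l//; apply: ler_wpM2l => //; rewrite gerBl.
    apply: (@relative_error_light _ _ _ _ _ _ _ _ _ (Fb x * a1) m) => //.
    * by rewrite (ltW d0).
    * exact: ltW.
    * apply: le_trans light; rewrite /Q mulrA (mulrC g).
      apply: (@le_trans _ _ (x / mu * Fb x)).
        by apply: ler_wpM2r => //; apply: gamma_le_linear => //; exact: ltW.
      rewrite mulrAC mulrC; apply: ler_wpM2r; first by rewrite mulr_ge0// ltW.
      exact: kap_ge.
    * by rewrite /m; exact: le_trans light1 light.
    * by rewrite lo up.
Unshelve. all: by end_near.
Qed.

End uniform_approximation.

(** * Bounded levels in heavy traffic *)

Lemma bernoulli_le (R : realType) (a : R) n : 0 <= a <= 1 -> 1 - n%:R * a <= (1 - a) ^+ n.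
Proof.
move=> /andP[a0 a1]; elim: n => [|n IH]; first by rewrite mul0r subr0 expr0.
have b0 : 0 <= 1 - a by rewrite subr_ge0.
rewrite exprS; apply: le_trans (ler_wpM2l b0 IH).
rewrite -natr1; have : 0 <= n%:R * a * a by rewrite !mulr_ge0.
lra.
Qed.

(** The terms of first order in 1 - rho cancel in gamma, so one factor 1 - rho
    survives the division. *)
Lemma gamma_le_small (R : realType) (mu rho x : R) : 0 < mu -> 0 < rho < 1 -> 0 <= x ->
  rho / (1 - rho) * gamma mu x rho <= (1 - rho) * (x / mu + (x / mu) ^+ 2).
Proof.
move=> mu_gt0 rho01 x0; have /andP[rho0 rho1] := rho01.
have e0 : 0 < 1 - rho by rewrite subr_gt0.
set m := x / mu; have m0 : 0 <= m by rewrite divr_ge0// ltW.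
set t := - ln rho; have t0 : 0 < t := neg_ln_gt0 rho01.
have t1 : 1 - rho <= t := one_minus_le_neg_ln rho01.
have t2 : rho * t <= 1 - rho := neg_ln_le rho01.
have E_ge : 1 - t * m <= rho `^ m by rewrite powR_expR//; exact: expR_ge1Dx.
clearbody t.
rewrite mulrAC ler_pdivrMr//.
have -> : gamma mu x rho = 1 - rho `^ m * (1 + (1 - rho) * m).
  by rewrite /gamma -/m -[(1 - rho) * x / mu]mulrA -/m; ring.
have h1 : (1 - t * m) * (1 + (1 - rho) * m) <= rho `^ m * (1 + (1 - rho) * m).
  by apply: ler_wpM2r => //; rewrite addr_ge0// mulr_ge0// ltW.
apply: (@le_trans _ _ (rho * (1 - (1 - t * m) * (1 + (1 - rho) * m)))).
  by rewrite ler_pM2l// lerD2l lerN2.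
have h2 : rho * t * (m + (1 - rho) * m ^+ 2) <= (1 - rho) * (m + (1 - rho) * m ^+ 2).
  by apply: ler_wpM2r => //; rewrite addr_ge0// mulr_ge0 ?sqr_ge0// ltW.
rewrite [X in X <= _](_ : _ = rho * t * (m + (1 - rho) * m ^+ 2) - rho * (1 - rho) * m).
  by rewrite lerBlDr; apply: (le_trans h2); rewrite le_eqVlt; apply/orP; left; apply/eqP; ring.
by ring.
Qed.

Lemma relative_error_bounded (R : realType) (del D h : R) : 0 < del <= 2^-1 ->
  1 - del <= D <= 1 + del -> (1 - del) ^+ 2 <= h <= 1 ->
  (1 - 8 * del) * D <= h /\ h <= (1 + 8 * del) * D.
Proof.
move=> /andP[d0 d1] /andP[D0 D1] /andP[h0 h1].
have dd : del * del <= 2^-1 * del by rewrite ler_pM2r.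
have dd0 : 0 <= del * del by rewrite mulr_ge0// ltW.
rewrite expr2 in h0; split.
  have [?|?] := leP 0 (1 - 8 * del).
    have : (1 - 8 * del) * D <= (1 - 8 * del) * (1 + del) by rewrite ler_wpM2l.
    lra.
  apply: (@le_trans _ _ 0); last lra.
  by rewrite mulr_le0_ge0//; lra.
have : (1 + 8 * del) * (1 - del) <= (1 + 8 * del) * D by rewrite ler_wpM2l//; lra.
lra.
Qed.

Lemma half_bound (R : realType) (rho t e : R) : 0 <= t -> 2^-1 <= rho -> rho * t <= e -> t <= 2 * e.
Proof.
move=> t0 r2 h; have : 2^-1 * t <= rho * t by rewrite ler_wpM2r.
lra.
Qed.

Section bounded_range.
Context (R : realType).
Variables (Fb : R -> R) (G : nat -> R -> R) (H : R -> R -> R) (mu : R).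
Hypothesis Fb_ge0 : forall x, 0 <= Fb x.
Hypothesis Fb_le1 : forall x, Fb x <= 1.
Hypothesis mu_gt0 : 0 < mu.
Hypothesis G_lower : forall n x, 1 - (1 - Fb x) ^+ n <= G n x.
Hypothesis H_le1 : forall rho x, H rho x <= 1.
Hypothesis H_nonincreasing : forall rho x y, x <= y -> H rho y <= H rho x.
Hypothesis H_ge : forall rho N x, 0 < rho < 1 -> rho ^+ N * G N x <= H rho x.

(** Some fixed number N of jumps exceeds x0 with probability close to 1, and
    rho^N tends to 1, so the tail tends to 1 uniformly on [0, x0]. *)
Lemma bounded_range_bounds (x0 del : R) : 0 < Fb x0 -> 0 <= x0 -> 0 < del <= 2^-1 ->
  \forall rho \near (1 : R)^'-, forall x, 0 <= x <= x0 ->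
    (1 - 8 * del) * waiting_tail_approx Fb mu x rho <= H rho x /\
    H rho x <= (1 + 8 * del) * waiting_tail_approx Fb mu x rho.
Proof.
move=> F0 x0_ge0 del01; have /andP[d0 d2] := del01.
have [N hN] : exists N, 1 - del <= G N x0.
  have : (fun n => (1 - Fb x0) ^+ n) @ \oo --> (0 : R).
    apply: cvg_expr; rewrite ger0_norm ?subr_ge0//.
    by rewrite gtrBl.
  move/cvgr0Pnorm_le => /(_ _ d0)[N _ /(_ N (leqnn N)) /= hN].
  exists N; apply: le_trans (G_lower N x0); rewrite lerD2l lerN2.
  exact: le_trans (ler_norm _) hN.
pose m0 := x0 / mu.
have m0_ge0 : 0 <= m0 by rewrite divr_ge0// ltW.
(* 1 - rho <= del / K makes every error term below at most del. *)
pose K := N%:R + 2 + 2 * m0 + (m0 + m0 ^+ 2).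
have [K2 KN Km Kmm] : [/\ 2 <= K, N%:R <= K, 2 * m0 <= K & m0 + m0 ^+ 2 <= K].
  have := sqr_ge0 m0; have : (0 : R) <= N%:R by [].
  by rewrite /K => ? ?; split; lra.
have K0 : 0 < K by exact: lt_le_trans K2.
have c0 : 0 < del / K by rewrite divr_gt0.
near=> rho => x /andP[xge xle].
have rho1 : rho < 1 by near: rho; exact: nbhs_left_lt.
have eta_le : 1 - rho <= del / K.
  rewrite lerBlDr -lerBlDl; near: rho; apply: nbhs_left_ge.
  by rewrite gtrBl.
pose eta := 1 - rho.
have eta0 : 0 < eta by rewrite subr_gt0.
have etaK : eta * K <= del by rewrite -ler_pdivlMr.
have part (c : R) : c <= K -> eta * c <= del.
  by move=> cK; apply: le_trans etaK; rewrite ler_pM2l.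
have eta2 : eta * 2 <= del by exact: part.
have rho2 : 2^-1 <= rho by move: eta2; rewrite /eta; lra.
have rho0 : 0 < rho by apply: lt_le_trans rho2.
have rho01 : 0 < rho < 1 by rewrite rho0.
pose m := x / mu.
have m_ge0 : 0 <= m by rewrite divr_ge0// ltW.
have m_le : m <= m0 by rewrite ler_pM2r ?invr_gt0.
have mm : m + m ^+ 2 <= m0 + m0 ^+ 2 by rewrite lerD// lerXn2r ?nnegrE.
apply: relative_error_bounded => //; apply/andP; split.
- apply: (@le_trans _ _ (rho `^ m)); last first.
    rewrite /waiting_tail_approx lerDr !mulr_ge0//.
    + exact: ltW.
    + by rewrite invr_ge0 ltW.
    + exact: gamma_ge0.
  rewrite powR_expR//; apply: (le_trans _ (expR_ge1Dx _)); rewrite lerD2l lerN2.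
  have t2 : - ln rho <= 2 * eta.
    by apply: half_bound rho2 (neg_ln_le rho01); exact: ltW (neg_ln_gt0 rho01).
  apply: (@le_trans _ _ (2 * eta * m0)).
    by apply: ler_pM => //; exact: ltW (neg_ln_gt0 rho01).
  by rewrite (mulrC 2) -mulrA; exact: part.
- rewrite /waiting_tail_approx addrC lerD//.
    by rewrite powR_expR// -expR0 ler_expR oppr_le0 mulr_ge0// ltW// neg_ln_gt0.
  apply: (@le_trans _ _ (rho / (1 - rho) * gamma mu x rho)).
    rewrite ler_piMr// mulr_ge0 ?gamma_ge0// divr_ge0 ?(ltW eta0)//; exact: ltW.
  apply: (le_trans (gamma_le_small mu_gt0 rho01 xge)); rewrite -/eta -/m.
  by apply: part; exact: le_trans mm Kmm.
- apply: le_trans (H_nonincreasing rho xle); apply: le_trans (H_ge N x0 rho01).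
  rewrite expr2; apply: ler_pM => //; rewrite ?subr_ge0 ?(le_trans d2) ?invf_le1 ?ler1n//.
  have etaE : 1 - eta = rho by rewrite opprB addrC subrK.
  have eta01 : 0 <= eta <= 1 by rewrite (ltW eta0) -subr_ge0 etaE ltW.
  have := bernoulli_le N eta01; rewrite etaE; apply: le_trans.
  by rewrite lerD2l lerN2 mulrC; exact: part.
- exact: H_le1.
Unshelve. all: by end_near.
Qed.

End bounded_range.

Section suprema.
Context (R : realType) (I J : Type) (F : set_system I) (S : set J) (f : I -> J -> R).
Context {FF : Filter F}.

Lemma ereal_sup_cvg0 : S !=set0 -> (forall i j, 0 <= f i j) ->
  (forall e, 0 < e -> \forall i \near F, forall j, S j -> f i j <= e) ->
  ereal_sup [set (f i j)%:E | j in S] @[i --> F] --> 0%E.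
Proof.
move=> [j0 Sj0] f_ge0 f_le.
have sup_ge0 i : (0 <= ereal_sup [set (f i j)%:E | j in S])%E.
  apply: (@le_trans _ _ (f i j0)%:E); first by rewrite lee_fin.
  by apply: ereal_sup_ubound; exists j0.
have sup_le i e : (forall j, S j -> f i j <= e) ->
    (ereal_sup [set (f i j)%:E | j in S] <= e%:E)%E.
  by move=> h; apply: ge_ereal_sup => _ [j Sj <-]; rewrite lee_fin; exact: h.
have fin i e : (forall j, S j -> f i j <= e) ->
    ereal_sup [set (f i j)%:E | j in S] \is a fin_num.
  move=> h; rewrite ge0_fin_numE//; apply: le_lt_trans (ltry e).
  exact: sup_le.
apply/fine_cvgP; split.
  by have := f_le 1 ltr01; apply: filterS => i; exact: fin.
apply/cvgr0Pnorm_le => e e0; have := f_le e e0; apply: filterS => i h /=.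
by rewrite ger0_norm ?fine_ge0// -lee_fin fineK ?(fin _ _ h)//; exact: sup_le.
Qed.

End suprema.

Lemma relative_error_le (R : realType) (del D h : R) : 0 < D ->
  (1 - 8 * del) * D <= h -> h <= (1 + 8 * del) * D -> `|h / D - 1| <= 8 * del.
Proof.
move=> D0 lo up; rewrite ler_norml; apply/andP; split.
  by rewrite lerBrDr addrC ler_pdivlMr.
by rewrite lerBlDr addrC ler_pdivrMr.
Qed.

Lemma waiting_tail_approx_gt0 (R : realType) (Fb : R -> R) (mu x rho : R) :
  0 < mu -> 0 <= Fb x -> 0 < rho < 1 -> 0 <= x -> 0 < waiting_tail_approx Fb mu x rho.
Proof.
move=> mu0 F0 rho01 x0; have /andP[rho0 rho1] := rho01.
apply: ltr_wpDl; last by rewrite powR_gt0.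
rewrite mulr_ge0// mulr_ge0 ?gamma_ge0// divr_ge0 ?subr_ge0//; exact: ltW.
Qed.

(** * The waiting times and their suprema *)

Section steady_state.
Context d (T : measurableType d) (R : realType) (P : probability T R).
Variables (rho : R) (V A : nat -> {RV P >-> R}) (W X : {RV P >-> R}).
Hypothesis rho01 : 0 < rho < 1.
Hypothesis V_ge0 : forall n w, 0 <= V n w.
Hypothesis m_gt0 : 0 < mean (V 0%N).
Hypothesis X_density : has_density X (equilibrium_density (V 0%N)).
Hypothesis W_steady : MG1_steady_state_waiting_time (rho / mean (V 0%N)) V A W.

Let Y := positive_part X.

Lemma steady_state_indep (B C D : set R) :
  measurable B -> measurable C -> measurable D ->
  P (W @^-1` B `&` V 0%N @^-1` C `&` A 0%N @^-1` D) =
  (P (W @^-1` B) * P (V 0%N @^-1` C) * P (A 0%N @^-1` D))%E.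
Proof.
move=> mB mC mD; have [_ _ indep _] := W_steady.
pose E (i : option (nat + nat)) : set R :=
  match i with None => B | Some (inl _) => C | Some (inr _) => D end.
have mE i : measurable (E i) by case: i => [[]|].
have := indep [:: None; Some (inl 0%N); Some (inr 0%N)] E isT mE.
rewrite !big_cons big_nil mule1 muleA => <-; congr (P _).
apply/seteqP; split => w /=.
  move=> [[wB wC] wD] i /=.
  by rewrite !inE => /or3P[] /eqP ->.
move=> h; split; first split.
- by have := h None; apply; rewrite /= !inE.
- by have := h (Some (inl 0%N)); apply; rewrite /= !inE.
- by have := h (Some (inr 0%N)); apply; rewrite /= !inE.
Qed.

Lemma steady_state_stationary (B : set R) : measurable B ->
  P ((fun w => Num.max (W w + V 0%N w - A 0%N w) 0) @^-1` B) = P (W @^-1` B).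
Proof. by move=> mB; have [_ _ _ /(_ 1%N B mB)] := W_steady. Qed.

Lemma tail_function_tail : tail_function (tail W).
Proof.
split; last 2 first.
- by move=> x; rewrite tail_ge0 tail_le1.
- exact: tail_nonincreasing.
by apply: nonincreasing_measurable => // x y; exact: tail_nonincreasing.
Qed.

Lemma waiting_tail_lt0 (x : R) : x < 0 -> tail W x = 1.
Proof.
move=> x0; apply/eqP; rewrite eq_le tail_le1 /=.
rewrite -lee_fin /tail fineK ?fin_num_measure// ccdf_1_cdf.
rewrite [cdf W x](_ : _ = 0%E) ?sube0//; apply/eqP.
rewrite eq_le measure_ge0 andbT -(stationary_lt0 steady_state_stationary).
rewrite /cdf /distribution /pushforward.
apply: le_measure; rewrite ?inE; [exact: measurable_funPTI..|].
by move=> w /=; rewrite !in_itv/= => h; exact: le_lt_trans x0.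
Qed.

Lemma waiting_tail_renewal (x : R) : 0 <= x -> tail W x = rho * step Y (tail W) x.
Proof.
move=> x0; have [_ A_exp _ _] := W_steady; have /andP[rho0 _] := rho01.
have lam0 : 0 < rho / mean (V 0%N) by rewrite divr_gt0.
rewrite [LHS]/tail (renewal_equation lam0 m_gt0 (A_exp 0%N) (V_ge0 0%N) (@positive_part_ge0 _ _ _ _ X)
  steady_state_indep steady_state_stationary (positive_part_equilibrium m_gt0 X_density) x0).
rewrite divfK ?gt_eqF// fineM//; last first.
  rewrite -(_ : \int[P]_w (tail W (x - Y w))%:E = \int[P]_w ccdf W (x - Y w))%E.
    by apply: integrable_fin_num => //; exact: integrable_translate tail_function_tail.
  by apply: eq_integral => w _; rewrite /tail fineK// fin_num_measure.
rewrite /step /Rintegral; congr (_ * fine _).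
by apply: eq_integral => w _; rewrite /tail fineK// fin_num_measure.
Qed.

End steady_state.

Section jump_sums.
Context d (T : measurableType d) (R : realType) (P : probability T R).
Variables (Y : {RV P >-> R}) (p : R).
Hypothesis Y_ge0 : forall w, 0 <= Y w.
Hypothesis p12 : 1 < p <= 2.
Hypothesis Y_integrable : P.-integrable setT (EFin \o Y).
Hypothesis Yp_integrable : P.-integrable setT (EFin \o (fun w => Y w `^ p)).

Let mu := \int[P]_w Y w.
Let mp := \int[P]_w (Y w `^ p).
Let G := jump_tail Y.

Let p12' : 1 <= p <= 2.
Proof. by case/andP : p12 => /ltW -> ->. Qed.

Lemma moment_ge0 : 0 <= mp.
Proof. by apply: Rintegral_ge0 => w _; exact: powR_ge0. Qed.

Let M (b s : R) := expR (s * mu + s ^+ 2 * b `^ (2 - p) * expR (s * b) * mp).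

Let M_ge1 b s : 0 <= s -> 1 <= M b s.
Proof.
move=> s0; have mu0 : 0 <= mu by apply: Rintegral_ge0.
rewrite -expR0 ler_expR addr_ge0 ?mulr_ge0 ?moment_ge0 ?sqr_ge0 ?powR_ge0//.
Qed.

Let M_power (n : nat) (x b s : R) : expR (- s * x) * M b s ^+ n =
  expR (- s * (x - n%:R * mu) + remainder p mp n b s).
Proof. by rewrite -expRM_natl -expRD /remainder; congr expR; ring. Qed.

Lemma jump_tail_le_truncated n (x b s : R) : 0 < b -> 0 <= s ->
  G n x <= n%:R * tail Y b + expR (- s * (x - n%:R * mu) + remainder p mp n b s).
Proof.
move=> b0 s0; rewrite -M_power; apply: jump_tail_truncated => //; first exact: M_ge1.
exact: truncated_mgf_le.
Qed.

Lemma jump_tail_le_one_big_jump n (x z b s : R) : 0 < b -> 0 <= s -> b <= z ->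
  G n x <= n%:R * tail Y z + (n%:R * tail Y b) ^+ 2 +
    n%:R * tail Y b * expR (- s * (x - z - n%:R * mu) + remainder p mp n b s) +
    expR (- s * (x - n%:R * mu) + remainder p mp n b s).
Proof.
move=> b0 s0 bz; rewrite -!M_power; apply: jump_tail_one_big_jump => //.
  exact: M_ge1.
exact: truncated_mgf_le.
Qed.

Lemma jump_tail_ge_laplace n (x s : R) : 0 <= s ->
  1 - G n x <= expR (s * (x - n%:R * mu) + n%:R * (s `^ p * mp)).
Proof.
move=> s0; apply: (le_trans (jump_tail_laplace Y_ge0 n x s0)).
have -> : expR (s * (x - n%:R * mu) + n%:R * (s `^ p * mp)) =
    expR (s * x) * expR (- s * mu + s `^ p * mp) ^+ n.
  by rewrite -expRM_natl -expRD; congr expR; ring.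
rewrite ler_wpM2l ?expR_ge0// lerXn2r ?nnegrE ?expR_ge0//.
  by apply: Rintegral_ge0 => w _; exact: expR_ge0.
exact: laplace_le.
Qed.

End jump_sums.

Section geometric_sums.
Context d (T : measurableType d) (R : realType) (P : probability T R).
Variables (Y : {RV P >-> R}) (k : R) (H : R -> R -> R).
Hypothesis Y_ge0 : forall w, 0 <= Y w.
Hypothesis mean_gt0 : 0 < mean Y.
Hypothesis k_gt1 : 1 < k.
Hypothesis Y_gt0 : \forall x \near +oo, 0 < tail Y x.
Hypothesis Y_rv : regularly_varying (tail Y) k.
Hypothesis H_tail : forall rho, 0 < rho < 1 -> tail_function (H rho).
Hypothesis H_lt0 : forall rho x, 0 < rho < 1 -> x < 0 -> H rho x = 1.
Hypothesis H_renewal : forall rho x, 0 < rho < 1 -> 0 <= x ->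
  H rho x = rho * step Y (H rho) x.

Lemma integrable_moment (p : R) : 0 < p < k ->
  P.-integrable setT (EFin \o (fun w => Y w `^ p)).
Proof.
move=> /andP[p0 pk].
apply: (@integrable_powR_of_tail _ _ _ _ _ p ((p + k) / 2)) => //.
  by rewrite p0/=; lra.
apply: (regularly_varying_upper _ Y_gt0 Y_rv); first exact: tail_nonincreasing.
by apply/andP; split; lra.
Qed.

Lemma integrable_heavy_tail : P.-integrable setT (EFin \o Y).
Proof.
have := @integrable_moment 1; rewrite ltr01 k_gt1 => /(_ isT).
by apply: eq_integrable => // w _ /=; rewrite powRr1.
Qed.

Lemma geometric_sum_bounds (del : R) : 0 < del <= 2^-1 ->
  \forall x \near +oo, forall rho, 0 < rho < 1 ->
    (1 - 8 * del) * waiting_tail_approx (tail Y) (mean Y) x rho <= H rho x /\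
    H rho x <= (1 + 8 * del) * waiting_tail_approx (tail Y) (mean Y) x rho.
Proof.
move=> del01.
pose p := Num.min 2 ((1 + k) / 2).
have p12 : 1 < p <= 2.
  by rewrite lt_min ge_min lexx /= ltr1n /= andbT ltr_pdivlMr// mul1r mulr2n ltrD2l.
have pk : p < k by rewrite gt_min ltr_pdivrMr// mulr_natr mulr2n ltrD2r k_gt1 orbT.
clearbody p; have /andP[p1 p2] := p12.
have int1 := integrable_heavy_tail.
have intp := @integrable_moment p; rewrite (lt_trans ltr01 p1) pk in intp.
move: intp => /(_ isT) intp.
have meanE : mean Y = \int[P]_w Y w by rewrite /mean unlock.
have mu0 : 0 < \int[P]_w Y w by rewrite -meanE.
have mp0 := @moment_ge0 _ _ _ P Y p.
have p0 := lt_trans ltr01 p1.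
have pV : p^-1 < 1 by rewrite invf_lt1.
have pV0 : 0 < p^-1 by rewrite invr_gt0.
have nonincr := @tail_nonincreasing _ _ _ P Y.
have truncated := jump_tail_le_truncated Y_ge0 p12 int1 intp.
rewrite meanE.
apply: (@uniform_bounds _ (tail Y) (jump_tail Y) H k _ ((1 + p^-1) / 2)) => //.
- exact: tail_ge0.
- exact: jump_tail_ge0.
- lra.
- lra.
- lra.
- exact: (power_negligible nonincr Y_gt0 Y_rv p12 pk).
- move=> e e0; have := linear_tail_negligible nonincr Y_gt0 Y_rv p12 pk ltr01 e0.
  by apply: filterS => x; rewrite mul1r.
- exact: (moderate_bound nonincr (@tail_ge0 _ _ _ _ Y) Y_gt0 Y_rv p12 pk mu0 mp0 truncated).
- exact: (near_mean_bound nonincr (@tail_ge0 _ _ _ _ Y) Y_gt0 Y_rv p12 pk mu0 mp0 truncated).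
- apply: (one_big_jump_bound nonincr (@tail_ge0 _ _ _ _ Y) (@tail_le1 _ _ _ _ Y)
    Y_gt0 Y_rv p12 pk mu0 mp0).
    by move=> x x0; rewrite jump_tail0 ltNge x0.
  exact: jump_tail_le_one_big_jump.
- exact: (lower_bound_small nonincr (@tail_ge0 _ _ _ _ Y) (@tail_le1 _ _ _ _ Y)
    Y_gt0 Y_rv p12 pk (jump_tail_lower Y_ge0)).
- exact: (lower_tail_bound p12 mu0 mp0 (jump_tail_ge_laplace Y_ge0 p12 int1 intp)).
- move=> rho N x rho01; apply: (renewal_upper Y_ge0 rho01 (H_tail rho01)).
    by move=> y; exact: H_lt0.
  by move=> y; exact: H_renewal.
- move=> rho N x rho01; apply: (renewal_lower Y_ge0 rho01 (H_tail rho01)).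
    by move=> y; exact: H_lt0.
  by move=> y; exact: H_renewal.
Qed.

End geometric_sums.

Lemma mean_gt0 d (T : measurableType d) (R : realType) (P : probability T R)
    (Z : {RV P >-> R}) (x : R) : (forall w, 0 <= Z w) ->
  P.-integrable setT (EFin \o Z) -> 0 < x -> 0 < tail Z x -> 0 < mean Z.
Proof.
move=> Z_ge0 Z_int x0 tx; apply: (@lt_le_trans _ _ (x * tail Z x)).
  exact: mulr_gt0.
rewrite -Rintegral_gt_indic -RintegralZl//; last exact: integrable_gt_indic.
rewrite /mean unlock; apply: le_Rintegral => //.
  have := integrableZl measurableT x (integrable_gt_indic Z x).
  by apply: eq_integrable => // w _ /=; rewrite EFinM.
move=> w _; case: ltP => [/ltW|_]; rewrite ?mulr1 ?mulr0//.
Qed.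

Lemma regularly_varying_eq (R : realType) (f g : R -> R) (k : R) :
  (forall x, 0 <= x -> f x = g x) -> regularly_varying f k -> regularly_varying g k.
Proof.
move=> fg f_rv t t0; apply: cvg_trans (f_rv t t0); apply: near_eq_cvg.
near=> x; have x0 : 0 <= x by near: x; exact: nbhs_pinfty_ge.
by rewrite !fg// mulr_ge0// ltW.
Unshelve. all: by end_near.
Qed.

Theorem theorem2p2 (R : realType) (d : measure_display) (T : measurableType d)
    (P : probability T R)
    (V X : nat -> {RV P >-> R})
    (A : R -> nat -> {RV P >-> R})
    (W : R -> {RV P >-> R})
    (alpha : R) (L : R -> R)
    (V_iid : iid V)
    (V_ge0 : forall n w, 0 <= V n w)
    (W_steady : forall rho, 0 < rho < 1 ->
       MG1_steady_state_waiting_time (rho / mean (V 0%N)) V (A rho) (W rho))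
    (X_iid : iid X)
    (X_density : forall n, has_density (X n) (equilibrium_density (V 0%N)))
    (alpha_gt2 : 2 < alpha)
    (L_sv : slowly_varying L)
    (V_tail : asymp_equal (tail (V 0%N)) (fun x => L x * x `^ (- alpha))) :
  let mu := mean (X 0%N) in
  let rel_error (rho x : R) :=
    `|tail (W rho) x / waiting_tail_approx (tail (X 0%N)) mu x rho - 1| in
  [/\ ('E_P[X 0%N] =
         (fine 'E_P[fun w => (V 0%N w ^+ 2)%R] / (2 * mean (V 0%N)))%:E)%E,
      ereal_sup [set (rel_error rho x)%:E | rho in `]0, 1[] @[x --> +oo]
        --> 0%E &
      ereal_sup [set (rel_error rho x)%:E | x in `[0, +oo[] @[rho --> 1^'-]
        --> 0%E].
Proof.
move=> mu rel_error.
have V0_ge0 := V_ge0 0%N; have X0_density := X_density 0%N.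
have [V_tail_gt0 V_rv] := asymp_regularly_varying L_sv V_tail.
have alpha1 : 1 < alpha by apply: lt_trans alpha_gt2; rewrite ltr1n.
have V_int := integrable_heavy_tail V0_ge0 alpha1 V_tail_gt0 V_rv.
have V2_int : P.-integrable setT (EFin \o (fun w => V 0%N w ^+ 2)).
  have := @integrable_moment _ _ _ _ _ _ V0_ge0 V_tail_gt0 V_rv 2.
  rewrite ltr0n alpha_gt2 => /(_ isT); apply: eq_integrable => // w _ /=.
  by rewrite powR_mulrn.
have m_gt0 : 0 < mean (V 0%N).
  have [x x0 /(_ x (lexx x)) tx] := near_pinfty_ge 0 V_tail_gt0.
  exact: (@mean_gt0 _ _ _ _ _ x).
set Y := positive_part (X 0%N).
have Y_ge0 : forall w, 0 <= Y w := @positive_part_ge0 _ _ _ _ (X 0%N).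
have tailY x : 0 <= x -> tail Y x = tail (X 0%N) x := @tail_positive_part _ _ _ _ (X 0%N) x.
have muE : mu = mean Y by rewrite /mu /mean (expectation_positive_part X0_density).
have Y_tail_gt0 x : 0 <= x -> 0 < tail Y x.
  by move=> x0; rewrite tailY//; exact: (equilibrium_tail_gt0 V0_ge0 V_int m_gt0 X0_density V_tail_gt0).
have k_gt1 : 1 < alpha - 1 by lra.
have Y_rv : regularly_varying (tail Y) (alpha - 1).
  apply: regularly_varying_eq
    (equilibrium_regularly_varying V0_ge0 V_int m_gt0 X0_density V_tail_gt0 V_rv).
  by move=> x x0; rewrite tailY.
have Y_near_gt0 : \forall x \near +oo, 0 < tail Y x.
  by apply: (@ge_near_pinfty _ _ 0) => x; exact: Y_tail_gt0.
have mu_gt0 : 0 < mu.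
  rewrite muE; apply: (@mean_gt0 _ _ _ _ _ 1) => //; last exact: Y_tail_gt0.
  exact: integrable_heavy_tail Y_ge0 k_gt1 Y_near_gt0 Y_rv.
have approxE x rho : 0 <= x -> waiting_tail_approx (tail (X 0%N)) mu x rho =
    waiting_tail_approx (tail Y) (mean Y) x rho.
  by move=> x0; rewrite muE /waiting_tail_approx tailY.
have rel_error_le del rho x : 0 < rho < 1 -> 0 <= x ->
    (1 - 8 * del) * waiting_tail_approx (tail Y) (mean Y) x rho <= tail (W rho) x /\
    tail (W rho) x <= (1 + 8 * del) * waiting_tail_approx (tail Y) (mean Y) x rho ->
    rel_error rho x <= 8 * del.
  move=> rho01 x0 [lo up]; rewrite /rel_error approxE//; apply: relative_error_le => //.
  by apply: waiting_tail_approx_gt0 => //; rewrite -?muE// tail_ge0.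
have W_lt0 rho x : 0 < rho < 1 -> x < 0 -> tail (W rho) x = 1.
  by move=> rho01; exact: (waiting_tail_lt0 (W_steady _ rho01)).
have W_renewal rho x : 0 < rho < 1 -> 0 <= x ->
    tail (W rho) x = rho * step Y (tail (W rho)) x.
  by move=> rho01; exact: (waiting_tail_renewal rho01 V_ge0 m_gt0 X0_density (W_steady _ rho01)).
have W_tail rho : tail_function (tail (W rho)) by exact: tail_function_tail.
have Ymean_gt0 : 0 < mean Y by rewrite -muE.
have far (del : R) := geometric_sum_bounds Y_ge0 Ymean_gt0 k_gt1 Y_near_gt0
  Y_rv (fun rho _ => W_tail rho) W_lt0 W_renewal (del := del).
have del_of (e : R) : 0 < e -> exists2 del, 0 < del <= 2^-1 & 8 * del <= e.
  move=> e0; exists (Num.min 2^-1 (e / 8)).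
    by rewrite lt_min ge_min lexx invr_gt0 ltr0n divr_gt0.
  by rewrite mulrC -ler_pdivlMr// ge_min lexx orbT.
split.
- exact: equilibrium_mean.
- apply: (@ereal_sup_cvg0 _ _ _ _ _ (fun x rho => rel_error rho x)) =>
    [|x rho|e /del_of[del del01 dele]].
    by exists 2^-1; rewrite /= in_itv/= invr_gt0 ltr0n invf_lt1// ltr1n.
    exact: normr_ge0.
  near=> x => rho /=; rewrite in_itv/= => rho01; apply: le_trans dele.
  have x0 : 0 <= x by near: x; exact: nbhs_pinfty_ge.
  apply: (rel_error_le _ _ _ rho01 x0).
  by move: rho rho01; near: x; exact: far.
- apply: (@ereal_sup_cvg0 _ _ _ _ _ rel_error) =>
    [|rho x|e /del_of[del del01 dele]].
    by exists 0; rewrite /= in_itv/= lexx.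
    exact: normr_ge0.
  have [x0 x0_ge0 far_x0] : exists2 x0, 0 <= x0 & forall x, x0 <= x ->
      forall rho, 0 < rho < 1 ->
      (1 - 8 * del) * waiting_tail_approx (tail Y) (mean Y) x rho <= tail (W rho) x /\
      tail (W rho) x <= (1 + 8 * del) * waiting_tail_approx (tail Y) (mean Y) x rho.
    have [M M0 hM] := near_pinfty_ge 0 (far del del01).
    by exists M; [exact: ltW|exact: hM].
  have W_ge rho N x : 0 < rho < 1 -> rho ^+ N * jump_tail Y N x <= tail (W rho) x.
    move=> rho01.
    apply: le_trans (renewal_lower Y_ge0 rho01 (W_tail rho) (fun y => W_lt0 rho y rho01)
      (fun y => W_renewal rho y rho01) N x).
    rewrite lerDr; apply: sumr_ge0 => n _; have /andP[rho0 rho1] := rho01.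
    by rewrite mulr_ge0 ?jump_tail_ge0// mulr_ge0 ?exprn_ge0 ?subr_ge0// ltW.
  near=> rho => x /=; rewrite in_itv/= andbT => x_ge0.
  have rho01 : 0 < rho < 1.
    by apply/andP; split; near: rho; [exact: nbhs_left_gt|exact: nbhs_left_lt].
  apply: le_trans dele; apply: rel_error_le => //.
  have [xx0|xx0] := leP x0 x; first exact: far_x0.
  have : 0 <= x <= x0 by rewrite x_ge0 ltW.
  move: x {x_ge0 xx0}; near: rho.
  apply: (@bounded_range_bounds _ (tail Y) (jump_tail Y) (fun rho => tail (W rho))) => //.
  + by move=> y; exact: tail_ge0.
  + by move=> y; exact: tail_le1.
  + exact: jump_tail_lower.
  + by move=> rho y; exact: tail_le1.
  + by move=> rho y z; exact: tail_nonincreasing.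
  + exact: Y_tail_gt0.
Unshelve. all: by end_near.
Qed.
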